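(* For every $\alpha\in\mathbb{C}^l$, the creative intertwining vertex operator $\mathcal{Y}$ for the $M^l$-module $M_\alpha$ is given, for all $u\otimes e^\alpha\in M_\alpha$, by $$\mathcal{Y}(u\otimes e^\alpha,z)=e^{\alpha\cdot q}\,c_\alpha\,Y_-(\alpha,z)\,Y(u,z)\,Y_+(\alpha,z)\,z^{\alpha(0)},$$ where $c_\alpha=\mathrm{Id}_{M^l}$.
   Context: Fix $l\ge 1$. $M^l$ is the rank $l$ Heisenberg vertex operator algebra, generated by weight one vectors $a^1,\dots,a^l$ whose modes satisfy $[a^i(n),a^j(m)]=n\,\delta_{n,-m}\delta_{i,j}$; it is spanned by the vectors $a^{i_1}(-k_1)\cdots a^{i_r}(-k_r)\mathbf{1}$, $k_j>0$, with Virasoro vector $\omega=\frac12\sum_i a^i(-1)^2\mathbf{1}$. For $\alpha\in\mathbb{C}^l$, $M_\alpha=M^l\otimes e^\alpha$ is the irreducible $M^l$-module with $a^i(0)(u\otimes e^\alpha)=\alpha^i(u\otimes e^\alpha)$ and $a^i(n)(u\otimes e^\alpha)=(a^i(n)u)\otimes e^\alpha$ for $n\neq 0$; $M_0=M^l$ and $u\otimes e^0$ is written $u$. For $u\in M^l$, $Y(u,z)=\sum_n u(n)z^{-n-1}$ denotes the (module) vertex operator. Put $\alpha(n)=\sum_i\alpha^ia^i(n)$ and $Y_\pm(\alpha,z)=\exp\big(\mp\sum_{n>0}\frac{\alpha(\pm n)}{n}z^{\mp n}\big)$. The operators $q^i$ are formal conjugates with $[a^i(n),q^j]=\delta_{n,0}\delta_{i,j}$,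 $\alpha\cdot q=\sum_i\alpha^iq^i$, and $e^{\alpha\cdot q}$ acts by $e^{\alpha\cdot q}u=u\otimes e^\alpha$. Creative intertwining vertex operator: for a vertex operator algebra $V$ and a $V$-module $(W,Y_W)$ it is a linear map $\mathcal{Y}:W\to\mathrm{Lin}(V,W)[[z,z^{-1}]]$, $\mathcal{Y}(w,z)=\sum_{n\in\mathbb{Z}}w(n)z^{-n-1}$, such that $\mathcal{Y}(w,z)\mathbf{1}=w+O(z)$ for all $w\in W$; $w(n)v=0$ for $n\gg0$ for each $v\in V$, $w\in W$; and for all $u\in V$, $w\in W$ $$z_0^{-1}\delta\left(\tfrac{z_1-z_2}{z_0}\right)Y_W(u,z_1)\mathcal{Y}(w,z_2)-z_0^{-1}\delta\left(\tfrac{z_2-z_1}{-z_0}\right)\mathcal{Y}(w,z_2)Y(u,z_1)=z_2^{-1}\delta\left(\tfrac{z_1-z_0}{z_2}\right)\mathcal{Y}(Y_W(u,z_0)w,z_2),$$ with $\delta(x/y)=\sum_{n\in\mathbb{Z}}x^ny^{-n}$ and binomials expanded in nonnegative powers of the second variable. Here $V=M^l$, $W=M_\alpha$.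
   Formalization: The listed axioms do not determine the operator ((1+z)Y(w,z) satisfies them too), so the L(-1)-derivative property Y(L(-1)w,z)=d/dz Y(w,z) is added to the definition of creative intertwining vertex operator; the formula is shown to satisfy it and all listed axioms. *)

(* Defs.v *)
From HB Require Import structures.
From mathcomp Require Import all_boot all_order all_algebra.
From mathcomp Require Import finmap.
From mathcomp.multinomials Require Import monalg.
From mathcomp Require Import complex.
From mathcomp Require Import mathcomp_extra boolp classical_sets functions
  cardinality fsbigop reals.

Set Implicit Arguments.
Unset Strict Implicit.
Unset Printing Implicit Defensive.

Import Order.TTheory GRing.Theory Num.Theory.

Local Open Scope classical_set_scope.
Local Open Scope ring_scope.

(** * Formal series of operators *)

(* [A : fser V W] is the bilateral series [\sum_n A n z^n] with coefficients
   maps from V to W: the integer is the exponent of z.  The mode A(n), i.e.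
   the coefficient of z^(-n-1), is [mode A n]. *)
Definition fser (V W : Type) := int -> V -> W.

Definition mode (V W : Type) (A : fser V W) (n : int) : V -> W :=
  A (- n - 1).

Section FormalSeries.
Variable F : fieldType.

(* [\sum_(k \in [set: int])] is the sum of a finitely supported family; all
   the compositions below are locally finite. *)
Definition fmul (U V W : lmodType F) (A : fser V W) (B : fser U V) :
    fser U W :=
  fun n v => \sum_(k \in [set: int]) A k (B (n - k) v).

Definition fone (V : lmodType F) : fser V V :=
  fun n v => if n == 0 then v else 0.

Definition fexp (V : lmodType F) (A : fser V V) : fser V V :=
  fun n v => \sum_(r \in [set: nat])
    (r`!%:R)^-1 *: iter r (fmul A) (@fone V) n v.

Definition fderiv (V W : lmodType F) (A : fser V W) : fser V W :=
  fun n v => (n + 1)%:~R *: A (n + 1) v.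

Definition fderivn (V W : lmodType F) (k : nat) (A : fser V W) : fser V W :=
  fun n v => (k`!%:R)^-1 *: iter k (@fderiv V W) A n v.

(* The normally ordered product :A(z)B(z): = A(z)_+ B(z) + B(z) A(z)_-,
   where A(z)_+ collects the nonnegative powers of z in A(z) and A(z)_- the
   negative ones. *)
Definition fnormal (V : lmodType F) (A B : fser V V) : fser V V :=
  let Areg : fser V V := fun n v => if 0 <= n then A n v else 0 in
  let Asing : fser V V := fun n v => if 0 <= n then 0 else A n v in
  fun n v => fmul Areg B n v + fmul B Asing n v.

(** * Creative intertwining vertex operators *)

(* Coefficient families of formal distributions in z_0, z_1, z_2: [D (a, b, c)]
   is the coefficient of z_0^a z_1^b z_2^c. *)
Definition fdist3 (W : Type) := int * int * int -> W.

Definition fmul3 (W : lmodType F) (D : fdist3 F) (G : fdist3 W) : fdist3 W :=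
  fun k => \sum_(k' \in [set: int * int * int]) D (k - k') *: G k'.

Definition gbin (n : int) (j : nat) : F :=
  (\prod_(i < j) (n - i%:Z)%:~R) / j`!%:R.

(* Coefficient of x^p y^q in (x - y)^n, expanded in nonnegative powers of y. *)
Definition binexp (n p q : int) : F :=
  if q is Posz j then
    if p + q == n then (-1) ^+ j * gbin n j else 0
  else 0.

(* z_0^-1 delta((z_1 - z_2)/z_0) = \sum_n z_0^(-n-1) (z_1 - z_2)^n *)
Definition delta_12 : fdist3 F :=
  fun k => let: (a, b, c) := k in binexp (- a - 1) b c.

(* z_0^-1 delta((z_2 - z_1)/(-z_0))
     = \sum_n (-1)^n z_0^(-n-1) (z_2 - z_1)^n *)
Definition delta_21 : fdist3 F :=
  fun k => let: (a, b, c) := k in (-1) ^ (- a - 1) * binexp (- a - 1) c b.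

(* z_2^-1 delta((z_1 - z_0)/z_2) = \sum_n z_2^(-n-1) (z_1 - z_0)^n *)
Definition delta_10 : fdist3 F :=
  fun k => let: (a, b, c) := k in binexp (- c - 1) b a.

Section Intertwiner.
Variables (V W : lmodType F) (vac : V) (Y : V -> fser V V)
  (YW : V -> fser W W).

Definition jacobi (Yc : W -> fser V W) : Prop :=
  forall (u : V) (w : W) (v : V) (k : int * int * int),
    fmul3 delta_12
      (fun k' => let: (a, b, c) := k' in
         if a == 0 then YW u b (Yc w c v) else 0) k
    - fmul3 delta_21
      (fun k' => let: (a, b, c) := k' in
         if a == 0 then Yc w c (Y u b v) else 0) k
    = fmul3 delta_10
      (fun k' => let: (a, b, c) := k' in
         if b == 0 then Yc (YW u a w) c v else 0) k.

Record creative_intertwiner (Yc : W -> fser V W) : Prop := {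
  ci_linear_l : forall n v, linear (fun w => Yc w n v);
  ci_linear_r : forall w n, linear (Yc w n);
  ci_creative : forall w,
    Yc w 0 vac = w /\ (forall n : int, n < 0 -> Yc w n vac = 0);
  ci_truncated : forall w v, exists N : int, forall n : int,
    N <= n -> mode (Yc w) n v = 0;
  ci_jacobi : jacobi Yc }.

(* The L(-1)-derivative property Yc(L(-1)w, z) = d/dz Yc(w, z), with
   L(-1) = omega(0).  It does not follow from [creative_intertwiner]: if Yc is
   a creative intertwining vertex operator, so is (1 + z) Yc(-, z). *)
Definition L_derivative (omega : V) (Yc : W -> fser V W) : Prop :=
  forall w n v, Yc (mode (YW omega) 0 w) n v = fderiv (Yc w) n v.

End Intertwiner.
End FormalSeries.

(** * The Heisenberg vertex operator algebra and its modules *)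

Section Heisenberg.
Variables (F : fieldType) (l : nat).
Unset Implicit Arguments.

(* The variable (i, k) of the polynomial algebra stands for a^i(-k-1), so the
   monomials are the vectors a^(i_1)(-k_1) ... a^(i_r)(-k_r) 1. *)
Definition fock := {malg F[{cmonom ('I_l * nat)%type}]}.

(* M_alpha = M^l (x) e^alpha; the vector u (x) e^alpha is represented by u. *)
Definition heis_mod (alpha : 'rV[F]_l) := fock.

Definition vacuum : heis_mod 0 := (1 : {malg F[{cmonom ('I_l * nat)%type}]}).

Definition expq (alpha : 'rV[F]_l) (u : heis_mod 0) : heis_mod alpha := u.

Definition fock_creation (i : 'I_l) (k : nat) (u : fock) : fock :=
  (<< ucm (i, k) >> : {malg F[{cmonom ('I_l * nat)%type}]}) * u.

(* (k+1) times the partial derivative with respect to the variable (i, k) *)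
Definition fock_annihilation (i : 'I_l) (k : nat) (u : fock) : fock :=
  \sum_(m <- msupp u)
    (u@_m * (k.+1 * m (i, k))%:R) *: (<< divcm m (ucm (i, k)) >> : fock).

Definition heis (alpha : 'rV[F]_l) (i : 'I_l) (n : int)
    (u : heis_mod alpha) : heis_mod alpha :=
  match n with
  | Posz 0 => alpha 0 i *: u
  | Posz k.+1 => fock_annihilation i k u
  | Negz k => fock_creation i k u
  end.

Definition heis_field (alpha : 'rV[F]_l) (i : 'I_l) :
    fser (heis_mod alpha) (heis_mod alpha) :=
  fun n => heis alpha i (- n - 1).

(* the variables of a monomial, repeated according to multiplicity *)
Definition mon_vars (m : {cmonom ('I_l * nat)%type}) : seq ('I_l * nat) :=
  flatten [seq nseq (m x) x | x <- finsupp m].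

(* For u = a^(i_1)(-k_1-1) ... a^(i_r)(-k_r-1) 1,
     Y(u, z) = :(1/k_1! d^k_1/dz^k_1 a^(i_1)(z)) ...
                  (1/k_r! d^k_r/dz^k_r a^(i_r)(z)):
   with the normally ordered product nested from the right. *)
Definition Ymon (alpha : 'rV[F]_l) (m : {cmonom ('I_l * nat)%type}) :
    fser (heis_mod alpha) (heis_mod alpha) :=
  foldr (fun x B => fnormal (fderivn x.2 (heis_field alpha x.1)) B)
    (@fone F (heis_mod alpha)) (mon_vars m).

(* The action on M_alpha of the vertex operator of u in M^l. *)
Definition Yheis (alpha : 'rV[F]_l) (u : heis_mod 0) :
    fser (heis_mod alpha) (heis_mod alpha) :=
  fun n v => \sum_(m <- msupp (u : fock)) (u : fock)@_m *: Ymon alpha m n v.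

Definition omega : heis_mod 0 :=
  2%:R^-1 *: \sum_(i < l) heis 0 i (-1) (heis 0 i (-1) vacuum).

(* the operator alpha(n) on M_beta *)
Definition alpha_mode (alpha beta : 'rV[F]_l) (n : int)
    (u : heis_mod beta) : heis_mod beta :=
  \sum_(i < l) alpha 0 i *: heis beta i n u.

Definition Yminus (alpha beta : 'rV[F]_l) :
    fser (heis_mod beta) (heis_mod beta) :=
  fexp (V := heis_mod beta) (fun n u =>
    if 0 < n then (n%:~R)^-1 *: alpha_mode alpha beta (- n) u else 0).

Definition Yplus (alpha beta : 'rV[F]_l) :
    fser (heis_mod beta) (heis_mod beta) :=
  fexp (V := heis_mod beta) (fun n u =>
    if n < 0 then - (((- n)%:~R)^-1 *: alpha_mode alpha beta (- n) u) else 0).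

(* z^(alpha(0)): alpha(0) is the scalar alpha . beta on M_beta, so the
   coefficient of z^n is the projection onto the eigenspace of alpha(0) with
   eigenvalue n.  This is all of z^(alpha(0)) when alpha . beta is an integer,
   in particular on M^l = M_0. *)
Definition zpow_alpha0 (alpha beta : 'rV[F]_l) :
    fser (heis_mod beta) (heis_mod beta) :=
  fun n u => if \sum_(i < l) alpha 0 i * beta 0 i == n%:~R then u else 0.

Definition c_alpha (alpha : 'rV[F]_l) (u : heis_mod 0) : heis_mod 0 := u.

(* e^(alpha.q) c_alpha Y_-(alpha, z) Y(u, z) Y_+(alpha, z) z^(alpha(0)) *)
Definition heis_intertwiner (alpha : 'rV[F]_l) (u : heis_mod 0) :
    fser (heis_mod 0) (heis_mod alpha) :=
  fun n v => expq alpha (c_alpha alpha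
    (fmul (Yminus alpha 0) (fmul (Yheis 0 u)
      (fmul (Yplus alpha 0) (zpow_alpha0 alpha 0))) n v)).

Definition heis_creative_intertwiner (alpha : 'rV[F]_l)
    (Yc : heis_mod alpha -> fser (heis_mod 0) (heis_mod alpha)) : Prop :=
  creative_intertwiner (V := heis_mod 0) (W := heis_mod alpha)
    vacuum (Yheis 0) (Yheis alpha) Yc.

Definition heis_L_derivative (alpha : 'rV[F]_l)
    (Yc : heis_mod alpha -> fser (heis_mod 0) (heis_mod alpha)) : Prop :=
  L_derivative (V := heis_mod 0) (W := heis_mod alpha)
    (Yheis alpha) omega Yc.

End Heisenberg.

Set Implicit Arguments.
Arguments heis_mod {F l} alpha.
Arguments expq {F l} alpha u.
Arguments heis {F l} alpha i n u.
Arguments heis_field {F l} alpha i.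
Arguments Ymon {F l} alpha m.
Arguments Yheis {F l} alpha u.
Arguments alpha_mode {F l} alpha beta n u.
Arguments Yminus {F l} alpha beta.
Arguments Yplus {F l} alpha beta.
Arguments zpow_alpha0 {F l} alpha beta.
Arguments c_alpha {F l} alpha u.
Arguments heis_intertwiner {F l} alpha u.
Arguments heis_creative_intertwiner {F l} alpha Yc.
Arguments heis_L_derivative {F l} alpha Yc.

(* Main.v *)
Require Import Defs.
From HB Require Import structures.
From mathcomp Require Import all_boot all_order all_algebra.
From mathcomp Require Import finmap.
From mathcomp.multinomials Require Import monalg.
From mathcomp Require Import complex.
From mathcomp Require Import boolp classical_sets fsbigop reals.
From mathcomp Require Import ssrAC zify ring.

Set Implicit Arguments.
Unset Strict Implicit.
Unset Printing Implicit Defensive.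

Import Order.TTheory GRing.Theory Num.Theory.
Local Open Scope ring_scope.

(** Throughout, u (x) e^alpha is identified with u.

    Uniqueness. Take u = a^i(-1) 1 in the Jacobi identity. The coefficient of
    z_0^(-1) gives the commutators
      [a^i(n), Yc(w, z)] = sum_j binomial(n, j) z^(n-j) Yc(a^i(j) w, z)
    ([jacobi_comm]), and the coefficient of z_1^(-1) says that
    Yc(a^i(-m-1) w, z) is the normally ordered product of the m-th divided
    derivative of a^i(z) with Yc(w, z) ([jacobi_nord]). As M^l is generated from
    the vacuum by creation operators, Yc is determined by the series
    Yc(e^alpha, z) 1 ([vertex_map_unique]). Since L(-1) e^alpha is
    alpha(-1) e^alpha, the L(-1)-derivative property is a first order linear
    differential equation for this series, whose constant term is e^alpha by
    creativity ([intertwiner_unique]).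

    Existence. Y_- commutes with creation operators and Y_+ with annihilation
    operators, so Y_- Y(u, z) Y_+ inherits from Y the behaviour under normally
    ordered products ([intertwiner_vertex_map]). On the label e^alpha the
    commutator with a^i(n) is multiplication by alpha^i z^n
    ([intertwiner_comm_vac]), and normal ordering propagates the commutator
    formula to all labels ([comm_formula_creation]). The vertex operators on M_0
    and M_alpha are normally ordered products by definition, in any order of the
    factors ([nord_swap], [Yheis_vertex_map]). From these properties the Jacobi
    identity follows by induction on u. For u = 1 it is the identity of delta
    functions ([jac_delta]). If it holds for u, then the three series for the
    label a^i(-m-1) u are obtained from those for u by applying creation
    operators, by replacing v or w by a^i(k) v or a^i(k) w, and by multiplying
    with powers of z_1 and z_0 ([jacobi_at_creation]); these operations preserve
    the identity, because the delta functions identify z_1 with z_2 + z_0 and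
    z_0 with z_1 - z_2 ([jac_z1], [jac_z0]). Creativity is read off from normal
    ordering, and the L(-1)-derivative property follows from the Leibniz rule
    and from the differential equations of the two exponentials
    ([intertwiner_translation]).

    Infinite sums of operators are locally finite throughout, and most of the
    bookkeeping consists in exchanging such sums. The argument is carried out
    over any field of characteristic 0 and for any space with creation and
    annihilation operators as in [fock_model]. *)

(** * Sums of eventually zero sequences *)

Section EventuallyZeroSums.

Definition ev0 (W : nmodType) (f : nat -> W) :=
  exists N, forall k, (N <= k)%N -> f k = 0.

(** Joint vanishing in both indices, which is what exchanging two sums needs. *)
Definition ev02 (W : nmodType) (f : nat -> nat -> W) :=
  exists N, forall j k, (N <= j)%N || (N <= k)%N -> f j k = 0.

(** The sum over all natural numbers, set to 0 on infinite supports; this is the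
    form taken by products and exponentials of series. *)
Definition nsum (W : nmodType) (f : nat -> W) : W :=
  \sum_(k \in [set: nat]%classic) f k.

Section Nmod.
Variable W : nmodType.
Implicit Types f g : nat -> W.

Lemma fsum_seq (T : choiceType) (s : seq T) (f : T -> W) :
  uniq s -> (forall i, i \notin s -> f i = 0) ->
  \sum_(i \in [set: T]%classic) f i = \sum_(i <- s) f i.
Proof.
move=> us f0; rewrite (@fsbigTE _ _ _ _ [fset x in s]%fset); last first.
  by move=> i; rewrite inE => /f0.
apply: perm_big; apply: uniq_perm => //.
by move=> x; rewrite inE.
Qed.

Lemma nsumE N f : (forall k, (N <= k)%N -> f k = 0) ->
  nsum f = \sum_(k < N) f k.
Proof.
move=> f0; rewrite /nsum (fsum_seq (s := iota 0 N)) ?iota_uniq //.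
  by rewrite -(big_mkord xpredT f) /index_iota subn0.
by move=> i; rewrite mem_iota /= add0n -leqNgt => /f0.
Qed.

Lemma eq_nsum f g : f =1 g -> nsum f = nsum g.
Proof. by move=> fg; congr nsum; apply/funext. Qed.

Lemma nsum0 f : (forall k, f k = 0) -> nsum f = 0.
Proof. by move=> f0; rewrite (nsumE (N := 0)) ?big_ord0. Qed.

Lemma nsum1 n f : (forall k, k != n -> f k = 0) -> nsum f = f n.
Proof.
move=> f0; rewrite (nsumE (N := n.+1)).
  rewrite big_ord_recr /= big1 ?add0r // => i _; apply: f0.
  by have := ltn_ord i; lia.
by move=> k nk; apply: f0; lia.
Qed.

Lemma nsumS f : ev0 f -> nsum f = f 0%N + nsum (fun k => f k.+1).
Proof.
move=> [N f0]; rewrite (nsumE (N := N.+1)); last by move=> k /ltnW/f0.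
rewrite big_ord_recl (nsumE (N := N)) // => k Nk.
by apply: f0; lia.
Qed.

Lemma ev0D f g : ev0 f -> ev0 g -> ev0 (fun k => f k + g k).
Proof.
move=> [N f0] [M g0]; exists (maxn N M) => k; rewrite geq_max => /andP[? ?].
by rewrite f0 // g0 // add0r.
Qed.

Lemma ev02_intro (F : nat -> nat -> W) :
  (exists J, forall j k, (J <= j)%N -> F j k = 0) ->
  (forall j, ev0 (F j)) -> ev02 F.
Proof.
move=> [J FJ] Ffin.
have [K FK] : exists K, forall j k, (j < J)%N -> (K <= k)%N -> F j k = 0.
  elim: J {FJ} => [|J [K FK]]; first by exists 0%N.
  have [K' FK'] := Ffin J; exists (maxn K K') => j k.
  rewrite geq_max ltnS leq_eqVlt => /orP[/eqP ->|jJ] /andP[? ?].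
    exact: FK'.
  exact: FK.
exists (maxn J K) => j k; rewrite !geq_max.
case: (leqP J j) => [/FJ -> //|jJ] /= /andP[_]; exact: FK.
Qed.

Lemma ev02_swap (F : nat -> nat -> W) : ev02 F -> ev02 (fun j k => F k j).
Proof. by move=> [N FN]; exists N => j k; rewrite orbC => /FN. Qed.

Lemma ev02_ev0 (F : nat -> nat -> W) j : ev02 F -> ev0 (F j).
Proof. by move=> [N FN]; exists N => k Nk; apply: FN; rewrite Nk orbT. Qed.

Lemma nsum2E N (F : nat -> nat -> W) :
  (forall j k, (N <= j)%N || (N <= k)%N -> F j k = 0) ->
  nsum (fun j => nsum (F j)) = \sum_(j < N) \sum_(k < N) F j k.
Proof.
move=> FN; rewrite (nsumE (N := N)) => [|j Nj].
  by apply: eq_bigr => j _; apply: nsumE => k Nk; apply: FN; rewrite Nk orbT.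
by apply: nsum0 => k; apply: FN; rewrite Nj.
Qed.

Lemma exchange_nsum (F : nat -> nat -> W) : ev02 F ->
  nsum (fun j => nsum (F j)) = nsum (fun k => nsum (fun j => F j k)).
Proof.
move=> [N FN]; rewrite (nsum2E FN) exchange_big (@nsum2E N) // => j k.
by rewrite orbC => /FN.
Qed.

Lemma ev02_ev0_nsum (F : nat -> nat -> W) : ev02 F -> ev0 (fun j => nsum (F j)).
Proof.
by move=> [N FN]; exists N => j Nj; apply: nsum0 => k; apply: FN; rewrite Nj.
Qed.

Lemma nsum_shift j (f : nat -> W) : ev0 f ->
  (forall k, (k < j)%N -> f k = 0) -> nsum f = nsum (fun t => f (j + t)%N).
Proof.
move=> [N f0] fj; rewrite (nsumE (N := j + N)) => [|k jN]; last by apply: f0; lia.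
rewrite big_split_ord /= big1 ?add0r => [|i _]; last exact: fj.
by rewrite (nsumE (N := N)) // => k Nk; apply: f0; lia.
Qed.

Lemma exchange_nsum_shift (f : nat -> nat -> W) : ev02 f ->
  (forall k j, (k < j)%N -> f k j = 0) ->
  nsum (fun k => nsum (f k)) = nsum (fun j => nsum (fun t => f (j + t)%N j)).
Proof.
move=> f0 fkj; rewrite exchange_nsum //; apply: eq_nsum => j.
apply: nsum_shift => [|k]; last exact: fkj.
exact: (ev02_ev0 (F := fun j k => f k j)) (ev02_swap f0).
Qed.

Lemma nsum_diag (F : nat -> nat -> W) : ev02 F ->
  nsum (fun j => nsum (F j)) = nsum (fun t => \sum_(j < t.+1) F j (t - j)%N).
Proof.
move=> finF.
transitivity (nsum (fun j => nsum (fun t => if (j <= t)%N then F j (t - j)%N else 0))).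
  apply: eq_nsum => j; rewrite [RHS](@nsum_shift j).
  - by apply: eq_nsum => t; rewrite leq_addr addKn.
  - have [N FN] := finF; exists (j + N)%N => k jk; case: ifP => // _.
    by apply: FN; apply/orP; right; lia.
  - by move=> k; rewrite ltnNge => /negbTE ->.
rewrite exchange_nsum; last first.
  have [N FN] := finF; exists (N + N)%N => j k H; case: ifP => // jk.
  by apply: FN; lia.
apply: eq_nsum => t; rewrite (nsumE (N := t.+1)) => [|k].
  by apply: eq_bigr => i _; rewrite -ltnS ltn_ord.
by rewrite ltnNge => /negbTE ->.
Qed.

Lemma nsumD f g : ev0 f -> ev0 g ->
  nsum (fun k => f k + g k) = nsum f + nsum g.
Proof.
move=> [N f0] [M g0].
have f0' k : (N + M <= k)%N -> f k = 0 by move=> ?; apply: f0; lia.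
have g0' k : (N + M <= k)%N -> g k = 0 by move=> ?; apply: g0; lia.
rewrite (nsumE f0') (nsumE g0') (nsumE (N := (N + M)%N)) ?big_split // => k Nk.
by rewrite f0' // g0' // addr0.
Qed.

Lemma ev0_sum (T : Type) (s : seq T) (f : T -> nat -> W) :
  (forall i, ev0 (f i)) -> ev0 (fun k => \sum_(i <- s) f i k).
Proof.
move=> ef; elim: s => [|x s [N sN]]; first by exists 0%N => k _; rewrite big_nil.
have [M xM] := ef x; exists (maxn N M) => k; rewrite geq_max => /andP[Nk Mk].
by rewrite big_cons sN // xM // addr0.
Qed.

Lemma nsum_sum (T : Type) (s : seq T) (f : T -> nat -> W) :
  (forall i, ev0 (f i)) ->
  nsum (fun k => \sum_(i <- s) f i k) = \sum_(i <- s) nsum (f i).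
Proof.
move=> ef; elim: s => [|x s IH].
  by rewrite big_nil nsum0 // => k; rewrite big_nil.
rewrite big_cons -IH -nsumD //; last exact: ev0_sum.
by apply: eq_nsum => k; rewrite big_cons.
Qed.

End Nmod.

Lemma nsum_morph (V W : nmodType) (A : V -> W) (f : nat -> V) :
  A 0 = 0 -> {morph A : x y / x + y} -> ev0 f ->
  A (nsum f) = nsum (fun k => A (f k)).
Proof.
move=> A0 AD [N f0]; rewrite (nsumE f0) (nsumE (N := N)) => [|k /f0 -> //].
by rewrite (big_morph A AD A0).
Qed.

Lemma nsumZ (F : fieldType) (V : lmodType F) c (f : nat -> V) : ev0 f ->
  c *: nsum f = nsum (fun k => c *: f k).
Proof. by apply: nsum_morph => [|x y]; rewrite ?scaler0 ?scalerDr. Qed.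

Lemma ev0Z (F : fieldType) (V : lmodType F) (c : nat -> F) (f : nat -> V) :
  ev0 f -> ev0 (fun k => c k *: f k).
Proof. by move=> [N f0]; exists N => k /f0 ->; rewrite scaler0. Qed.

Lemma ev02Z (F : fieldType) (V : lmodType F) (c : nat -> nat -> F)
    (f : nat -> nat -> V) :
  ev02 f -> ev02 (fun j k => c j k *: f j k).
Proof. by move=> [N f0]; exists N => j k /f0 ->; rewrite scaler0. Qed.

Lemma ev0_morph (V W : nmodType) (A : nat -> V -> W) (f : nat -> V) :
  (forall k, A k 0 = 0) -> ev0 f -> ev0 (fun k => A k (f k)).
Proof. by move=> A0 [N f0]; exists N => k /f0 ->. Qed.

End EventuallyZeroSums.

(** * Binomial coefficients *)

(** Both sides are (m + j + t)! / (m! j! t!). *)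
Lemma trinomial m j t :
  ('C(m + (j + t), m) * 'C(j + t, j) = 'C(m + j, m) * 'C(m + j + t, m + j))%N.
Proof.
apply/eqP; rewrite -(@eqn_pmul2r (m`! * (j`! * t`!))); last first.
  by rewrite !muln_gt0 !fact_gt0.
have h1 := @bin_fact (m + (j + t)) m (leq_addr _ _).
have h2 := @bin_fact (j + t) j (leq_addr _ _).
have h3 := @bin_fact (m + j) m (leq_addr _ _).
have h4 := @bin_fact (m + j + t) (m + j) (leq_addr _ _).
rewrite addKn in h1 h2 h3 h4; rewrite addKn in h2; rewrite addKn in h3.
rewrite addKn in h4; apply/eqP; transitivity (m + (j + t))`!.
  by rewrite -h1 -h2; ring.
by rewrite addnA -h4 -h3; ring.
Qed.

Lemma trinomial_sym m k j :
  ('C(m + k, m) * 'C(m + k + j, m + k) = 'C(m + j, m) * 'C(m + j + k, m + j))%N.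
Proof.
rewrite -!trinomial (addnC k j); congr (_ * _)%N.
by rewrite -bin_sub ?leq_addl // addnK.
Qed.

Section Binomials.
Variable F : fieldType.
Hypothesis charF0 : [pchar F] =i pred0.

Lemma natF_neq0 n : (n.+1%:R : F) != 0.
Proof. by move/pcharf0P: charF0 => ->. Qed.

Lemma factF_neq0 n : (n`!%:R : F) != 0.
Proof. by rewrite -(prednK (fact_gt0 n)) natF_neq0. Qed.

Lemma gbin0 n : gbin F n 0 = 1.
Proof. by rewrite /gbin big_ord0 fact0 divr1. Qed.

Lemma gbinS n j : (j.+1)%:R * gbin F n j.+1 = (n - j%:Z)%:~R * gbin F n j.
Proof.
rewrite /gbin big_ord_recr /= factS natrM invfM.
have := natF_neq0 j; have := factF_neq0 j.
by move: (j.+1%:R) (j`!%:R) => a b b0 a0; field; rewrite a0 b0.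
Qed.

Lemma gbin_absorb n j : (j.+1)%:R * gbin F n j.+1 = n%:~R * gbin F (n - 1) j.
Proof.
rewrite /gbin big_ord_recl /= subr0 factS natrM invfM.
rewrite (eq_bigr (fun i : 'I_j => (n - 1 - i%:Z)%:~R)); last first.
  by move=> i _; congr (_%:~R); rewrite /bump /=; lia.
have := natF_neq0 j; have := factF_neq0 j.
by move: (j.+1%:R) (j`!%:R) => a b b0 a0; field; rewrite a0 b0.
Qed.

Lemma gbin_pascal n j : gbin F (n + 1) j.+1 = gbin F n j.+1 + gbin F n j.
Proof.
apply: (mulfI (natF_neq0 j)); rewrite mulrDr [LHS]gbin_absorb gbinS.
rewrite addrK -mulrDl; congr (_ * _).
by rewrite rmorphB /= rmorphD /= -[j.+1]addn1 natrD; ring.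
Qed.

Lemma gbin0S j : gbin F 0 j.+1 = 0.
Proof. by rewrite /gbin big_ord_recl /= subrr mul0r mul0r. Qed.

Lemma gbin_nat n j : gbin F n%:Z j = 'C(n, j)%:R.
Proof.
elim: n j => [|n IH] [|j]; rewrite ?gbin0 ?bin0 //.
  by rewrite gbin0S bin0n.
by rewrite -addn1 PoszD gbin_pascal !IH addn1 binS natrD.
Qed.

Lemma gbin_neg n j : gbin F (- n%:Z - 1) j = (-1) ^+ j * 'C(n + j, j)%:R.
Proof.
elim: j => [|j IH]; first by rewrite gbin0 bin0 mulr1.
apply: (mulfI (natF_neq0 j)); rewrite gbinS IH.
have h : (j.+1 * 'C(n + j.+1, j.+1) = (n + j.+1) * 'C(n + j, j))%N.
  by have := mul_bin_diag (n + j.+1) j; rewrite addnS /= => <-.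
rewrite [RHS]mulrCA -[in RHS]natrM h natrM exprS.
rewrite (_ : - n%:Z - 1 - j%:Z = - (n + j.+1)%N%:Z); last by lia.
by rewrite rmorphN /= -pmulrn; ring.
Qed.

Lemma sign_gbin_neg n t :
  (-1) ^+ t * gbin F (- n.+1%:Z) t = 'C(n + t, n)%:R.
Proof.
rewrite (_ : - n.+1%:Z = - n%:Z - 1); last by lia.
rewrite gbin_neg mulrA -exprMn mulrNN mulr1 expr1n mul1r.
by rewrite -[in RHS]bin_sub ?leq_addr // addKn.
Qed.

(** Upper negation. *)
Lemma gbin_opp b j : gbin F (- b - 1) j = (-1) ^+ j * gbin F (b + j%:Z) j.
Proof.
case: b => [n|q].
  by rewrite gbin_neg // -PoszD gbin_nat.
rewrite (_ : - Negz q - 1 = q%:Z); last by lia.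
rewrite gbin_nat //; have [qj|jq] := ltnP q j.
  rewrite bin_small // (_ : Negz q + j%:Z = (j - q.+1)%N%:Z); last by lia.
  by rewrite gbin_nat // bin_small ?mulr0 //; lia.
rewrite (_ : Negz q + j%:Z = - (q - j)%N%:Z - 1); last by lia.
by rewrite gbin_neg // mulrA -exprMn mulrNN mulr1 expr1n mul1r subnK.
Qed.

(** Pascal's rule turns the identity at n into the identity at n + 1 and back, so
    it spreads from n = 0 to all integers. *)
Lemma vandermonde n m k :
  \sum_(i < k.+1) gbin F n i * gbin F m (k - i)%N = gbin F (n + m) k.
Proof.
have step x : (forall k, \sum_(i < k.+1) gbin F x i * gbin F m (k - i)%N =
      gbin F (x + m) k) <->
    (forall k, \sum_(i < k.+1) gbin F (x + 1) i * gbin F m (k - i)%N =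
      gbin F (x + 1 + m) k).
  have S j : \sum_(i < j.+2) gbin F (x + 1) i * gbin F m (j.+1 - i)%N =
     \sum_(i < j.+2) gbin F x i * gbin F m (j.+1 - i)%N +
     \sum_(i < j.+1) gbin F x i * gbin F m (j - i)%N.
    rewrite big_ord_recl [in RHS]big_ord_recl !gbin0 -addrA; congr (_ + _).
    rewrite -big_split /=; apply: eq_bigr => i _.
    by rewrite !subSS -mulrDl -gbin_pascal.
  have B y : \sum_(i < 1) gbin F y i * gbin F m (0 - i)%N = gbin F (y + m) 0%N.
    by rewrite big_ord1 !gbin0 mulr1.
  have e : x + 1 + m = x + m + 1 by ring.
  split=> H; first by case=> [|j]; rewrite ?B // S !H e gbin_pascal.
  elim=> [|j IH]; first exact: B.
  by have := S j; rewrite H e gbin_pascal IH => /addIr.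
elim/int_rec: n k => [|n IH|n IH]; first 1 last.
- by rewrite -addn1 PoszD; exact: (step _).1.
- apply: (step _).2 => k; rewrite (_ : - n.+1%:Z + 1 = - n%:Z); first exact: IH.
  by lia.
move=> k; rewrite big_ord_recl gbin0 mul1r add0r subn0 big1 ?addr0 // => i _.
by rewrite gbin0S mul0r.
Qed.

End Binomials.

(** * Powers of a binomial acting on series in two variables *)

Section LinearMaps.
Variables (F : fieldType) (V W : lmodType F) (A : V -> W).
Hypothesis linA : linear A.

Lemma lin0 : A 0 = 0.
Proof. by have := linA (-1) 0 0; rewrite !scaleN1r !oppr0 add0r addNr. Qed.

Lemma linD : {morph A : x y / x + y}.
Proof. by move=> x y; have := linA 1 x y; rewrite !scale1r. Qed.

Lemma linZ c : {morph A : x / c *: x}.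
Proof. by move=> x; have := linA c x 0; rewrite lin0 !addr0. Qed.

Lemma linB : {morph A : x y / x - y}.
Proof. by move=> x y; rewrite -scaleN1r linD linZ scaleN1r. Qed.

Lemma lin_nsum (f : nat -> V) : ev0 f -> A (nsum f) = nsum (fun k => A (f k)).
Proof. by apply: nsum_morph; [exact: lin0 | exact: linD]. Qed.

Lemma lin_ev0 (f : nat -> V) : ev0 f -> ev0 (fun k => A (f k)).
Proof. by move=> [N f0]; exists N => k /f0 ->; rewrite lin0. Qed.

End LinearMaps.

Lemma linear_scale (F : fieldType) (W : lmodType F) c : linear (fun x : W => c *: x).
Proof. by move=> k x y; rewrite scalerDr !scalerA mulrC. Qed.

Section BinomialAction.
Variable F : fieldType.
Hypothesis charF0 : [pchar F] =i pred0.
Variable W : lmodType F.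
Implicit Types (G : int -> int -> W) (H : nat -> int -> int -> W) (s : F).

(** Only the second exponent is bounded below, uniformly in the first one: this
    makes expansions in nonnegative powers of the second variable finite. *)
Definition bounded G := exists N : int, forall x y, y < N -> G x y = 0.

(** The coefficient of X^x Y^y in (X + s Y)^n G(X, Y), the power being expanded
    in nonnegative powers of Y. *)
Definition binact s (n : int) G : int -> int -> W := fun x y =>
  nsum (fun j => (s ^+ j * gbin F n j) *: G (x - n + j%:Z) (y - j%:Z)).

Lemma bounded_ev0 G h (y : int) :
  bounded G -> ev0 (fun j => G (h j) (y - j%:Z)).
Proof.
by move=> [N GN]; exists `|y - N|.+1 => j Nj; apply: GN; lia.
Qed.

Lemma binact_ev0 s n G (x y : int) : bounded G ->
  ev0 (fun j => (s ^+ j * gbin F n j) *: G (x - n + j%:Z) (y - j%:Z)).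
Proof. by move=> bG; apply: ev0Z; apply: bounded_ev0. Qed.

Lemma binact_bounded s n G : bounded G -> bounded (binact s n G).
Proof.
move=> [N GN]; exists N => x y yN; apply: nsum0 => j.
by rewrite GN ?scaler0 //; lia.
Qed.

(** Multiplying by (X + s Y)^m and then by (X + s Y)^n: this is Vandermonde's
    identity for the expansions. *)
Lemma binactD s n m G : bounded G ->
  binact s n (binact s m G) = binact s (n + m) G.
Proof.
move=> bG; apply/funext => x; apply/funext => y.
pose f t := G (x - (n + m) + t%:Z) (y - t%:Z).
have fE : ev0 f by exact: bounded_ev0.
transitivity (nsum (fun j => nsum (fun i =>
    (s ^+ j * gbin F n j * (s ^+ i * gbin F m i)) *: f (j + i)%N))).
  apply: eq_nsum => j; rewrite nsumZ; last exact: binact_ev0.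
  by apply: eq_nsum => i; rewrite scalerA /f; congr (_ *: G _ _); lia.
rewrite nsum_diag; last first.
  have [N fN] := fE; exists N => j i ji; rewrite fN ?scaler0 //; lia.
apply: eq_nsum => t; rewrite -(vandermonde charF0) mulr_sumr scaler_suml.
apply: eq_bigr => i _; rewrite subnKC; last by rewrite -ltnS.
rewrite mulrACA -exprD subnKC //; by rewrite -ltnS.
Qed.

Lemma binact0 s G : binact s 0 G = G.
Proof.
apply/funext => x; apply/funext => y; rewrite /binact (@nsum1 _ 0%N).
  by rewrite gbin0 mulr1 scale1r; congr G; lia.
by case=> // k _; rewrite gbin0S // mulr0 scale0r.
Qed.

(** Local finiteness of an infinite family of series, enough for its sum to be
    again a series on which powers of binomials act. *)
Definition bounded_fam H :=
  (exists N : int, forall k x y, y < N -> H k x y = 0) /\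
  (forall x y, ev0 (fun k => H k x y)).

Definition sum_fam H : int -> int -> W := fun x y => nsum (fun k => H k x y).

Lemma sum_fam_bounded H : bounded_fam H -> bounded (sum_fam H).
Proof. by move=> [[N HN] _]; exists N => x y yN; apply: nsum0 => k; exact: HN. Qed.

Lemma binact_fam_ev0 s n H x y : bounded_fam H -> ev0 (fun k => binact s n (H k) x y).
Proof.
move=> [[N HN] HE]; apply: (ev02_ev0_nsum (F := fun k j => _)); apply: ev02_swap.
apply: ev02Z; apply: ev02_intro => [|j]; last exact: HE.
by exists `|y - N|.+1 => j k Nj; apply: HN; lia.
Qed.

Lemma binact_sum_fam s n H x y : bounded_fam H ->
  binact s n (sum_fam H) x y = nsum (fun k => binact s n (H k) x y).
Proof.
move=> [[N HN] HE]; rewrite /binact /sum_fam exchange_nsum; last first.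
  apply: ev02_swap; apply: ev02Z; apply: ev02_intro => [|j]; last exact: HE.
  by exists `|y - N|.+1 => j k Nj; apply: HN; lia.
by apply: eq_nsum => j; rewrite nsumZ //; exact: HE.
Qed.

Lemma binact_add s n G1 G2 x y : bounded G1 -> bounded G2 ->
  binact s n (fun x y => G1 x y + G2 x y) x y = binact s n G1 x y + binact s n G2 x y.
Proof.
move=> b1 b2; rewrite -nsumD; try exact: binact_ev0.
by apply: eq_nsum => j; rewrite scalerDr.
Qed.

Lemma binact_lin (A : W -> W) s n G x y : linear A -> bounded G ->
  binact s n (fun x y => A (G x y)) x y = A (binact s n G x y).
Proof.
move=> linA bG; rewrite lin_nsum //; last exact: binact_ev0.
by apply: eq_nsum => j; rewrite (linZ linA).
Qed.

Lemma binactZ c s n G x y : bounded G ->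
  binact s n (fun x y => c *: G x y) x y = c *: binact s n G x y.
Proof.
by apply: binact_lin; exact: linear_scale.
Qed.

(** Coefficientwise Jacobi identity for the three series
    Y_W(u, z_1) Yc(w, z_2) v, Yc(w, z_2) Y(u, z_1) v and Yc(Y_W(u, z_0) w, z_2) v.
    The variable in which a series is bounded below comes second, as this is
    the one in whose nonnegative powers the binomials are expanded. *)
Record jac G1 G2 G3 : Prop := Jac {
  jac_b1 : bounded G1;
  jac_b2 : bounded G2;
  jac_b3 : bounded G3;
  jacE : forall a b c,
    binact (-1) (- a - 1) G1 b c
    - (-1) ^ (- a - 1) *: binact (-1) (- a - 1) G2 c b
    = binact 1 (- b - 1) G3 c a }.

Lemma jac_ext G1 G2 G3 G1' G2' G3' : jac G1 G2 G3 ->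
  (forall b c, G1 b c = G1' b c) -> (forall c b, G2 c b = G2' c b) ->
  (forall c a, G3 c a = G3' c a) -> jac G1' G2' G3'.
Proof.
have E G G' : (forall x y, G x y = G' x y) -> G = G'.
  by move=> GG; apply/funext => x; apply/funext => y.
by move=> J /E <- /E <- /E <-.
Qed.

Lemma jac_lin A G1 G2 G3 : linear A -> jac G1 G2 G3 ->
  jac (fun x y => A (G1 x y)) (fun x y => A (G2 x y)) (fun x y => A (G3 x y)).
Proof.
move=> linA [b1 b2 b3 J].
have bA G : bounded G -> bounded (fun x y => A (G x y)).
  by move=> [N GN]; exists N => x y /GN ->; rewrite (lin0 linA).
split; try exact: bA.
move=> a b c; rewrite !(binact_lin _ _ _ _ linA) // -J.
by rewrite (linB linA) (linZ linA).
Qed.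

Lemma jacD G1 G2 G3 G1' G2' G3' : jac G1 G2 G3 -> jac G1' G2' G3' ->
  jac (fun x y => G1 x y + G1' x y) (fun x y => G2 x y + G2' x y)
      (fun x y => G3 x y + G3' x y).
Proof.
move=> [b1 b2 b3 J] [d1 d2 d3 K].
have bD G G' : bounded G -> bounded G' -> bounded (fun x y => G x y + G' x y).
  move=> [N GN] [M HM]; exists (Num.min N M) => x y.
  by rewrite lt_min => /andP[/GN -> /HM ->]; rewrite addr0.
split; try exact: bD.
by move=> a b c; rewrite !binact_add // -J -K scalerDr opprD addrACA.
Qed.

Lemma jac_sum H1 H2 H3 :
  bounded_fam H1 -> bounded_fam H2 -> bounded_fam H3 ->
  (forall k, jac (H1 k) (H2 k) (H3 k)) ->
  jac (sum_fam H1) (sum_fam H2) (sum_fam H3).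
Proof.
move=> b1 b2 b3 J; split; try exact: sum_fam_bounded.
move=> a b c; rewrite !binact_sum_fam // nsumZ; last exact: binact_fam_ev0.
have -> u v : u - v = u + (-1) *: v :> W by rewrite scaleN1r.
have e2 : ev0 (fun k => (-1) ^ (- a - 1) *: binact (-1) (- a - 1) (H2 k) c b).
  by apply: ev0Z; exact: binact_fam_ev0.
rewrite nsumZ // -nsumD; [|exact: binact_fam_ev0|exact: ev0Z].
by apply: eq_nsum => k; rewrite -(jacE (J k)) scaleN1r.
Qed.

(** The delta functions identify z_1 with z_2 + z_0, so multiplication by z_1^n
    is multiplication by (z_2 + z_0)^n on the third series. *)
Lemma jac_z1 n G1 G2 G3 : jac G1 G2 G3 ->
  jac (fun b c => G1 (b - n) c) (fun c b => G2 c (b - n)) (binact 1 n G3).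
Proof.
move=> [b1 b2 b3 J]; split.
- by have [N GN] := b1; exists N => x y /GN ->.
- by have [N GN] := b2; exists (N + n) => x y ?; apply: GN; lia.
- exact: binact_bounded.
move=> a b c; rewrite binactD // (_ : - b - 1 + n = - (b - n) - 1); last by lia.
rewrite -J; congr (_ - _ *: _); apply: eq_nsum => j; congr (_ *: _).
  by congr G1; lia.
by congr G2; lia.
Qed.

(** The delta functions identify z_0 with z_1 - z_2, so multiplication by z_0^n
    is multiplication by (z_1 - z_2)^n on the first series and by
    (-z_2 + z_1)^n, expanded the other way, on the second one. *)
Lemma jac_z0 n G1 G2 G3 : jac G1 G2 G3 ->
  jac (binact (-1) n G1) (fun c b => (-1) ^ n *: binact (-1) n G2 c b)
      (fun c a => G3 c (a - n)).
Proof.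
move=> [b1 b2 b3 J]; split.
- exact: binact_bounded.
- have [N GN] := binact_bounded (-1) n b2.
  by exists N => x y /GN ->; rewrite scaler0.
- by have [N GN] := b3; exists (N + n) => x y ?; apply: GN; lia.
move=> a b c; rewrite binactZ; last exact: binact_bounded.
rewrite !binactD // (_ : - a - 1 + n = - (a - n) - 1); last by lia.
rewrite scalerA -expfzDr ?oppr_eq0 ?oner_eq0 //.
rewrite (_ : - a - 1 + n = - (a - n) - 1); last by lia.
by rewrite J; apply: eq_nsum => j; congr (_ *: G3 _ _); lia.
Qed.

End BinomialAction.

(** * Normally ordered products and commutators *)

Section HeisenbergFields.
Variable F : fieldType.
Hypothesis charF0 : [pchar F] =i pred0.
Variable I : eqType.

(** The operator [a i n] stands for a^i(n). *)
Record heis_action (V : lmodType F) (a : I -> int -> V -> V) : Prop := {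
  ha_lin : forall i n, linear (a i n);
  ha_comm : forall i j n m v, a i n (a j m v) =
    a j m (a i n v) + (if (i == j) && (n + m == 0) then n%:~R else 0) *: v;
  ha_ev0 : forall i v, ev0 (fun k => a i (Posz k) v) }.

Record is_field (V W : lmodType F) (B : fser V W) : Prop := {
  field_lin : forall n, linear (B n);
  field_trunc : forall v, exists N : int, forall n, n < N -> B n v = 0 }.

Lemma field_ev0 (V W : lmodType F) (B : fser V W) n v :
  is_field B -> ev0 (fun k => B (n - k%:Z) v).
Proof.
move=> fB; have [N BN] := field_trunc fB v.
by exists `|n - N|.+1 => k Nk; apply: BN; lia.
Qed.

Section NormalOrder.
Variables (V W : lmodType F) (aV : I -> int -> V -> V) (aW : I -> int -> W -> W).
Hypotheses (haV : heis_action aV) (haW : heis_action aW).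
Implicit Types B : fser V W.

Definition nordl i m B : fser V W := fun n v =>
  nsum (fun k => 'C(m + k, m)%:R *: aW i (Negz (m + k)) (B (n - k%:Z) v)).

Definition nordr i m B : fser V W := fun n v =>
  nsum (fun k => 'C(m + k, m)%:R *: B (n + (m + k).+1%:Z) (aV i (Posz k) v)).

(** The normally ordered product of the m-th divided derivative of the field
    a^i(z) with B(z), where a^i(z) acts through [aW] on the left of B(z) and
    through [aV] on its right. *)
Definition nord i m B : fser V W := fun n v =>
  nordl i m B n v + (-1) ^+ m *: nordr i m B n v.

Lemma nord_ev0l i (c : nat -> F) (d : nat -> int) B n v : is_field B ->
  ev0 (fun k => c k *: aW i (d k) (B (n - k%:Z) v)).
Proof.
move=> fB; apply: ev0Z; apply: (ev0_morph (A := fun k => aW i (d k))).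
  by move=> k; exact: (lin0 (ha_lin haW i (d k))).
exact: field_ev0.
Qed.

Lemma nord_ev0r i (c : nat -> F) (d : nat -> int) B v : is_field B ->
  ev0 (fun k => c k *: B (d k) (aV i (Posz k) v)).
Proof.
move=> fB; apply: ev0Z; apply: (ev0_morph (A := fun k => B (d k))).
  by move=> k; exact: (lin0 (field_lin fB _)).
exact: ha_ev0.
Qed.

Lemma nord_shift i m B s n v :
  nord i m (fun n v => B (n + s) v) n v = nord i m B (n + s) v.
Proof.
congr (_ + _ *: _); apply: eq_nsum => k; congr (_ *: _).
  by congr (aW _ _ (B _ _)); lia.
by congr B; lia.
Qed.

Lemma is_field_comb B c B' : is_field B -> is_field B' ->
  is_field (fun n v => c *: B n v + B' n v).
Proof.
move=> [lB tB] [lB' tB']; split=> [n k u v|v].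
  rewrite lB lB' !scalerDr !scalerA (mulrC c k) -!addrA; congr (_ + _).
  by rewrite addrCA.
have [N BN] := tB v; have [M BM] := tB' v; exists (Num.min N M) => n.
by rewrite lt_min => /andP[/BN -> /BM ->]; rewrite scaler0 add0r.
Qed.

Lemma is_field0 : is_field (fun (n : int) (v : V) => 0 : W).
Proof. by split=> [n k u v|v]; [rewrite scaler0 addr0 | exists 0]. Qed.

Lemma is_field_shift B s : is_field B -> is_field (fun n v => B (n + s) v).
Proof.
move=> [lB tB]; split=> [n|v]; first exact: lB.
by have [N BN] := tB v; exists (N - s) => n ns; apply: BN; lia.
Qed.

Lemma is_field_sum (T : Type) (s : seq T) (c : T -> F) (C : T -> fser V W) :
  (forall j, is_field (C j)) ->
  is_field (fun n v => \sum_(j <- s) c j *: C j n v).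
Proof.
move=> fC; elim: s => [|x s IH].
  rewrite (_ : (fun n v => _) = (fun (n : int) (v : V) => 0 : W)).
    exact: is_field0.
  by apply/funext => n; apply/funext => v; rewrite big_nil.
rewrite (_ : (fun n v => _) =
  (fun (n : int) (v : V) => c x *: C x n v + \sum_(j <- s) c j *: C j n v)).
  exact: is_field_comb.
by apply/funext => n; apply/funext => v; rewrite big_cons.
Qed.

Lemma nordlDZ i m B c B' n v : is_field B -> is_field B' ->
  nordl i m (fun n v => c *: B n v + B' n v) n v =
  c *: nordl i m B n v + nordl i m B' n v.
Proof.
move=> fB fB'; have eB := nord_ev0l i (fun k => 'C(m + k, m)%:R)
  (fun k => Negz (m + k)) n v.
rewrite nsumZ -?nsumD; [|exact: ev0Z (eB _ fB)|exact: eB|exact: eB].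
apply: eq_nsum => k; have lA := ha_lin haW i (Negz (m + k)).
by rewrite (linD lA) (linZ lA) scalerDr !scalerA mulrC.
Qed.

Lemma nordrDZ i m B c B' n v : is_field B -> is_field B' ->
  nordr i m (fun n v => c *: B n v + B' n v) n v =
  c *: nordr i m B n v + nordr i m B' n v.
Proof.
move=> fB fB'; have eB := nord_ev0r i (fun k => 'C(m + k, m)%:R)
  (fun k => n + (m + k).+1%:Z) v.
rewrite nsumZ -?nsumD; [|exact: ev0Z (eB _ fB)|exact: eB|exact: eB].
by apply: eq_nsum => k; rewrite scalerDr !scalerA mulrC.
Qed.

Lemma nordDZ i m B c B' n v : is_field B -> is_field B' ->
  nord i m (fun n v => c *: B n v + B' n v) n v =
  c *: nord i m B n v + nord i m B' n v.
Proof.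
move=> fB fB'; rewrite /nord nordlDZ // nordrDZ // !scalerDr addrACA.
by rewrite !scalerA mulrC.
Qed.

Lemma nord_sum (T : Type) i m (s : seq T) (c : T -> F) (C : T -> fser V W) n v :
  (forall j, is_field (C j)) ->
  nord i m (fun n v => \sum_(j <- s) c j *: C j n v) n v =
  \sum_(j <- s) c j *: nord i m (C j) n v.
Proof.
move=> fC; elim: s => [|x s IH].
  rewrite big_nil /nord /nordl /nordr !nsum0 ?scaler0 ?addr0 // => k.
    by rewrite big_nil scaler0.
  by rewrite big_nil (lin0 (ha_lin haW _ _)) scaler0.
have -> : (fun n v => \sum_(j <- x :: s) c j *: C j n v) =
    (fun n v => c x *: C x n v + \sum_(j <- s) c j *: C j n v).
  by apply/funext => y; apply/funext => z; rewrite big_cons.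
rewrite nordDZ // ?IH; first by rewrite big_cons.
exact: is_field_sum.
Qed.

Lemma nordl_field i m B : is_field B -> is_field (nordl i m B).
Proof.
move=> fB; split=> [n k u v|v].
  have eB := nord_ev0l i (fun k => 'C(m + k, m)%:R) (fun k => Negz (m + k)) n.
  rewrite nsumZ -?nsumD; [|exact: ev0Z (eB _ _ fB)|exact: eB|exact: eB].
  apply: eq_nsum => j; have lA := ha_lin haW i (Negz (m + j)).
  by rewrite (field_lin fB) lA scalerDr !scalerA mulrC.
have [N BN] := field_trunc fB v; exists N => n nN; apply: nsum0 => k.
by rewrite BN ?(lin0 (ha_lin haW _ _)) ?scaler0 //; lia.
Qed.

Lemma nordr_field i m B : is_field B -> is_field (nordr i m B).
Proof.
move=> fB; split=> [n k u v|v].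
  have eB := nord_ev0r i (fun k => 'C(m + k, m)%:R) (fun k => n + (m + k).+1%:Z).
  rewrite nsumZ -?nsumD; [|exact: ev0Z (eB _ _ fB)|exact: eB|exact: eB].
  apply: eq_nsum => j.
  by rewrite (ha_lin haV) (field_lin fB) scalerDr !scalerA mulrC.
have [K aK] := ha_ev0 haV i v.
have [M BM] : exists M : int, forall k n, (k < K)%N -> n < M -> B n (aV i (Posz k) v) = 0.
  elim: K {aK} => [|K [M BM]]; first by exists 0.
  have [M' BM'] := field_trunc fB (aV i (Posz K) v).
  exists (Num.min M M') => k n; rewrite lt_min ltnS leq_eqVlt.
  by move=> /orP[/eqP ->|kK] /andP[? ?]; [exact: BM' | exact: BM].
exists (M - (m + K).+1%:Z) => n nM; apply: nsum0 => k.
have [kK|Kk] := ltnP k K; first by rewrite BM ?scaler0 //; lia.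
by rewrite aK // (lin0 (field_lin fB _)) scaler0.
Qed.

Lemma nord_field i m B : is_field B -> is_field (nord i m B).
Proof.
move=> fB; rewrite (_ : nord i m B =
  (fun n v => (-1) ^+ m *: nordr i m B n v + nordl i m B n v)).
  by apply: is_field_comb; [exact: nordr_field | exact: nordl_field].
by apply/funext => n; apply/funext => v; rewrite addrC.
Qed.

(** Creation operators commute among themselves, annihilation operators (with the
    zero modes) commute among themselves, and the two kinds act on opposite
    sides of B. *)
Lemma nord_swap i m j p B : is_field B ->
  nord i m (nord j p B) = nord j p (nord i m B).
Proof.
move=> fB.
have E k q : nord k q B =
    (fun n v => (-1) ^+ q *: nordr k q B n v + nordl k q B n v).
  by apply/funext => n; apply/funext => v; rewrite addrC.
apply/funext => n; apply/funext => v; rewrite !E /nord.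
rewrite !nordlDZ ?nordrDZ; try exact: nordr_field; try exact: nordl_field.
have ll : nordl i m (nordl j p B) n v = nordl j p (nordl i m B) n v.
  transitivity (nsum (fun k => nsum (fun k' => ('C(m + k, m)%:R * 'C(p + k', p)%:R) *:
      aW i (Negz (m + k)) (aW j (Negz (p + k')) (B (n - k%:Z - k'%:Z) v))))).
    apply: eq_nsum => k; have lA := ha_lin haW i (Negz (m + k)).
    rewrite (lin_nsum lA); last exact: nord_ev0l.
    rewrite nsumZ; last by apply: (lin_ev0 lA); exact: nord_ev0l.
    by apply: eq_nsum => k'; rewrite (linZ lA) scalerA.
  rewrite exchange_nsum; last first.
    apply: (ev02Z (fun k k' => _)); have [N BN] := field_trunc fB v.
    exists `|n - N|.+1 => k k' kk'; rewrite BN; last by lia.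
    by rewrite !(lin0 (ha_lin haW _ _)).
  apply: eq_nsum => k'; have lA := ha_lin haW j (Negz (p + k')).
  rewrite (lin_nsum lA); last exact: nord_ev0l.
  rewrite nsumZ; last by apply: (lin_ev0 lA); exact: nord_ev0l.
  apply: eq_nsum => k; rewrite (linZ lA) scalerA mulrC (ha_comm haW) ifF.
    by rewrite scale0r addr0 addrAC.
  by apply/negbTE; rewrite negb_and; apply/orP; right; apply/eqP; lia.
have rr : nordr i m (nordr j p B) n v = nordr j p (nordr i m B) n v.
  transitivity (nsum (fun k => nsum (fun k' => ('C(m + k, m)%:R * 'C(p + k', p)%:R) *:
      B (n + (m + k).+1%:Z + (p + k').+1%:Z) (aV j (Posz k') (aV i (Posz k) v))))).
    apply: eq_nsum => k; rewrite nsumZ; last exact: nord_ev0r.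
    by apply: eq_nsum => k'; rewrite scalerA.
  rewrite exchange_nsum; last first.
    apply: (ev02Z (fun k k' => _)); apply: ev02_intro => [|k].
      have [K aK] := ha_ev0 haV i v; exists K => k k' /aK ->.
      by rewrite (lin0 (ha_lin haV _ _)) (lin0 (field_lin fB _)).
    apply: (ev0_morph (A := fun k' => B _)); last exact: ha_ev0.
    by move=> k'; exact: (lin0 (field_lin fB _)).
  apply: eq_nsum => k'; rewrite nsumZ; last exact: nord_ev0r.
  apply: eq_nsum => k; rewrite scalerA mulrC (ha_comm haV).
  rewrite (_ : (if _ then _ else _) = 0); last first.
    by case: andP => // -[_ /eqP h]; rewrite (_ : k' = 0%N) //; lia.
  by rewrite scale0r addr0 addrAC.
have lr k q k' q' : nordl k q (nordr k' q' B) n v = nordr k' q' (nordl k q B) n v.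
  transitivity (nsum (fun x => nsum (fun y => ('C(q + x, q)%:R * 'C(q' + y, q')%:R) *:
      aW k (Negz (q + x)) (B (n - x%:Z + (q' + y).+1%:Z) (aV k' (Posz y) v))))).
    apply: eq_nsum => x; have lA := ha_lin haW k (Negz (q + x)).
    rewrite (lin_nsum lA); last exact: nord_ev0r.
    rewrite nsumZ; last by apply: (lin_ev0 lA); exact: nord_ev0r.
    by apply: eq_nsum => y; rewrite (linZ lA) scalerA.
  rewrite exchange_nsum; last first.
    apply: ev02_swap; apply: (ev02Z (fun k k' => _)); apply: ev02_intro => [|y].
      have [K aK] := ha_ev0 haV k' v; exists K => y x /aK ->.
      by rewrite (lin0 (field_lin fB _)) (lin0 (ha_lin haW _ _)).
    apply: (ev0_morph (A := fun x => aW k _)).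
      by move=> x; exact: (lin0 (ha_lin haW _ _)).
    have [N BN] := field_ev0 (n + (q' + y).+1%:Z) (aV k' (Posz y) v) fB.
    by exists N => x /BN <-; rewrite addrAC.
  apply: eq_nsum => y; rewrite nsumZ; last exact: nord_ev0l.
  by apply: eq_nsum => x; rewrite scalerA mulrC addrAC.
rewrite ll rr !lr !scalerDr !scalerA (mulrC (_ ^+ p)).
by rewrite [LHS](AC (2*2) ((4*2)*(3*1))).
Qed.

End NormalOrder.

Section VertexMaps.
Variables (U V W : lmodType F).
Variables (aU : I -> int -> U -> U) (aV : I -> int -> V -> V)
  (aW : I -> int -> W -> W).
Hypotheses (haU : heis_action aU) (haV : heis_action aV) (haW : heis_action aW).

(** A linear map u |-> P(u, z) that turns a creation operator on the label u into a
    normally ordered product; [aU], [aV], [aW] are the actions on labels,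
    arguments and values. Vertex operators on modules and the intertwining
    operator are of this kind. *)
Record vertex_map (P : U -> fser V W) : Prop := {
  vm_lin : forall n v, linear (fun u => P u n v);
  vm_field : forall u, is_field (P u);
  vm_nord : forall i m u n v,
    P (aU i (Negz m) u) n v = nord aV aW i m (P u) n v }.

(** [a^i(n), P(u, z)] = sum_j binomial(n, j) z^(n - j) P(a^i(j) u, z). *)
Definition comm_formula (P : U -> fser V W) (u : U) := forall i n c v,
  aW i n (P u c v) = P u c (aV i n v)
  + nsum (fun j => gbin F n j *: P (aU i (Posz j) u) (c - n + j%:Z) v).

Lemma comm_ev0 P i u (c : nat -> F) (d : nat -> int) v : vertex_map P ->
  ev0 (fun j => c j *: P (aU i (Posz j) u) (d j) v).
Proof.
move=> vP; apply: ev0Z; apply: (ev0_morph (A := fun j u => P u (d j) v)).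
  by move=> k; exact: (lin0 (vm_lin vP _ _)).
exact: ha_ev0.
Qed.

(** The scalar terms that appear when a^i(n) is moved across the modes of a^j in a
    normally ordered product, on the left (n > m), on the right (n < 0), and
    across a^j(-m-1) in the label. For each n at most one index contributes,
    and the coefficients agree because
    (m + 1) binomial(n, m + 1) = n binomial(n - 1, m). *)
Lemma comm_central (i j : I) m n c v (B : fser V W) :
  nsum (fun k => 'C(m + k, m)%:R *:
     ((if (i == j) && (n + Negz (m + k) == 0) then n%:~R else 0) *:
        B (c - k%:Z) v))
  + (-1) ^+ m *: nsum (fun k => 'C(m + k, m)%:R *:
     ((if (i == j) && (n + Posz k == 0) then n%:~R else 0) *:
        B (c + (m + k).+1%:Z) v))
  = nsum (fun k => gbin F n k *:
     ((if (i == j) && (Posz k + Negz m == 0) then (Posz k)%:~R else 0) *: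
        B (c - n + k%:Z) v)).
Proof.
case: eqVneq => [_|_] /=; last first.
  by rewrite !nsum0 ?scaler0 ?addr0 // => k; rewrite scale0r scaler0.
rewrite [RHS](@nsum1 _ m.+1); last first.
  by move=> k km; case: eqP => [h|_]; last (by rewrite scale0r scaler0); exfalso; lia.
rewrite ifT; last by apply/eqP; lia.
rewrite scalerA mulrC (gbin_absorb charF0).
case: n => [p|q].
  rewrite [X in _ + _ *: X]nsum0 ?scaler0 ?addr0; last first.
    move=> k; case: eqP => [h|_]; last by rewrite scale0r scaler0.
    by rewrite (_ : p = 0%N) ?scale0r ?scaler0 //; lia.
  case: p => [|p].
    rewrite mul0r scale0r nsum0 // => k.
    by case: eqP => _; rewrite scale0r scaler0.
  have -> : Posz p.+1 - 1 = p%:Z by lia.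
  rewrite gbin_nat //.
  have [pm|mp] := ltnP p m.
    rewrite bin_small // mulr0 scale0r nsum0 // => k.
    by case: eqP => [h|_]; [exfalso; lia | rewrite scale0r scaler0].
  rewrite (@nsum1 _ (p - m)%N); last first.
    by move=> k km; case: eqP => [h|_]; last (by rewrite scale0r scaler0); exfalso; lia.
  rewrite ifT; last by apply/eqP; lia.
  by rewrite scalerA mulrC subnKC //; congr (_ *: B _ _); lia.
rewrite nsum0 ?add0r; last first.
  by move=> k; case: eqP => [h|_]; last (by rewrite scale0r scaler0); exfalso; lia.
rewrite (@nsum1 _ q.+1); last first.
  by move=> k km; case: eqP => [h|_]; last (by rewrite scale0r scaler0); exfalso; lia.
rewrite ifT; last by apply/eqP; lia.
rewrite (_ : Negz q - 1 = - q.+1%:Z - 1); last by lia.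
rewrite gbin_neg // !scalerA (addnC q.+1) addnC; congr (_ *: B _ _); last by lia.
by rewrite mulrA mulrC.
Qed.

(** Commutation with a^i(n) is a derivation, hence acts on the factors of a normally
    ordered product one at a time: on P(u, z) through the hypothesis, on the
    modes of a^j by the central terms collected in [comm_central]. *)
Lemma comm_formula_creation P j m u : vertex_map P ->
  comm_formula P u -> comm_formula P (aU j (Negz m) u).
Proof.
move=> vP cP i n c v; rewrite !(vm_nord vP).
have fB := vm_field vP u.
(* [B'] collects the commutator of a^i(n) with P(u, z) as a finite sum *)
have [J aJ] := ha_ev0 haU i u.
pose C k : fser V W := fun x y => P (aU i (Posz k) u) (x + (- n + k%:Z)) y.
have fC k : is_field (C k) by apply: is_field_shift; exact: vm_field.
pose B' : fser V W := fun x y => \sum_(k < J) gbin F n k *: C k x y.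
have fB' : is_field B' by exact: is_field_sum.
have aB x y : aW i n (P u x y) = P u x (aV i n y) + B' x y.
  rewrite cP (nsumE (N := J)) => [|k /aJ ->].
    by congr (_ + _); apply: eq_bigr => k _; congr (_ *: P _ _ _); lia.
  by rewrite (lin0 (vm_lin vP _ _)) scaler0.
have -> : nsum (fun k => gbin F n k *:
    P (aU i (Posz k) (aU j (Negz m) u)) (c - n + k%:Z) v) =
  nord aV aW j m B' c v + nsum (fun k => gbin F n k *:
     ((if (i == j) && (Posz k + Negz m == 0) then (Posz k)%:~R else 0) *:
        P u (c - n + k%:Z) v)).
  have -> : nord aV aW j m B' c v =
      nsum (fun k => gbin F n k *: P (aU j (Negz m) (aU i (Posz k) u)) (c - n + k%:Z) v).
    rewrite nord_sum // (nsumE (N := J)) => [|k /aJ ->].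
      apply: eq_bigr => k _; by rewrite vm_nord // nord_shift addrA.
    by rewrite (lin0 (ha_lin haU _ _)) (lin0 (vm_lin vP _ _)) scaler0.
  rewrite -nsumD.
  - apply: eq_nsum => k; rewrite (ha_comm haU) (linD (vm_lin vP _ _)).
    by rewrite (linZ (vm_lin vP _ _)) scalerDr.
  - exists J => k /aJ ->.
    by rewrite (lin0 (ha_lin haU _ _)) (lin0 (vm_lin vP _ _)) scaler0.
  - exists m.+2 => k mk; rewrite ifF ?scale0r ?scaler0 //.
    by apply/negbTE; rewrite negb_and; apply/orP; right; apply/eqP; lia.
rewrite -comm_central addrA.
have lA := ha_lin haW i n.
have ec : ev0 (fun k => 'C(m + k, m)%:R *:
   ((if (i == j) && (n + Posz k == 0) then n%:~R else 0) *: P u (c + (m + k).+1%:Z) v)).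
  exists `|n|.+1 => k nk; rewrite ifF ?scale0r ?scaler0 //.
  by apply/negbTE; rewrite negb_and; apply/orP; right; apply/eqP; lia.
rewrite [in LHS]/nord (linD lA) (linZ lA) !(lin_nsum lA);
  try exact: (nord_ev0l haW _ _ _ _ _ fB); try exact: (nord_ev0r haV _ _ _ _ fB).
transitivity (
 (nsum (fun k => 'C(m + k, m)%:R *: aW j (Negz (m + k)) (P u (c - k%:Z) (aV i n v)))
  + nsum (fun k => 'C(m + k, m)%:R *: aW j (Negz (m + k)) (B' (c - k%:Z) v))
  + nsum (fun k => 'C(m + k, m)%:R *:
     ((if (i == j) && (n + Negz (m + k) == 0) then n%:~R else 0) *:
        P u (c - k%:Z) v)))
 + (-1) ^+ m *:
 (nsum (fun k => 'C(m + k, m)%:R *: P u (c + (m + k).+1%:Z) (aV j (Posz k) (aV i n v)))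
  + nsum (fun k => 'C(m + k, m)%:R *: B' (c + (m + k).+1%:Z) (aV j (Posz k) v))
  + nsum (fun k => 'C(m + k, m)%:R *:
     ((if (i == j) && (n + Posz k == 0) then n%:~R else 0) *:
        P u (c + (m + k).+1%:Z) v)))); last first.
  by rewrite /nord !scalerDr addrACA; congr (_ + _); exact: addrACA.
congr (_ + _ *: _).
  rewrite -!nsumD; try exact: (nord_ev0l haW _ _ _ _ _ fB);
    try exact: (nord_ev0l haW _ _ _ _ _ fB').
  - apply: eq_nsum => k; rewrite (linZ lA) (ha_comm haW) aB.
    by rewrite (linD (ha_lin haW _ _)) !scalerDr.
  - by apply: ev0D; [exact: (nord_ev0l haW _ _ _ _ _ fB)
                    | exact: (nord_ev0l haW _ _ _ _ _ fB')].
  - by apply: ev0Z; apply: ev0Z; exact: field_ev0.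
rewrite -!nsumD //; try exact: (nord_ev0r haV _ _ _ _ fB);
  try exact: (nord_ev0r haV _ _ _ _ fB').
  apply: eq_nsum => k; rewrite (linZ lA) aB (ha_comm haV).
  rewrite (linD (field_lin fB _)) (linZ (field_lin fB _)) !scalerDr -!addrA.
  by congr (_ + _); rewrite addrC.
by apply: ev0D; [exact: (nord_ev0r haV _ _ _ _ fB)
                | exact: (nord_ev0r haV _ _ _ _ fB')].
Qed.

End VertexMaps.
End HeisenbergFields.

(** * Jacobi identity for a label with one more creation operator *)

Section JacobiStep.
Variable F : fieldType.
Hypothesis charF0 : [pchar F] =i pred0.
Variables (I : eqType) (V W : lmodType F).
Variables (aV : I -> int -> V -> V) (aW : I -> int -> W -> W).
Hypotheses (haV : heis_action aV) (haW : heis_action aW).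
Variables (Y : V -> fser V V) (YW : V -> fser W W) (Yc : W -> fser V W).
Hypotheses (vY : vertex_map aV aV aV Y) (vYW : vertex_map aV aW aW YW)
  (vYc : vertex_map aW aV aW Yc).
Hypothesis cYc : forall w, comm_formula aW aV aW Yc w.

(** [J1], [J2], [J3] are the coefficients of the three series in the Jacobi identity,
    in the argument order of [jac]. *)
Definition J1 u w v : int -> int -> W := fun b c => YW u b (Yc w c v).
Definition J2 u w v : int -> int -> W := fun c b => Yc w c (Y u b v).
Definition J3 u w v : int -> int -> W := fun c a => Yc (YW u a w) c v.

Definition jacobi_at u w v := jac (J1 u w v) (J2 u w v) (J3 u w v).

Lemma bounded_fam_finite (H : nat -> int -> int -> W) K :
  (forall k x y, (K <= k)%N -> H k x y = 0) -> (forall k, bounded (H k)) ->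
  bounded_fam H.
Proof.
move=> HK bH; split; last by move=> x y; exists K => k; exact: HK.
have [N HN] : exists N, forall k x y, (k < K)%N -> y < N -> H k x y = 0.
  elim: K {HK} => [|K [N HN]]; first by exists 0.
  have [M HM] := bH K; exists (Num.min N M) => k x y.
  rewrite lt_min ltnS leq_eqVlt => /orP[/eqP ->|kK] /andP[? ?]; first exact: HM.
  exact: HN.
by exists N => k x y yN; have [kK|Kk] := ltnP k K; [exact: HN | exact: HK].
Qed.

Let C m k : F := 'C(m + k, m)%:R.

Lemma J1_bounded u w v : bounded (J1 u w v).
Proof.
have [N YN] := field_trunc (vm_field vYc w) v; exists N => b c /YN.
by rewrite /J1 => ->; rewrite (lin0 (field_lin (vm_field vYW u) _)).
Qed.

Lemma J2_bounded u w v : bounded (J2 u w v).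
Proof.
have [N YN] := field_trunc (vm_field vY u) v; exists N => c b /YN.
by rewrite /J2 => ->; rewrite (lin0 (field_lin (vm_field vYc w) _)).
Qed.

Lemma J3_bounded u w v : bounded (J3 u w v).
Proof.
have [N YN] := field_trunc (vm_field vYW u) w; exists N => c a /YN.
by rewrite /J3 => ->; rewrite (lin0 (vm_lin vYc _ _)).
Qed.

Lemma J1_ev0 u w v b c : ev0 (fun k => J1 u w v (b - k%:Z) c).
Proof. exact: (field_ev0 _ _ (vm_field vYW u)). Qed.

Lemma J3_ev0 u w v c a : ev0 (fun k => J3 u w v (c - k%:Z) a).
Proof. exact: (field_ev0 _ _ (vm_field vYc _)). Qed.

(** With a^i(-m-1) u as label, each of the three series splits into
    - P: creation operators applied to the series for (u, w, v), multiplied by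
      powers z_1^k;
    - Q: the series for (u, w, a^i(k) v), multiplied by z_1^(-m-1-k);
    - R: the series for (u, a^i(k) w, v), multiplied by z_0^(-m-1-k).
    All three operations preserve the Jacobi identity. *)
Section Step.
Variables (i : I) (m : nat) (u : V) (w : W) (v : V).
Hypothesis IH : forall w v, jacobi_at u w v.

Let A k (x : W) : W := C m k *: aW i (Negz (m + k)) x.
Let e : F := (-1) ^+ m.

Let P1 (k : nat) (b c : int) := A k (J1 u w v (b - k%:Z) c).
Let P2 (k : nat) (c b : int) := A k (J2 u w v c (b - k%:Z)).
Let P3 (k : nat) (c a : int) := A k (binact 1 k%:Z (J3 u w v) c a).

Let Q1 (k : nat) (b c : int) := (e * C m k) *: J1 u w (aV i k v) (b - - (m + k).+1%:Z) c.
Let Q2 (k : nat) (c b : int) := (e * C m k) *: J2 u w (aV i k v) c (b - - (m + k).+1%:Z).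
Let Q3 (k : nat) (c a : int) :=
  (e * C m k) *: binact 1 (- (m + k).+1%:Z) (J3 u w (aV i k v)) c a.

Let R1 (k : nat) (b c : int) :=
  (e * C m k) *: binact (-1) (- (m + k).+1%:Z) (J1 u (aW i k w) v) b c.
Let R2 (k : nat) (c b : int) := (e * C m k) *: ((-1) ^ (- (m + k).+1%:Z) *:
  binact (-1) (- (m + k).+1%:Z) (J2 u (aW i k w) v) c b).
Let R3 (k : nat) (c a : int) := (e * C m k) *: J3 u (aW i k w) v c (a - - (m + k).+1%:Z).

Let linA k : linear (A k).
Proof.
by move=> c x y; rewrite /A (ha_lin haW) scalerDr !scalerA mulrC.
Qed.

Lemma jac_P k : jac (P1 k) (P2 k) (P3 k).
Proof. exact: (jac_lin (linA k) (jac_z1 charF0 k%:Z (IH w v))). Qed.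

Lemma jac_Q k : jac (Q1 k) (Q2 k) (Q3 k).
Proof.
exact: (jac_lin (linear_scale _) (jac_z1 charF0 _ (IH w (aV i k v)))).
Qed.

Lemma jac_R k : jac (R1 k) (R2 k) (R3 k).
Proof.
exact: (jac_lin (linear_scale _) (jac_z0 charF0 _ (IH (aW i k w) v))).
Qed.

Lemma bounded_P1 : bounded_fam P1.
Proof.
split=> [|b c].
  have [N JN] := J1_bounded u w v; exists N => k b c cN.
  by rewrite /P1 JN // (lin0 (linA k)).
apply: (ev0_morph (A := A)) => [k|]; first exact: (lin0 (linA k)).
exact: J1_ev0.
Qed.

Lemma bounded_P2 : bounded_fam P2.
Proof.
split=> [|c b].
  have [N JN] := J2_bounded u w v; exists N => k c b bN.
  by rewrite /P2 JN ?(lin0 (linA k)) //; lia.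
apply: (ev0_morph (A := A)) => [k|]; first exact: (lin0 (linA k)).
exact: (bounded_ev0 (fun=> c) b (J2_bounded u w v)).
Qed.

Lemma ev02_P3 c a : ev02 (fun k j =>
  (1 ^+ j * gbin F k%:Z j) *: J3 u w v (c - k%:Z + j%:Z) (a - j%:Z)).
Proof.
apply: ev02_swap; apply: ev02Z; apply: ev02_intro => [|j].
  have [N JN] := J3_bounded u w v; exists `|a - N|.+1 => j k Nj.
  by apply: JN; lia.
have [N JN] := J3_ev0 u w v (c + j%:Z) (a - j%:Z).
by exists N => k /JN <-; congr J3; lia.
Qed.

Lemma bounded_P3 : bounded_fam P3.
Proof.
split=> [|c a].
  have [M JM] := J3_bounded u w v.
  exists M => k c a aM; rewrite /P3 /binact nsum0 ?(lin0 (linA k)) // => j.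
  by rewrite JM ?scaler0 //; lia.
apply: (ev0_morph (A := A)) => [k|]; first exact: (lin0 (linA k)).
by apply: ev02_ev0_nsum; exact: ev02_P3.
Qed.

Lemma bounded_Q : [/\ bounded_fam Q1, bounded_fam Q2 & bounded_fam Q3].
Proof.
have [K aK] := ha_ev0 haV i v.
split.
- apply: (bounded_fam_finite (K := K)) => [k x y /aK Ek|k]; last exact: jac_b1 (jac_Q k).
  rewrite /Q1 /J1 Ek (lin0 (field_lin (vm_field vYc _) _)).
  by rewrite (lin0 (field_lin (vm_field vYW _) _)) scaler0.
- apply: (bounded_fam_finite (K := K)) => [k x y /aK Ek|k]; last exact: jac_b2 (jac_Q k).
  rewrite /Q2 /J2 Ek (lin0 (field_lin (vm_field vY _) _)).
  by rewrite (lin0 (field_lin (vm_field vYc _) _)) scaler0.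
- apply: (bounded_fam_finite (K := K)) => [k x y /aK Ek|k]; last exact: jac_b3 (jac_Q k).
  rewrite /Q3 /binact nsum0 ?scaler0 // => j.
  by rewrite /J3 Ek (lin0 (field_lin (vm_field vYc _) _)) scaler0.
Qed.

Lemma bounded_R : [/\ bounded_fam R1, bounded_fam R2 & bounded_fam R3].
Proof.
have [K aK] := ha_ev0 haW i w.
split.
- apply: (bounded_fam_finite (K := K)) => [k x y /aK Ek|k]; last exact: jac_b1 (jac_R k).
  rewrite /R1 /binact nsum0 ?scaler0 // => j.
  rewrite /J1 Ek (lin0 (vm_lin vYc _ _)).
  by rewrite (lin0 (field_lin (vm_field vYW _) _)) scaler0.
- apply: (bounded_fam_finite (K := K)) => [k x y /aK Ek|k]; last exact: jac_b2 (jac_R k).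
  rewrite /R2 /binact nsum0 ?scaler0 // => j.
  by rewrite /J2 Ek (lin0 (vm_lin vYc _ _)) scaler0.
- apply: (bounded_fam_finite (K := K)) => [k x y /aK Ek|k]; last exact: jac_b3 (jac_R k).
  rewrite /R3 /J3 Ek (lin0 (field_lin (vm_field vYW _) _)).
  by rewrite (lin0 (vm_lin vYc _ _)) scaler0.
Qed.

(** Moving a^i(k) from the normally ordered product across Yc(w, z_2) produces the
    terms Q and commutators, and the commutators sum up to the expansions of
    (z_1 - z_2)^(-m-1-j). *)
Lemma J1_creation b c :
  J1 (aV i (Negz m) u) w v b c = sum_fam P1 b c + (sum_fam Q1 b c + sum_fam R1 b c).
Proof.
rewrite /J1 (vm_nord vYW) /nord; congr (_ + _).
rewrite nsumZ; last exact: (nord_ev0r haW _ _ _ _ (vm_field vYW u)).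
(* the commutators; the substitution k = j + t makes the sum over t an expansion *)
pose f (k j : nat) := (e * C m k * gbin F k%:Z j) *:
  J1 u (aW i j w) v (b - - (m + k).+1%:Z) (c - k%:Z + j%:Z).
have ef : ev02 f.
  apply: ev02_swap; apply: (ev02Z (fun j k => _)); apply: ev02_intro => [|j].
    have [J aJ] := ha_ev0 haW i w; exists J => j k /aJ; rewrite /J1 => ->.
    rewrite (lin0 (vm_lin vYc _ _)).
    exact: (lin0 (field_lin (vm_field vYW _) _)).
  have [N JN] := J1_bounded u (aW i (Posz j) w) v.
  by exists `|(c + j%:Z - N)%R|.+1 => k Nk; apply: JN; lia.
transitivity (nsum (fun k => Q1 k b c + nsum (f k))).
  apply: eq_nsum => k; rewrite cYc (linD (field_lin (vm_field vYW u) _)) !scalerDr.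
  congr (_ + _); first by rewrite /Q1 /J1 scalerA opprK.
  rewrite (lin_nsum (field_lin (vm_field vYW u) _)); last first.
    exact: (comm_ev0 haW _ _ _ _ _ vYc).
  have ek : ev0 (fun j => gbin F k j *: J1 u (aW i (Posz j) w) v (b + (m + k).+1%:Z)
      (c - k%:Z + j%:Z)).
    apply: ev0Z; apply: (lin_ev0 (field_lin (vm_field vYW u) _)).
    have [J aJ] := ha_ev0 haW i w; exists J => j /aJ ->.
    exact: (lin0 (vm_lin vYc _ _)).
  rewrite scalerA; transitivity ((e * C m k) *: nsum (fun j => gbin F k j *:
      J1 u (aW i (Posz j) w) v (b + (m + k).+1%:Z) (c - k%:Z + j%:Z))).
    congr (_ *: _); apply: eq_nsum => j.
    by rewrite (linZ (field_lin (vm_field vYW u) _)).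
  by rewrite nsumZ //; apply: eq_nsum => j; rewrite /f scalerA opprK.
rewrite nsumD; [|by have [[_ h] _ _] := bounded_Q; exact: h | exact: ev02_ev0_nsum].
congr (_ + _); rewrite exchange_nsum_shift // => [|k j kj]; last first.
  by rewrite /f gbin_nat // bin_small // mulr0 scale0r.
apply: eq_nsum => j; rewrite /R1 /binact nsumZ; last first.
  by apply: binact_ev0; exact: J1_bounded.
apply: eq_nsum => t; rewrite /f (sign_gbin_neg charF0) scalerA gbin_nat //.
rewrite -!mulrA -!natrM trinomial mulnC; congr (_ *: J1 _ _ _ _ _); lia.
Qed.

(** Here the creation operators have to be moved to the left of Yc(w, z_2), and the
    commutators sum up to the expansions of (-z_2 + z_1)^(-m-1-j) in powers of
    z_1. *)
Lemma J2_creation c b :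
  J2 (aV i (Negz m) u) w v c b = sum_fam P2 c b + (sum_fam Q2 c b + sum_fam R2 c b).
Proof.
have lYc := field_lin (vm_field vYc w) c.
rewrite /J2 (vm_nord vY) /nord (linD lYc) (linZ lYc) !(lin_nsum lYc); first last.
- exact: (nord_ev0l haV _ _ _ _ _ (vm_field vY u)).
- exact: (nord_ev0r haV _ _ _ _ (vm_field vY u)).
rewrite [RHS]addrCA [LHS]addrC; congr (_ + _).
  rewrite nsumZ; last first.
    by apply: (lin_ev0 lYc); exact: (nord_ev0r haV _ _ _ _ (vm_field vY u)).
  by apply: eq_nsum => k; rewrite (linZ lYc) /Q2 /J2 scalerA opprK.
pose f (k j : nat) := (- (C m k * gbin F (Negz (m + k)) j)) *:
  J2 u (aW i j w) v (c - Negz (m + k) + j%:Z) (b - k%:Z).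
have ef : ev02 f.
  apply: ev02_swap; apply: (ev02Z (fun j k => _)); apply: ev02_intro => [|j].
    have [J aJ] := ha_ev0 haW i w; exists J => j k /aJ; rewrite /J2 => ->.
    by rewrite (lin0 (vm_lin vYc _ _)).
  exact: bounded_ev0 (J2_bounded _ _ _).
transitivity (nsum (fun k => P2 k c b + nsum (f k))).
  apply: eq_nsum => k; rewrite (linZ lYc) /P2 /A /J2 cYc scalerDr -addrA.
  rewrite -[LHS]addr0; congr (_ + _); rewrite nsumZ; last first.
    exact: (comm_ev0 haW _ _ _ _ _ vYc).
  rewrite -nsumD; last exact: ev02_ev0 ef.
    by apply/esym/nsum0 => j; rewrite /f scalerA scaleNr addrN.
  by apply: (ev0Z (fun j => _)); exact: (comm_ev0 haW _ _ _ _ _ vYc).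
rewrite nsumD; [|by have [_ h] := bounded_P2; exact: h | exact: ev02_ev0_nsum].
congr (_ + _); rewrite exchange_nsum //; apply: eq_nsum => j.
rewrite /R2 /binact scalerA nsumZ; last by apply: binact_ev0; exact: J2_bounded.
apply: eq_nsum => k; rewrite (sign_gbin_neg charF0) scalerA /f.
rewrite (_ : Negz (m + k) = - (m + k)%N%:Z - 1); last by lia.
rewrite gbin_neg //; congr (_ *: J2 _ _ _ _ _); last by lia.
rewrite -exprnN -exprVn invrN1 -(bin_sub (leq_addl _ _)) addnK.
have -> : (-1) ^+ j = - e * (-1) ^+ (m + j).+1 :> F.
  by rewrite exprS mulN1r mulrNN exprD mulrA -exprMn mulrNN mulr1 expr1n mul1r.
have := congr1 (fun x => x%:R : F) (trinomial_sym m k j); rewrite /= !natrM.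
rewrite /C; move: ('C(m + k, m)%:R) ('C(m + k + j, m + k)%:R) => x y xy.
move: ('C(m + j, m)%:R) ('C(m + j + k, m + j)%:R) ((-1) ^+ (m + j).+1) xy => p q s xy.
by transitivity (e * s * (x * y)); [ring | rewrite xy; ring].
Qed.

(** Normal ordering is used twice, for Y_W(a^i(-m-1) u, z_0) w and then for the label
    a^i(-m-k-1) x of Yc; the double sums are expansions of powers of z_2 + z_0. *)
Lemma J3_creation c a :
  J3 (aV i (Negz m) u) w v c a = sum_fam P3 c a + (sum_fam Q3 c a + sum_fam R3 c a).
Proof.
have lYc := vm_lin vYc c v.
have fYW := vm_field vYW u.
rewrite /J3 (vm_nord vYW) /nord (linD lYc) (linZ lYc) !(lin_nsum lYc); first last.
- exact: (nord_ev0l haW _ _ _ _ _ fYW).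
- exact: (nord_ev0r haW _ _ _ _ fYW).
rewrite addrA; congr (_ + _); last first.
  rewrite nsumZ; last by apply: (lin_ev0 lYc); exact: (nord_ev0r haW _ _ _ _ fYW).
  by apply: eq_nsum => k; rewrite (linZ lYc) /R3 /J3 scalerA opprK.
pose f (k s : nat) := (C m k * C (m + k) s) *:
  aW i (Negz (m + k + s)) (J3 u w v (c - s%:Z) (a - k%:Z)).
pose g (k s : nat) := (C m k * ((-1) ^+ (m + k) * C (m + k) s)) *:
  J3 u w (aV i s v) (c + (m + k + s).+1%:Z) (a - k%:Z).
have [N JN] := J3_bounded u w v.
have ef : ev02 f.
  apply: (ev02Z (fun k s => _)); apply: ev02_intro => [|k].
    exists `|a - N|.+1 => k s ks; rewrite JN; last by lia.
    exact: (lin0 (ha_lin haW _ _)).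
  apply: (ev0_morph (A := fun s => aW i (Negz (m + k + s)))); last exact: J3_ev0.
  by move=> s; exact: (lin0 (ha_lin haW _ _)).
have eg : ev02 g.
  apply: ev02_swap; apply: (ev02Z (fun s k => _)); apply: ev02_intro => [|s].
    have [K aK] := ha_ev0 haV i v; exists K => s k /aK; rewrite /J3 => ->.
    exact: (lin0 (field_lin (vm_field vYc _) _)).
  exact: bounded_ev0 (J3_bounded _ _ _).
transitivity (nsum (fun k => nsum (f k) + nsum (g k))).
  apply: eq_nsum => k; rewrite (linZ lYc) (vm_nord vYc) /nord scalerDr scalerA.
  have fk := vm_field vYc (YW u (a - k%:Z) w).
  rewrite !nsumZ; try exact: (nord_ev0l haW _ _ _ _ _ fk);
    try exact: (nord_ev0r haV _ _ _ _ fk).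
  by congr (_ + _); apply: eq_nsum => s; rewrite scalerA -?mulrA.
rewrite nsumD; try exact: ev02_ev0_nsum.
congr (_ + _).
  pose h (k j : nat) := C m k *: aW i (Negz (m + k)) ((1 ^+ j * gbin F k%:Z j) *:
    J3 u w v (c - k%:Z + j%:Z) (a - j%:Z)).
  transitivity (nsum (fun k => nsum (h k))); last first.
    apply: eq_nsum => k; rewrite /P3 (lin_nsum (linA k)) //.
    exact: ev02_ev0 (ev02_P3 c a).
  rewrite [RHS]exchange_nsum_shift.
  - apply: eq_nsum => j; apply: eq_nsum => s; rewrite /h (linZ (ha_lin haW _ _)).
    rewrite gbin_nat // expr1n mul1r scalerA /f /C -!natrM.
    rewrite -trinomial addnA.
    by congr (_ *: aW _ _ (J3 _ _ _ _ _)); lia.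
  - have [M hM] := ev02_P3 c a; exists M => k j /hM; rewrite /h => ->.
    by rewrite (lin0 (ha_lin haW _ _)) scaler0.
  - move=> k j kj; rewrite /h gbin_nat // bin_small // mulr0 scale0r.
    by rewrite (lin0 (ha_lin haW _ _)) scaler0.
rewrite exchange_nsum //; apply: eq_nsum => s.
rewrite /Q3 /binact nsumZ; last by apply: binact_ev0; exact: J3_bounded.
apply: eq_nsum => k; rewrite /g scalerA expr1n mul1r.
rewrite (_ : - (m + s).+1%:Z = - (m + s)%N%:Z - 1); last by lia.
rewrite gbin_neg //; congr (_ *: J3 _ _ _ _ _); last by lia.
rewrite -(bin_sub (leq_addl _ _)) addnK exprD /C /e.
have := congr1 (fun x => x%:R : F) (trinomial_sym m k s); rewrite /= !natrM.
move: ('C(m + k, m)%:R) ('C(m + k + s, m + k)%:R) => x y xy.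
by rewrite mulrCA xy -!mulrA; congr (_ * _); rewrite mulrCA.
Qed.

Lemma jacobi_at_creation : jacobi_at (aV i (Negz m) u) w v.
Proof.
have [bQ1 bQ2 bQ3] := bounded_Q; have [bR1 bR2 bR3] := bounded_R.
apply: jac_ext (jacD (jac_sum bounded_P1 bounded_P2 bounded_P3 jac_P)
  (jacD (jac_sum bQ1 bQ2 bQ3 jac_Q) (jac_sum bR1 bR2 bR3 jac_R))) _ _ _ => x y.
- by rewrite J1_creation.
- by rewrite J2_creation.
- by rewrite J3_creation.
Qed.

End Step.
End JacobiStep.

(** * Delta functions *)

Section DeltaFunctions.
Variable F : fieldType.
Hypothesis charF0 : [pchar F] =i pred0.

(** Used to replace a sum over integers or over triples of exponents by a sum over
    the one index that parametrises its support. *)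
Lemma fsum_nsum (W : nmodType) (T : choiceType) (h : nat -> T) (f : T -> W) :
  injective h -> (forall i, (forall j, i <> h j) -> f i = 0) ->
  \sum_(i \in [set: T]%classic) f i = nsum (fun j => f (h j)).
Proof.
move=> ih f0; rewrite /nsum; transitivity (\sum_(i \in (h @` setT)%classic) f i); last first.
  by apply: fsbig_image => x y _ _; exact: ih.
apply/esym; apply: fsbig_widen => // i [_ hi] /=; apply: f0 => j e.
by apply: hi; exists j.
Qed.

Variable W : lmodType F.
Implicit Type G : int -> int -> W.

Lemma fmul3_delta12 G a b c :
  fmul3 (@delta_12 F) (fun k' => let: (a, b, c) := k' in
    if a == 0 then G b c else 0) (a, b, c) = binact (-1) (- a - 1) G b c.
Proof.
rewrite /fmul3 (@fsum_nsum _ _ (fun j : nat => (0, b + a + 1 + j%:Z, c - j%:Z))).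
- apply: eq_nsum => j; rewrite /delta_12 /= ?eqxx /binexp subr0.
  rewrite (_ : c - (c - j%:Z) = j%:Z); last by lia.
  rewrite ifT; last by apply/eqP; lia.
  by congr (_ *: G _ _); lia.
- by move=> j k; case=> *; lia.
move=> [[a' b'] c'] H; rewrite /delta_12 /=.
case: eqVneq => [a0|]; last by rewrite scaler0.
rewrite /binexp; case E: (c - c') => [j|]; last by rewrite scale0r.
case: eqVneq => [e|]; last by rewrite scale0r.
by exfalso; apply: (H j); congr (_, _, _); lia.
Qed.

Lemma fmul3_delta21 G a b c : bounded G ->
  fmul3 (@delta_21 F) (fun k' => let: (a, b, c) := k' in
    if a == 0 then G c b else 0) (a, b, c) =
  (-1) ^ (- a - 1) *: binact (-1) (- a - 1) G c b.
Proof.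
move=> bG; rewrite /fmul3 (@fsum_nsum _ _ (fun j : nat => (0, b - j%:Z, c + a + 1 + j%:Z))).
- rewrite /binact nsumZ; last exact: binact_ev0.
  apply: eq_nsum => j; rewrite /delta_21 /= ?eqxx /binexp subr0.
  rewrite (_ : b - (b - j%:Z) = j%:Z); last by lia.
  rewrite ifT; last by apply/eqP; lia.
  by rewrite scalerA; congr (_ *: G _ _); lia.
- by move=> j k; case=> *; lia.
move=> [[a' b'] c'] H; rewrite /delta_21 /=.
case: eqVneq => [a0|]; last by rewrite scaler0.
rewrite /binexp; case E: (b - b') => [j|]; last by rewrite mulr0 scale0r.
case: eqVneq => [e|]; last by rewrite mulr0 scale0r.
by exfalso; apply: (H j); congr (_, _, _); lia.
Qed.

Lemma fmul3_delta10 G a b c :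
  fmul3 (@delta_10 F) (fun k' => let: (a, b, c) := k' in
    if b == 0 then G c a else 0) (a, b, c) = binact 1 (- b - 1) G c a.
Proof.
rewrite /fmul3 (@fsum_nsum _ _ (fun j : nat => (a - j%:Z, 0, c + b + 1 + j%:Z))).
- apply: eq_nsum => j; rewrite /delta_10 /= ?eqxx /binexp subr0.
  rewrite (_ : a - (a - j%:Z) = j%:Z); last by lia.
  rewrite ifT; last by apply/eqP; lia.
  rewrite expr1n mul1r (gbin_opp charF0 b) (_ : - (c - _) - 1 = b + j%:Z); last by lia.
  by congr (_ *: G _ _); lia.
- by move=> j k; case=> *; lia.
move=> [[a' b'] c'] H; rewrite /delta_10 /=.
case: eqVneq => [b0|]; last by rewrite scaler0.
rewrite /binexp; case E: (a - a') => [j|]; last by rewrite scale0r.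
case: eqVneq => [e|]; last by rewrite scale0r.
by exfalso; apply: (H j); congr (_, _, _); lia.
Qed.

(** This is the Jacobi identity for the vacuum as label u. All terms contain the
    same coefficient of g, and the binomial coefficients in front of it agree in
    each of the cases given by the signs of a and b. *)
Lemma jac_delta (g : int -> W) : (exists N : int, forall c, c < N -> g c = 0) ->
  jac (fun b c => if b == 0 then g c else 0) (fun c b => if b == 0 then g c else 0)
      (fun c a => if a == 0 then g c else 0).
Proof.
move=> [N gN]; split.
- by exists N => b c /gN ->; rewrite if_same.
- by exists 0 => c b b0; case: eqP => // e; lia.
- by exists 0 => c b b0; case: eqP => // e; lia.
move=> a b c; set n := - a - 1.
pose t := g (c - n + b).
have z (x : F) (k y : int) : k != 0 -> x *: (if k == 0 then g y else 0) = 0.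
  by move=> /negbTE ->; rewrite scaler0.
have E1 : binact (-1) n (fun b c => if b == 0 then g c else 0) b c =
    (if n - b is Posz j then (-1) ^+ j * gbin F n j else 0) *: t.
  rewrite /binact; case e: (n - b) => [j|j].
    rewrite (@nsum1 _ j) => [|k kj]; last by apply: z; lia.
    by rewrite ifT; [congr (_ *: g _); lia | apply/eqP; lia].
  by rewrite scale0r nsum0 // => k; apply: z; lia.
have E2 : binact (-1) n (fun c b => if b == 0 then g c else 0) c b =
    (if b is Posz j then (-1) ^+ j * gbin F n j else 0) *: t.
  rewrite /binact; case e: b => [j|j].
    rewrite (@nsum1 _ j) => [|k kj]; last by apply: z; lia.
    by rewrite ifT; [congr (_ *: g _); lia | apply/eqP; lia].
  by rewrite scale0r nsum0 // => k; apply: z; lia.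
have E3 : binact 1 (- b - 1) (fun c a => if a == 0 then g c else 0) c a =
    (if a is Posz j then gbin F (- b - 1) j else 0) *: t.
  rewrite /binact; case e: a => [j|j].
    rewrite (@nsum1 _ j) => [|k kj]; last by apply: z; lia.
    rewrite ifT; last by apply/eqP; lia.
    by rewrite expr1n mul1r; congr (_ *: g _); lia.
  by rewrite scale0r nsum0 // => k; apply: z; lia.
rewrite E1 E2 E3 scalerA -scalerBl; congr (_ *: t); rewrite {E1 E2 E3 t z}/n.
have sgn k : (-1) ^+ k * (-1) ^+ k = 1 :> F.
  by rewrite -exprMn mulrNN mulr1 expr1n.
case: a => [p|q]; last first.
  rewrite (_ : - Negz q - 1 = q%:Z); last by lia.
  case: b => [r|s]; last first.
    case e: (q%:Z - Negz s) => [j|j]; last by exfalso; lia.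
    by rewrite gbin_nat // bin_small ?mulr0 ?subr0 //; lia.
  case e: (q%:Z - r%:Z) => [j|j]; last first.
    by rewrite gbin_nat // bin_small ?mulr0 ?subr0 //; lia.
  rewrite !gbin_nat // -exprnP (_ : q = j + r)%N; last by lia.
  rewrite exprD -[_ * _ * (_ * _)]mulrA (mulrA (_ ^+ r)) sgn mul1r.
  by rewrite -(bin_sub (leq_addr r j)) addKn subrr.
have -> : - Posz p - 1 = - p%:Z - 1 by [].
case: b => [r|s].
  case e: (- p%:Z - 1 - r%:Z) => [j|j]; first by exfalso; lia.
  rewrite !gbin_neg // (mulrA (_ ^+ r)) sgn mul1r sub0r.
  rewrite (_ : - p%:Z - 1 = - p.+1%:Z); last by lia.
  rewrite -exprnN -exprVn invrN1 exprS mulN1r mulNr opprK (addnC r).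
  by rewrite -(bin_sub (leq_addl _ _)) addnK.
rewrite mulr0 subr0 (_ : - Negz s - 1 = s%:Z) ?gbin_nat //; last by lia.
case e: (- p%:Z - 1 - Negz s) => [j|j]; last by rewrite bin_small //; lia.
rewrite gbin_neg // mulrA sgn mul1r (_ : s = p + j)%N; last by lia.
by rewrite -(bin_sub (leq_addl _ _)) addnK.
Qed.

End DeltaFunctions.

(** * Exponentials of commuting series *)

Section Exponentials.
Variable F : fieldType.
Hypothesis charF0 : [pchar F] =i pred0.
Variable V : lmodType F.
Implicit Types A B : fser V V.

Lemma intF_eq0 (n : int) : ((n%:~R : F) == 0) = (n == 0).
Proof.
case: n => [[|n]|n]; first by rewrite eqxx.
  by rewrite -pmulrn (negbTE (natF_neq0 charF0 n)).
by rewrite NegzE mulrNz oppr_eq0 -pmulrn (negbTE (natF_neq0 charF0 n)).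
Qed.

Lemma fmul_opp A B n v :
  fmul A B n v = fmul (fun k => A (- k)) (fun k => B (- k)) (- n) v.
Proof.
rewrite /fmul (@reindex_fsbigT _ _ _ _ _ (fun k : int => - k)); last first.
  by exists -%R; exact: opprK.
by apply: eq_fsbigr => k _; congr (A _ (B _ _)); lia.
Qed.

Lemma fexp_opp A n v : fexp A n v = fexp (fun k => A (- k)) (- n) v.
Proof.
rewrite /fexp; apply: eq_fsbigr => r _; congr (_ *: _).
elim: r n v => [|r IH] n v /=; first by rewrite /fone oppr_eq0.
rewrite fmul_opp; apply: eq_fsbigr => k _; congr (A _ _).
by rewrite IH opprK.
Qed.

Section PositiveSeries.
Variable A : fser V V.
Hypothesis linA : forall n, linear (A n).
Hypothesis A_le0 : forall n v, n <= 0 -> A n v = 0.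
Hypothesis A_comm : forall n m v, A n (A m v) = A m (A n v).

Lemma fmul_pos B n v :
  fmul A B n v = nsum (fun j => A (Posz j.+1) (B (n - j.+1%:Z) v)).
Proof.
rewrite /fmul (@fsum_nsum _ _ (fun j : nat => j.+1%:Z)) //.
  by move=> j k [].
move=> [[|i]|i] H; rewrite ?A_le0 //.
by case: (H i).
Qed.

Let X r := iter r (fmul A) (@fone F V).

Lemma powS r n v :
  X r.+1 n v = nsum (fun j => A (Posz j.+1) (X r (n - j.+1%:Z) v)).
Proof. exact: fmul_pos. Qed.

Lemma pow_lt r (n : int) v : n < r%:Z -> X r n v = 0.
Proof.
elim: r n v => [|r IH] n v nr; first by rewrite /X /= /fone ifF //; lia.
rewrite powS nsum0 // => j; rewrite IH; last by lia.
exact: (lin0 (linA _)).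
Qed.

Lemma pow_ev0 r n v : ev0 (fun j => X r (n - j.+1%:Z) v).
Proof. by exists `|n|.+1 => j nj; apply: pow_lt; lia. Qed.

Lemma term_ev0 r n (c : nat -> F) v :
  ev0 (fun j => c j *: A (Posz j.+1) (X r (n - j.+1%:Z) v)).
Proof.
apply: ev0Z; apply: (ev0_morph (A := fun j => A (Posz j.+1))).
  by move=> k; exact: (lin0 (linA _)).
exact: pow_ev0.
Qed.

(** The Leibniz rule for z d/dz on the power A^(r+1), whose factors commute. *)
Lemma pow_deriv r (n : int) v : n%:~R *: X r.+1 n v =
  r.+1%:R *: nsum (fun j => j.+1%:R *: A (Posz j.+1) (X r (n - j.+1%:Z) v)).
Proof.
have scale1 (f : nat -> V) : f = (fun j => 1 *: f j).
  by apply/funext => j; rewrite scale1r.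
elim: r n v => [|r IH] n v.
  rewrite powS scale1r nsumZ; last first.
    by rewrite (scale1 (fun j => _)); exact: (term_ev0 0).
  apply: eq_nsum => j; rewrite /X /= /fone; case: eqP => [e|_].
    by congr (_ *: _); rewrite pmulrn; congr (_%:~R); lia.
  by rewrite (lin0 (linA _)) !scaler0.
rewrite powS nsumZ; last first.
  by rewrite (scale1 (fun j => _)); exact: (term_ev0 r.+1).
transitivity (nsum (fun j => j.+1%:R *: A (Posz j.+1) (X r.+1 (n - j.+1%:Z) v)) +
  r.+1%:R *: nsum (fun j => A (Posz j.+1) (nsum (fun i =>
     i.+1%:R *: A (Posz i.+1) (X r (n - j.+1%:Z - i.+1%:Z) v))))).
  have e2 : ev0 (fun j => A (Posz j.+1) (nsum (fun i =>
     i.+1%:R *: A (Posz i.+1) (X r (n - j.+1%:Z - i.+1%:Z) v)))).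
    exists `|n|.+1 => j nj; rewrite nsum0 ?(lin0 (linA _)) // => i.
    by rewrite pow_lt ?(lin0 (linA _)) ?scaler0 //; lia.
  rewrite nsumZ // -nsumD; [|exact: term_ev0|exact: ev0Z].
  apply: eq_nsum => j; rewrite -[r.+1%:R *: A _ _](linZ (linA _)) -IH.
  rewrite (linZ (linA _)) -scalerDl.
  by congr (_ *: _); rewrite pmulrn -rmorphD /=; congr (_%:~R); lia.
rewrite (_ : r.+2%:R = 1 + r.+1%:R :> F); last by rewrite -[r.+2]add1n natrD.
rewrite scalerDl scale1r; congr (_ + _ *: _).
transitivity (nsum (fun j => nsum (fun i =>
     i.+1%:R *: A (Posz j.+1) (A (Posz i.+1) (X r (n - j.+1%:Z - i.+1%:Z) v))))).
  apply: eq_nsum => j; rewrite (lin_nsum (linA _)); last exact: term_ev0.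
  by apply: eq_nsum => i; rewrite (linZ (linA _)).
rewrite exchange_nsum; last first.
  exists `|n|.+1 => j i ji; rewrite pow_lt; last by lia.
  by rewrite !(lin0 (linA _)) scaler0.
apply: eq_nsum => i; rewrite powS.
rewrite (lin_nsum (linA _)); last first.
  by rewrite (scale1 (fun j => _)); exact: term_ev0.
rewrite nsumZ; last first.
  apply: (lin_ev0 (linA _)).
  by rewrite (scale1 (fun j => _)); exact: term_ev0.
apply: eq_nsum => j; rewrite A_comm; congr (_ *: A _ (A _ (X _ _ _))).
by lia.
Qed.

Let E := fexp A.

Lemma fexpE n v : E n v = nsum (fun r => (r`!%:R)^-1 *: X r n v).
Proof. by []. Qed.

Lemma fexp_lt0 (n : int) v : n < 0 -> E n v = 0.
Proof.
by move=> n0; rewrite fexpE nsum0 // => r; rewrite pow_lt ?scaler0 //; lia.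
Qed.

Lemma fexp0 v : E 0 v = v.
Proof.
rewrite fexpE (@nsum1 _ 0%N).
  by rewrite fact0 invr1 scale1r /X /= /fone eqxx.
by case=> // r _; rewrite pow_lt ?scaler0.
Qed.

Lemma fexp_ev0 n v : ev0 (fun j => E (n - j.+1%:Z) v).
Proof. by exists `|n|.+1 => j nj; apply: fexp_lt0; lia. Qed.

Lemma fexp_term_ev0 n v : ev0 (fun j => j.+1%:R *: A (Posz j.+1) (E (n - j.+1%:Z) v)).
Proof.
apply: ev0Z; apply: (ev0_morph (A := fun j => A (Posz j.+1))).
  by move=> k; exact: (lin0 (linA _)).
exact: fexp_ev0.
Qed.

(** The differential equation z E' = (z A') E, obtained termwise from the powers of
    A. In characteristic 0 it determines E from its constant term, which is how
    the next lemmas are proved. *)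
Lemma fexp_deriv (n : int) v : n%:~R *: E n v =
  nsum (fun j => j.+1%:R *: A (Posz j.+1) (E (n - j.+1%:Z) v)).
Proof.
have er m : ev0 (fun r => (r`!%:R)^-1 *: X r m v).
  by exists `|m|.+1 => r mr; rewrite pow_lt ?scaler0 //; lia.
rewrite fexpE nsumZ; last exact: er.
rewrite nsumS; last exact: ev0Z (er n).
rewrite {1}/X /= {1}/fone; have -> : n%:~R *: (0`!%:R^-1 *: (if n == 0 then v else 0)) = 0.
  by case: eqP => [->|_]; rewrite ?scale0r // !scaler0.
rewrite add0r; transitivity (nsum (fun r => nsum (fun j =>
    (r`!%:R)^-1 *: (j.+1%:R *: A (Posz j.+1) (X r (n - j.+1%:Z) v))))).
  apply: eq_nsum => r; rewrite scalerA mulrC -scalerA (pow_deriv r) scalerA.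
  rewrite nsumZ; last exact: term_ev0.
  apply: eq_nsum => j; congr (_ *: _).
  have := natF_neq0 charF0 r; have := factF_neq0 charF0 r.
  rewrite factS natrM; move: (r.+1%:R) (r`!%:R) => a b b0 a0.
  by field; rewrite a0 b0.
rewrite exchange_nsum; last first.
  exists `|n|.+1 => r j rj; rewrite pow_lt; last by lia.
  by rewrite (lin0 (linA _)) !scaler0.
apply: eq_nsum => j; rewrite fexpE (lin_nsum (linA _)); last exact: er.
rewrite nsumZ; last exact: (lin_ev0 (linA _)).
by apply: eq_nsum => r; rewrite (linZ (linA _)) !scalerA mulrC.
Qed.

Lemma int_strong_ind (P : int -> Prop) :
  (forall n, n <= 0 -> P n) ->
  (forall n, 0 < n -> (forall m, m < n -> P m) -> P n) -> forall n, P n.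
Proof.
move=> P0 PS n; have [k nk] : exists k : nat, n <= k%:Z by exists `|n|%N; lia.
elim: k n nk => [|k IH] n nk; first exact: P0.
have [n0|n0] := lerP n 0; first exact: P0.
by apply: PS => // m mn; apply: IH; lia.
Qed.

Lemma fexp_lin n : linear (E n).
Proof.
elim/int_strong_ind: n => [n n0 k u v|n n0 IH k u v].
  move: n0; rewrite le_eqVlt => /orP[/eqP ->|n0]; first by rewrite !fexp0.
  by rewrite !fexp_lt0 // scaler0 addr0.
have nz : (n%:~R : F) != 0 by rewrite intF_eq0; lia.
apply: (scalerI nz); rewrite scalerDr scalerA (mulrC _ k) -scalerA !fexp_deriv.
rewrite nsumZ; last exact: fexp_term_ev0.
rewrite -nsumD; [|apply: ev0Z|]; try exact: fexp_term_ev0.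
apply: eq_nsum => j; rewrite IH; last by lia.
by rewrite linA scalerDr !scalerA mulrC.
Qed.

(** If [x, A(z)] is the scalar c z^(p+1) then [x, exp A(z)] = c z^(p+1) exp A(z),
    because both sides satisfy the same differential equation. *)
Lemma fexp_comm (x : V -> V) (p : nat) (c : F) : linear x ->
  (forall n v, x (A n v) = A n (x v) + (if n == p.+1%:Z then c else 0) *: v) ->
  forall n v, x (E n v) = E n (x v) + c *: E (n - p.+1%:Z) v.
Proof.
move=> lx xA n; elim/int_strong_ind: n => [n n0 v|n n0 IH v].
  rewrite (fexp_lt0 (n := n - _)) ?scaler0 ?addr0; last by lia.
  move: n0; rewrite le_eqVlt => /orP[/eqP ->|n0]; first by rewrite !fexp0.
  by rewrite !fexp_lt0 // (lin0 lx).
have nz : (n%:~R : F) != 0 by rewrite intF_eq0; lia.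
apply: (scalerI nz); rewrite -(linZ lx) fexp_deriv (lin_nsum lx); last exact: fexp_term_ev0.
rewrite scalerDr fexp_deriv.
transitivity (nsum (fun j => j.+1%:R *: A (Posz j.+1) (E (n - j.+1%:Z) (x v)))
  + nsum (fun j => c *: (j.+1%:R *: A (Posz j.+1) (E (n - p.+1%:Z - j.+1%:Z) v)))
  + nsum (fun j => j.+1%:R *:
      ((if Posz j.+1 == p.+1%:Z then c else 0) *: E (n - j.+1%:Z) v))).
  have e1 : ev0 (fun j => c *: (j.+1%:R *: A (Posz j.+1) (E (n - p.+1%:Z - j.+1%:Z) v))).
    by apply: ev0Z; exact: fexp_term_ev0.
  rewrite -!nsumD //; try exact: fexp_term_ev0.
  - apply: eq_nsum => j; rewrite (linZ lx) xA IH; last by lia.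
    rewrite (linD (linA _)) (linZ (linA _)) !scalerDr !scalerA (mulrC c).
    by rewrite (addrAC n (- p.+1%:Z)).
  - by apply: ev0D => //; exact: fexp_term_ev0.
  - by apply: ev0Z; apply: ev0Z; exact: fexp_ev0.
rewrite -addrA; congr (_ + _); rewrite -nsumZ; last exact: fexp_term_ev0.
rewrite -fexp_deriv (@nsum1 _ p) => [|k kp]; last first.
  by rewrite ifF ?scale0r ?scaler0 //; lia.
rewrite eqxx !scalerA -scalerDl; congr (_ *: _).
have -> : (n - p.+1%:Z)%:~R = n%:~R - p.+1%:R :> F by rewrite rmorphB.
by rewrite mulrBr (mulrC _ c) subrK mulrC.
Qed.

Lemma fexp_A n m v : A m (E n v) = E n (A m v).
Proof.
rewrite (@fexp_comm (A m) 0 0 (linA m)) ?scale0r ?addr0 // => k w.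
by rewrite A_comm if_same scale0r addr0.
Qed.

End PositiveSeries.
End Exponentials.

(** * The Fock space *)

Section LinearExtension.
Variables (F : fieldType) (K : choiceType) (V : lmodType F) (h : K -> V).

Lemma malg_sumE (g : {malg F[K]}) : g = \sum_(k <- msupp g) g@_k *: << k >>.
Proof.
rewrite {1}(monalgE g); apply: eq_bigr => k _.
by apply/malgP => k'; rewrite mcoeffZ !mcoeffU mulr_natr.
Qed.

(** The coefficients may be summed over any finite set of monomials containing the
    support, so that different supports can be compared. *)
Lemma linear_extension : linear (fun g : {malg F[K]} => \sum_(k <- msupp g) g@_k *: h k).
Proof.
have E (g : {malg F[K]}) (d : {fset K}) : (msupp g `<=` d)%fset ->
    \sum_(k <- msupp g) g@_k *: h k = \sum_(k <- d) g@_k *: h k.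
  move=> gd; rewrite (big_fset_incl _ gd) //= => x _ /mcoeff_outdom ->.
  by rewrite scale0r.
move=> c g1 g2; pose d := (msupp (c *: g1 + g2) `|` (msupp g1 `|` msupp g2))%fset.
rewrite !(E _ d) /d ?fsubsetUl //; first last.
- by rewrite (fsubset_trans (fsubsetUl _ _) (fsubsetUr _ _)).
- by rewrite (fsubset_trans (fsubsetUr _ _) (fsubsetUr _ _)).
rewrite scaler_sumr -big_split /=; apply: eq_bigr => k _.
by rewrite mcoeffD mcoeffZ scalerDl scalerA.
Qed.

Lemma linear_extensionU k :
  \sum_(x <- msupp (<< k >> : {malg F[K]})) (<< k >> : {malg F[K]})@_x *: h x = h k.
Proof. by rewrite msuppU oner_eq0 big_seq_fset1 mcoeffUU scale1r. Qed.

End LinearExtension.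

Section FockModel.
Variables (F : fieldType) (l : nat) (V : lmodType F).
Variables (cre ann : 'I_l -> nat -> V -> V) (vac : V).

(** The polynomial algebra in the variables (i, k) through its characteristic features:
    multiplication [cre i k] by a variable, [ann i k], which is k + 1 times the
    partial derivative, and generation from the constant polynomial. *)
Record fock_model : Prop := {
  cre_lin : forall i k, linear (cre i k);
  ann_lin : forall i k, linear (ann i k);
  cre_comm : forall i k j p u, cre i k (cre j p u) = cre j p (cre i k u);
  ann_cre : forall i k j p u, ann i k (cre j p u) =
    cre j p (ann i k u) + (if (i == j) && (k == p) then k.+1%:R else 0) *: u;
  ann_vac : forall i k, ann i k vac = 0;
  fock_ind : forall P : V -> Prop,
    (forall c u v, P u -> P v -> P (c *: u + v)) -> P vac ->
    (forall i k u, P u -> P (cre i k u)) -> forall u, P u }.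

Hypothesis fm : fock_model.

Definition modes (alpha : 'rV[F]_l) (i : 'I_l) (n : int) (u : V) : V :=
  match n with
  | Posz 0 => alpha 0 i *: u
  | Posz k.+1 => ann i k u
  | Negz k => cre i k u
  end.

Lemma ann_comm i k j p u : ann i k (ann j p u) = ann j p (ann i k u).
Proof.
elim/(fock_ind fm): u => [c u v IHu IHv||i' k' u IH].
- by rewrite !(ann_lin fm) IHu IHv.
- by rewrite !(ann_vac fm) (lin0 (ann_lin fm i k)) (lin0 (ann_lin fm j p)).
rewrite !(ann_cre fm) (linD (ann_lin fm i k)) (linD (ann_lin fm j p)).
rewrite (linZ (ann_lin fm i k)) (linZ (ann_lin fm j p)) !(ann_cre fm) IH.
by rewrite addrAC.
Qed.

Lemma modes_ev0 alpha i v : ev0 (fun k => modes alpha i (Posz k) v).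
Proof.
suff [N aN] : ev0 (fun k => ann i k v) by exists N.+1 => -[|k] // /aN.
elim/(fock_ind fm): v => [c u v [N uN] [M vM]||j p u [N uN]].
- exists (maxn N M) => k; rewrite geq_max => /andP[/uN u0 /vM v0].
  by rewrite (ann_lin fm) u0 v0 scaler0 addr0.
- by exists 0%N => k _; rewrite (ann_vac fm).
exists (maxn N p.+1) => k; rewrite geq_max => /andP[/uN u0 pk].
rewrite (ann_cre fm) u0 (lin0 (cre_lin fm j p)) add0r ifF ?scale0r //.
by apply/negbTE; rewrite negb_and; apply/orP; right; rewrite gtn_eqF.
Qed.

Lemma modes_lin alpha i n : linear (modes alpha i n).
Proof.
case: n => [[|k]|k] c u v /=; [|exact: ann_lin|exact: cre_lin].
by rewrite scalerDr !scalerA mulrC.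
Qed.

Lemma modes_heis_action alpha : heis_action (modes alpha).
Proof.
split; [exact: modes_lin | | exact: modes_ev0].
have z (b : bool) (n : int) (v : V) : b = false ->
  (if b then n%:~R else 0 : F) *: v = 0 by move=> ->; rewrite scale0r.
have zm i j n v : modes alpha i 0 (modes alpha j n v) =
    modes alpha j n (modes alpha i 0 v).
  by rewrite /= (linZ (modes_lin alpha j n)).
move=> i j [[|k]|k] [[|p]|p] v.
- by rewrite mulr0z if_same scale0r addr0; exact: zm.
- by rewrite mulr0z if_same scale0r addr0; exact: zm.
- by rewrite mulr0z if_same scale0r addr0; exact: zm.
- rewrite z ?addr0; first exact/esym/zm.
  by apply/negbTE; rewrite negb_and; apply/orP; right; apply/eqP; lia.
- rewrite z ?addr0; first exact: ann_comm.
  by apply/negbTE; rewrite negb_and; apply/orP; right; apply/eqP; lia.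
- rewrite /= (ann_cre fm) (_ : (Posz k.+1 + Negz p == 0) = (k == p)) //.
  by apply/eqP/eqP; lia.
- rewrite z ?addr0; first exact/esym/zm.
  by apply/negbTE; rewrite negb_and; apply/orP; right; apply/eqP; lia.
- rewrite /= (ann_cre fm) -addrA -scalerDl (_ : (Negz k + Posz p.+1 == 0) = (p == k)).
    rewrite eq_sym; case: andP => [[_ /eqP ->]|_]; last by rewrite addr0 scale0r addr0.
    by rewrite NegzE mulrNz -pmulrn addrN scale0r addr0.
  by apply/eqP/eqP; lia.
- rewrite z ?addr0; first exact: cre_comm.
  by apply/negbTE; rewrite negb_and; apply/orP; right; apply/eqP; lia.
Qed.

End FockModel.

HB.lock Definition fmon (F : fieldType) (l : nat) (m : {cmonom ('I_l * nat)%type}) :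
  fock F l := << m >>.

Section FockSpace.
Variables (F : fieldType) (l : nat).
Local Notation fock := (fock F l).
Local Notation mon := {cmonom ('I_l * nat)%type}.
Local Notation cre := (@fock_creation F l).
Local Notation ann := (@fock_annihilation F l).
Local Notation fmon := (@fmon F l).
Local Notation vac := (@vacuum F l : fock).

Definition mulvar x (m : mon) : mon := locked (mmul (ucm x) m).
Definition divvar x (m : mon) : mon := locked (divcm m (ucm x)).

Lemma mulvarE x m y : mulvar x m y = ((x == y) + m y)%N.
Proof. by rewrite /mulvar -lock cmM cmU. Qed.

Lemma divvarE x m y : divvar x m y = (m y - (x == y))%N.
Proof. by rewrite /divvar -lock divcmE cmU. Qed.

Lemma fmonE m : fmon m = << m >>.
Proof. by rewrite fmon.unlock. Qed.

Lemma creU i k (m : mon) : cre i k (fmon m) = fmon (mulvar (i, k) m).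
Proof. by rewrite !fmonE /fock_creation malgM_def fgmulUU mul1r /mulvar -lock. Qed.

Lemma fock_cre_lin i k : linear (cre i k).
Proof. by move=> c u v; rewrite /fock_creation mulrDr -scalerAr. Qed.

Lemma fock_cre_comm i k j p u : cre i k (cre j p u) = cre j p (cre i k u).
Proof. exact: mulrCA. Qed.

Lemma annE i k u : ann i k u = \sum_(m <- msupp u)
  u@_m *: ((k.+1 * m (i, k))%:R *: fmon (divvar (i, k) m)).
Proof. by apply: eq_bigr => m _; rewrite scalerA fmonE /divvar -lock. Qed.

Lemma fock_ann_lin i k : linear (ann i k).
Proof.
move=> c u v; rewrite !annE.
exact: (linear_extension (fun m : mon => (k.+1 * m (i, k))%:R *: fmon (divvar (i, k) m))).
Qed.

Lemma annU i k (m : mon) :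
  ann i k (fmon m) = (k.+1 * m (i, k))%:R *: fmon (divvar (i, k) m).
Proof.
rewrite annE (fmonE m).
exact: (linear_extensionU (fun m : mon => (k.+1 * m (i, k))%:R *: fmon (divvar (i, k) m))).
Qed.

Lemma fock_monomial_ext (A B : fock -> fock) : linear A -> linear B ->
  (forall m : mon, A (fmon m) = B (fmon m)) -> A =1 B.
Proof.
move=> lA lB AB u; rewrite (malg_sumE u) (big_morph A (linD lA) (lin0 lA)).
rewrite (big_morph B (linD lB) (lin0 lB)).
apply: eq_bigr => m _; rewrite (linZ lA) (linZ lB).
by have := AB m; rewrite fmonE => ->.
Qed.

Lemma divvarK (m : mon) x : m x != 0%N -> mulvar x (divvar x m) = m.
Proof.
move=> mx; apply/eqP/cmP => y; rewrite mulvarE divvarE.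
by case: eqVneq => [<-|_]; rewrite ?subn0 // subnKC // lt0n.
Qed.

Lemma scale_mulS (V : lmodType F) (x y : V) (n c : nat) : (n != 0 -> x = y) ->
  (c * (1 + n))%:R *: x = (c * n)%:R *: y + c%:R *: x.
Proof.
move=> xy; rewrite mulnDr muln1 natrD scalerDl addrC; congr (_ + _).
by case: eqVneq xy => [->|_ ->]; rewrite ?muln0 ?scale0r.
Qed.

Lemma scale_mul0 (V : lmodType F) (x y z : V) (n c : nat) : (n != 0 -> x = y) ->
  (c * (0 + n))%:R *: x = (c * n)%:R *: y + 0 *: z.
Proof.
move=> xy; rewrite add0n scale0r addr0.
by case: eqVneq xy => [->|_ ->]; rewrite ?muln0 ?scale0r.
Qed.

Lemma fock_ann_cre i k j p u : ann i k (cre j p u) =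
  cre j p (ann i k u) + (if (i == j) && (k == p) then k.+1%:R else 0) *: u.
Proof.
have := @fock_monomial_ext (fun u => ann i k (cre j p u)) (fun u =>
  cre j p (ann i k u) + (if (i == j) && (k == p) then k.+1%:R else 0) *: u).
apply=> [c v w|c v w|m].
- by rewrite fock_cre_lin fock_ann_lin.
- rewrite fock_ann_lin fock_cre_lin !scalerDr !scalerA (mulrC c) -!addrA; congr (_ + _).
  by rewrite addrCA.
have -> : (i == j) && (k == p) = ((j, p) == (i, k)).
  by rewrite [RHS]eq_sym xpair_eqE.
have -> : cre j p (ann i k (fmon m)) =
    (k.+1 * m (i, k))%:R *: fmon (mulvar (j, p) (divvar (i, k) m)).
  by rewrite annU (linZ (fock_cre_lin j p)) creU.
rewrite creU; apply: etrans (annU _ _ _) _; rewrite mulvarE; case: eqP => [[<- <-]|ne].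
  have -> : divvar (j, p) (mulvar (j, p) m) = m.
    by apply/eqP/cmP => y; rewrite divvarE mulvarE addKn.
  by apply: scale_mulS => nz; rewrite divvarK.
apply: scale_mul0 => nz; congr fmon; apply/eqP/cmP => y.
rewrite !(divvarE, mulvarE).
by rewrite addnBA //; case: eqP => [<-|//]; rewrite lt0n.
Qed.

Lemma fock_ann_vac i k : ann i k vac = 0.
Proof.
rewrite (_ : vac = fmon mone) ?annU; last by rewrite fmonE.
by rewrite cm1 muln0 scale0r.
Qed.

(** Induction on the degree of monomials, splitting off one variable. *)
Lemma fock_generated (P : fock -> Prop) :
  (forall c u v, P u -> P v -> P (c *: u + v)) -> P vac ->
  (forall i k u, P u -> P (cre i k u)) -> forall u, P u.
Proof.
move=> PL P1 PS.
have P0 : P 0 by have := PL (-1) _ _ P1 P1; rewrite scaleN1r addNr.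
have Pm (m : mon) : P (fmon m).
  have [n nm] := ubnP (mdeg m); elim: n m nm => // n IH m nm.
  have [->|/eqP m1] := eqVneq m (mone : mon); first by rewrite fmonE.
  have [x mx] : exists x, m x != 0%N.
    apply: contrapT => /forallNP mx; apply: m1; apply/eqP/cmP => y.
    by rewrite cm1; apply/eqP/negPn/negP; exact: mx.
  rewrite -(divvarK mx); case: x mx => i k mx; rewrite -creU; apply: PS.
  apply: IH; move: nm; rewrite -{1}(divvarK mx) {1}/mulvar -lock mdegM mdegU add1n.
  by rewrite ltnS.
move=> u; rewrite (malg_sumE u); elim: (msupp u : seq _) => [|m s IH].
  by rewrite big_nil.
rewrite big_cons; apply: PL IH; rewrite -fmonE; exact: Pm.
Qed.

Lemma fock_fock_model : fock_model cre ann vac.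
Proof.
split; [exact: fock_cre_lin|exact: fock_ann_lin|exact: fock_cre_comm|exact: fock_ann_cre|
        exact: fock_ann_vac|exact: fock_generated].
Qed.

End FockSpace.

(** * Products with series of operators *)

Section Twists.
Variables (F : fieldType) (I : eqType) (U V W : lmodType F).

Section RightTwist.
Variables (aU : I -> int -> U -> U) (aV : I -> int -> V -> V) (aW : I -> int -> W -> W).
Hypotheses (haV : heis_action aV) (haW : heis_action aW).
Variable e : nat -> U -> V.
Hypotheses (linE : forall t, linear (e t)) (e_ev0 : forall v, ev0 (fun t => e t v)).
Hypothesis e_comm : forall i k t v, aV i (Posz k) (e t v) = e t (aU i (Posz k) v).

(** The product of B(z) with the series of the operators e_t z^(-t). *)
Definition rtwist (B : fser V W) : fser U W := fun n v =>
  nsum (fun t => B (n + t%:Z) (e t v)).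

Lemma rtwist_ev0 (B : fser V W) n v : is_field B -> ev0 (fun t => B (n + t%:Z) (e t v)).
Proof.
move=> fB; apply: (ev0_morph (A := fun t => B (n + t%:Z))); last exact: e_ev0.
by move=> t; exact: (lin0 (field_lin fB _)).
Qed.

Lemma rtwist_field (B : fser V W) : is_field B -> is_field (rtwist B).
Proof.
move=> fB; split=> [n c u v|v].
  rewrite nsumZ -?nsumD; try exact: rtwist_ev0.
    by apply: eq_nsum => t; rewrite linE (field_lin fB).
  by apply: (ev0Z (fun=> c)); exact: rtwist_ev0.
have [K eK] := e_ev0 v.
have [M BM] : exists M : int, forall t n, (t < K)%N -> n < M -> B n (e t v) = 0.
  elim: K {eK} => [|K [M BM]]; first by exists 0.
  have [M' BM'] := field_trunc fB (e K v).
  exists (Num.min M M') => t n; rewrite lt_min ltnS leq_eqVlt.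
  by move=> /orP[/eqP ->|tK] /andP[? ?]; [exact: BM' | exact: BM].
exists (M - K%:Z) => n nM; apply: nsum0 => t.
have [tK|Kt] := ltnP t K; first by rewrite BM //; lia.
by rewrite eK // (lin0 (field_lin fB _)).
Qed.

(** The operators e_t commute with annihilation operators, hence do not disturb the
    right half of a normally ordered product. *)
Lemma rtwist_nord i m (B : fser V W) : is_field B ->
  rtwist (nord aV aW i m B) = nord aU aW i m (rtwist B).
Proof.
move=> fB; apply/funext => n; apply/funext => v.
have el : ev0 (fun t => nordl aW i m B (n + t%:Z) (e t v)).
  exact: (ev0_morph (A := fun t => nordl aW i m B (n + t%:Z)) (fun t =>
    lin0 (field_lin (nordl_field haW i m fB) _)) (e_ev0 v)).
have er : ev0 (fun t => nordr aV i m B (n + t%:Z) (e t v)).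
  exact: (ev0_morph (A := fun t => nordr aV i m B (n + t%:Z)) (fun t =>
    lin0 (field_lin (nordr_field haV i m fB) _)) (e_ev0 v)).
rewrite {1}/rtwist /nord nsumD //; last exact: (ev0Z (fun=> _)).
rewrite -nsumZ //; congr (_ + _ *: _).
  rewrite exchange_nsum; last first.
    apply: (ev02Z (fun k k' => _)); apply: ev02_intro => [|t].
      have [K eK] := e_ev0 v; exists K => t k /eK ->.
      by rewrite (lin0 (field_lin fB _)) (lin0 (ha_lin haW _ _)).
    apply: (ev0_morph (A := fun k => aW i (Negz (m + k)))); last exact: field_ev0.
    by move=> k; exact: (lin0 (ha_lin haW _ _)).
  apply: eq_nsum => k; have lA := ha_lin haW i (Negz (m + k)).
  rewrite (lin_nsum lA) ?nsumZ; try exact: rtwist_ev0.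
    by apply: eq_nsum => t; rewrite addrAC.
  by apply: (lin_ev0 lA); exact: rtwist_ev0.
rewrite exchange_nsum; last first.
  apply: (ev02Z (fun k k' => _)); apply: ev02_intro => [|t].
    have [K eK] := e_ev0 v; exists K => t k /eK ->.
    by rewrite (lin0 (ha_lin haV _ _)) (lin0 (field_lin fB _)).
  apply: (ev0_morph (A := fun k => B _)); last exact: ha_ev0.
  by move=> k; exact: (lin0 (field_lin fB _)).
apply: eq_nsum => k; rewrite /rtwist nsumZ; last exact: rtwist_ev0.
by apply: eq_nsum => t; rewrite e_comm addrAC.
Qed.

End RightTwist.

Section LeftTwist.
Variables (aU : I -> int -> U -> U) (aV : I -> int -> V -> V) (aW : I -> int -> W -> W).
Hypotheses (haV : heis_action aV) (haW : heis_action aW) (haU : heis_action aU).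
Variable e : nat -> V -> W.
Hypothesis linE : forall t, linear (e t).
Hypothesis e_comm : forall i k s v, aW i (Negz k) (e s v) = e s (aV i (Negz k) v).

(** The product of the series of the operators e_s z^s with B(z). *)
Definition ltwist (B : fser U V) : fser U W := fun n v =>
  nsum (fun s => e s (B (n - s%:Z) v)).

Lemma ltwist_ev0 (B : fser U V) n v : is_field B -> ev0 (fun s => e s (B (n - s%:Z) v)).
Proof.
move=> fB; apply: (ev0_morph (A := e)); last exact: field_ev0.
by move=> t; exact: (lin0 (linE _)).
Qed.

Lemma ltwist_field (B : fser U V) : is_field B -> is_field (ltwist B).
Proof.
move=> fB; split=> [n c u v|v].
  rewrite nsumZ -?nsumD; try exact: ltwist_ev0.
    by apply: eq_nsum => t; rewrite (field_lin fB) linE.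
  by apply: (ev0Z (fun=> c)); exact: ltwist_ev0.
have [N BN] := field_trunc fB v; exists N => n nN; apply: nsum0 => s.
by rewrite BN ?(lin0 (linE _)) //; lia.
Qed.

(** The operators e_s commute with creation operators, hence do not disturb the left
    half of a normally ordered product. *)
Lemma ltwist_nord i m (B : fser U V) : is_field B ->
  ltwist (nord aU aV i m B) = nord aU aW i m (ltwist B).
Proof.
move=> fB; apply/funext => n; apply/funext => v.
have fl := nordl_field haV i m fB; have fr := nordr_field haU i m fB.
transitivity (nsum (fun s => e s (nordl aV i m B (n - s%:Z) v)) +
  (-1) ^+ m *: nsum (fun s => e s (nordr aU i m B (n - s%:Z) v))).
  rewrite nsumZ -?nsumD; try exact: (ltwist_ev0 _ _ fl); try exact: (ltwist_ev0 _ _ fr).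
    by apply: eq_nsum => s; rewrite (linD (linE s)) (linZ (linE s)).
  by apply: (ev0Z (fun=> _)); exact: (ltwist_ev0 _ _ fr).
have [N BN] := field_trunc fB v.
congr (_ + _ *: _).
  transitivity (nsum (fun s => nsum (fun k =>
     'C(m + k, m)%:R *: aW i (Negz (m + k)) (e s (B (n - s%:Z - k%:Z) v))))).
    apply: eq_nsum => s; rewrite (lin_nsum (linE s)); last first.
      exact: (nord_ev0l haV _ _ _ _ _ fB).
    by apply: eq_nsum => k; rewrite (linZ (linE s)) e_comm.
  rewrite exchange_nsum; last first.
    apply: (ev02Z (fun k k' => _)); exists `|n - N|.+1 => s k sk.
    by rewrite BN ?(lin0 (linE _)) ?(lin0 (ha_lin haW _ _)) //; lia.
  apply: eq_nsum => k; have lA := ha_lin haW i (Negz (m + k)).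
  rewrite (lin_nsum lA) ?nsumZ; try exact: ltwist_ev0.
    by apply: eq_nsum => s; rewrite addrAC.
  by apply: (lin_ev0 lA); exact: ltwist_ev0.
transitivity (nsum (fun s => nsum (fun k =>
   'C(m + k, m)%:R *: e s (B (n - s%:Z + (m + k).+1%:Z) (aU i (Posz k) v))))).
  apply: eq_nsum => s; rewrite (lin_nsum (linE s)); last exact: (nord_ev0r haU _ _ _ _ fB).
  by apply: eq_nsum => k; rewrite (linZ (linE s)).
rewrite exchange_nsum; last first.
  apply: (ev02Z (fun k k' => _)); apply: ev02_swap; apply: ev02_intro => [|k].
    have [K aK] := ha_ev0 haU i v; exists K => k s /aK ->.
    by rewrite (lin0 (field_lin fB _)) (lin0 (linE _)).
  have [M BM] := ltwist_ev0 (n + (m + k).+1%:Z) (aU i (Posz k) v) fB.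
  by exists M => s /BM <-; rewrite addrAC.
apply: eq_nsum => k; rewrite nsumZ; last exact: ltwist_ev0.
by apply: eq_nsum => s; rewrite addrAC.
Qed.

End LeftTwist.
End Twists.

Section NormalOrderDerivative.
Variables (F : fieldType) (I : eqType) (V W : lmodType F).
Variables (aV : I -> int -> V -> V) (aW : I -> int -> W -> W).
Hypotheses (haV : heis_action aV) (haW : heis_action aW).

(** The Leibniz rule: the derivative of the m-th divided derivative of a^i(z) is
    m + 1 times the next one. *)
Lemma nord_fderiv i m (B : fser V W) n v : is_field B ->
  fderiv (nord aV aW i m B) n v =
  nord aV aW i m (fderiv B) n v + m.+1%:R *: nord aV aW i m.+1 B n v.
Proof.
move=> fB; rewrite /fderiv /nord scalerDr scalerA mulrC -scalerA.
have e1 c d n' : ev0 (fun k => c k *: aW i (d k) (B (n' - k%:Z) v)).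
  exact: (nord_ev0l haW _ _ _ _ _ fB).
have e2 c d : ev0 (fun k => c k *: B (d k) (aV i (Posz k) v)).
  exact: (nord_ev0r haV _ _ _ _ fB).
have -> : nordl aW i m (fun n v => (n + 1)%:~R *: B (n + 1) v) n v =
   nsum (fun k => ('C(m + k, m)%:R * (n - k%:Z + 1)%:~R) *:
     aW i (Negz (m + k)) (B (n + 1 - k%:Z) v)).
  apply: eq_nsum => k; rewrite (linZ (ha_lin haW _ _)) scalerA.
  by rewrite (addrAC n 1).
have -> : nordr aV i m (fun n v => (n + 1)%:~R *: B (n + 1) v) n v =
   nsum (fun k => ('C(m + k, m)%:R * (n + (m + k).+1%:Z + 1)%:~R) *:
     B (n + 1 + (m + k).+1%:Z) (aV i (Posz k) v)).
  by apply: eq_nsum => k; rewrite scalerA (addrAC n 1).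
have -> : (n + 1)%:~R *: nordl aW i m B (n + 1) v =
   nsum (fun k => ('C(m + k, m)%:R * (n - k%:Z + 1)%:~R) *:
     aW i (Negz (m + k)) (B (n + 1 - k%:Z) v)) + m.+1%:R *: nordl aW i m.+1 B n v.
  rewrite nsumZ; last exact: e1.
  transitivity (nsum (fun k => ('C(m + k, m)%:R * (n - k%:Z + 1)%:~R) *:
     aW i (Negz (m + k)) (B (n + 1 - k%:Z) v)) + nsum (fun k => ('C(m + k, m) * k)%:R *:
     aW i (Negz (m + k)) (B (n + 1 - k%:Z) v))).
    rewrite -nsumD; try exact: e1; apply: eq_nsum => k.
    rewrite scalerA -scalerDl; congr (_ *: _); rewrite natrM -mulrDr mulrC.
    by congr (_ * _); rewrite pmulrn -rmorphD /=; congr (_%:~R); lia.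
  congr (_ + _); rewrite nsumS; last exact: e1.
  rewrite muln0 scale0r add0r nsumZ; last exact: e1.
  apply: eq_nsum => k; rewrite scalerA -natrM addnS addSn.
  have -> : (m.+1 * 'C((m + k).+1, m.+1) = 'C((m + k).+1, m) * k.+1)%N.
    by rewrite mul_bin_left mulnC; congr (_ * _)%N; lia.
  by congr (_ *: aW i _ (B _ _)); lia.
have -> : (n + 1)%:~R *: nordr aV i m B (n + 1) v =
   nsum (fun k => ('C(m + k, m)%:R * (n + (m + k).+1%:Z + 1)%:~R) *:
     B (n + 1 + (m + k).+1%:Z) (aV i (Posz k) v)) - m.+1%:R *: nordr aV i m.+1 B n v.
  rewrite nsumZ; last exact: e2.
  rewrite -scaleNr nsumZ; last exact: e2.
  rewrite -nsumD; [|exact: e2|by apply: (ev0Z (fun=> _)); exact: e2].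
  apply: eq_nsum => k; rewrite !scalerA (_ : n + (m.+1 + k).+1%:Z = n + 1 + (m + k).+1%:Z).
    rewrite -scalerDl; congr (_ *: _); rewrite mulNr -natrM addSn -mul_bin_diag natrM.
    rewrite (mulrC (_.+1%:R)) -mulrBr mulrC; congr (_ * _).
    by rewrite (pmulrn _ (m + k).+1) -rmorphB /=; congr (_%:~R); lia.
  by lia.
rewrite exprS mulN1r scaleNr !scalerDr !scalerN !scalerA (mulrC m.+1%:R).
by rewrite addrACA.
Qed.

End NormalOrderDerivative.

(** * The intertwining operator: existence and uniqueness *)

Section Intertwiner.
Variable F : fieldType.
Hypothesis charF0 : [pchar F] =i pred0.
Variables (l : nat) (V : lmodType F).
Variables (cre ann : 'I_l -> nat -> V -> V) (vac : V).
Hypothesis fm : fock_model cre ann vac.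
Variable alpha : 'rV[F]_l.

(* the modes on M_0 and on M_alpha, which have the same underlying space *)
Let a0 := modes cre ann 0.
Let aa := modes cre ann alpha.
Let h0 : heis_action a0 := modes_heis_action fm 0.
Let ha : heis_action aa := modes_heis_action fm alpha.

Definition amode (n : int) (u : V) : V := \sum_(i < l) alpha 0 i *: a0 i n u.

Definition Aminus : fser V V := fun n u =>
  if 0 < n then (n%:~R)^-1 *: amode (- n) u else 0.
Definition Aplus : fser V V := fun n u =>
  if n < 0 then - (((- n)%:~R)^-1 *: amode (- n) u) else 0.
Definition zpow0 : fser V V := fun n u =>
  if \sum_(i < l) alpha 0 i * (0 : 'rV[F]_l) 0 i == n%:~R then u else 0.

(* [Ep n] is the coefficient of z^(-n) in Y_+(alpha, z) *)
Let Ap : fser V V := fun n => Aplus (- n).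
Let Em := fexp Aminus.
Let Ep := fexp Ap.

Lemma a0_zero i v : a0 i (Posz 0) v = 0.
Proof. by rewrite /a0 /= mxE scale0r. Qed.

Lemma amode_lin n : linear (amode n).
Proof.
move=> c u v; rewrite /amode scaler_sumr -big_split /=; apply: eq_bigr => i _.
by rewrite (ha_lin h0) scalerDr !scalerA mulrC.
Qed.

Lemma amode_comm i n m v : a0 i n (amode m v) =
  amode m (a0 i n v) + (if n + m == 0 then n%:~R * alpha 0 i else 0) *: v.
Proof.
rewrite /amode (big_morph _ (linD (ha_lin h0 i n)) (lin0 (ha_lin h0 i n))).
transitivity (\sum_(j < l) (alpha 0 j *: a0 j m (a0 i n v) +
   (if (i == j) && (n + m == 0) then n%:~R * alpha 0 j else 0) *: v)).
  apply: eq_bigr => j _; rewrite (linZ (ha_lin h0 i n)) (ha_comm h0) scalerDr.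
  rewrite scalerA; congr (_ + _ *: _).
  by case: ifP; rewrite ?mulr0 // mulrC.
rewrite big_split /=; congr (_ + _); rewrite (bigD1 i) //= eqxx big1 ?addr0 //.
by move=> j ji; rewrite eq_sym (negbTE ji) scale0r.
Qed.

Lemma Aminus_lin n : linear (Aminus n).
Proof.
move=> c u v; rewrite /Aminus; case: ifP => _; last by rewrite scaler0 addr0.
by rewrite amode_lin scalerDr !scalerA mulrC.
Qed.

Lemma Aminus_le0 n v : n <= 0 -> Aminus n v = 0.
Proof. by rewrite /Aminus ltNge => ->. Qed.

Lemma Ap_lin n : linear (Ap n).
Proof.
move=> c u v; rewrite /Ap /Aplus; case: ifP => _; last by rewrite scaler0 addr0.
by rewrite amode_lin scalerDr opprD !scalerA mulrC -scalerA scalerN.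
Qed.

Lemma Ap_le0 n v : n <= 0 -> Ap n v = 0.
Proof. by rewrite /Ap /Aplus oppr_lt0 ltNge => ->. Qed.

Lemma AminusE k v : Aminus (Posz k.+1) v = (k.+1%:R)^-1 *: amode (Negz k) v.
Proof. by []. Qed.

Lemma ApE k v : Ap (Posz k.+1) v = - ((k.+1%:R)^-1 *: amode (Posz k.+1) v).
Proof. by []. Qed.

Lemma Aminus_comm i n m v : a0 i n (Aminus m v) =
  Aminus m (a0 i n v) + (if (0 < m) && (n == m) then alpha 0 i else 0) *: v.
Proof.
rewrite /Aminus; case: ltP => m0 /=; last first.
  by rewrite (lin0 (ha_lin h0 i n)) scale0r addr0.
rewrite (linZ (ha_lin h0 i n)) amode_comm scalerDr scalerA subr_eq0.
congr (_ + _ *: _); case: eqP => [->|_]; last by rewrite mulr0.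
by rewrite mulKf // intF_eq0 //; lia.
Qed.

Lemma Ap_comm i n m v : a0 i n (Ap m v) =
  Ap m (a0 i n v) + (if (0 < m) && (n == - m) then alpha 0 i else 0) *: v.
Proof.
rewrite /Ap /Aplus oppr_lt0 opprK; case: ltP => m0 /=; last first.
  by rewrite (lin0 (ha_lin h0 i n)) scale0r addr0.
rewrite -!scaleNr (linZ (ha_lin h0 i n)) amode_comm scalerDr scalerA.
congr (_ + _ *: _); rewrite addr_eq0; case: eqP => [->|_]; last by rewrite mulr0.
by rewrite mulrNz mulrA mulrNN mulVf ?mul1r // intF_eq0 //; lia.
Qed.

Lemma comm_amode (x : V -> V) n v : linear x ->
  (forall i v, x (a0 i n v) = a0 i n (x v)) -> x (amode n v) = amode n (x v).
Proof.
move=> lx xa; rewrite /amode (big_morph _ (linD lx) (lin0 lx)).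
by apply: eq_bigr => i _; rewrite (linZ lx) xa.
Qed.

Lemma Aminus_Aminus n m v : Aminus n (Aminus m v) = Aminus m (Aminus n v).
Proof.
have [n0|n0] := lerP n 0.
  by rewrite !(Aminus_le0 _ n0) (lin0 (Aminus_lin m)).
have AE w : Aminus n w = (n%:~R)^-1 *: amode (- n) w by rewrite /Aminus n0.
rewrite !AE (linZ (Aminus_lin m)).
congr (_ *: _); apply/esym/comm_amode; first exact: Aminus_lin.
by move=> i w; rewrite Aminus_comm ifF ?scale0r ?addr0 //; lia.
Qed.

Lemma Ap_Ap n m v : Ap n (Ap m v) = Ap m (Ap n v).
Proof.
have [n0|n0] := lerP n 0.
  by rewrite !(Ap_le0 _ n0) (lin0 (Ap_lin m)).
have AE w : Ap n w = (- (n%:~R)^-1) *: amode n w.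
  by rewrite /Ap /Aplus oppr_lt0 n0 opprK scaleNr.
rewrite !AE (linZ (Ap_lin m)).
congr (_ *: _); apply/esym/comm_amode; first exact: Ap_lin.
by move=> i w; rewrite Ap_comm ifF ?scale0r ?addr0 //; lia.
Qed.

Let Em_lin : forall n, linear (Em n) := fexp_lin charF0 Aminus_lin Aminus_le0 Aminus_Aminus.
Let Ep_lin : forall n, linear (Ep n) := fexp_lin charF0 Ap_lin Ap_le0 Ap_Ap.
Let Em_lt0 n v : n < 0 -> Em n v = 0 := @fexp_lt0 F V Aminus Aminus_lin Aminus_le0 n v.
Let Ep_lt0 n v : n < 0 -> Ep n v = 0 := @fexp_lt0 F V Ap Ap_lin Ap_le0 n v.

Lemma Em_creation i k n v : a0 i (Negz k) (Em n v) = Em n (a0 i (Negz k) v).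
Proof.
rewrite (@fexp_comm _ charF0 _ _ Aminus_lin Aminus_le0 Aminus_Aminus _ 0 0
  (ha_lin h0 i (Negz k))).
  by rewrite scale0r addr0.
by move=> m w; rewrite Aminus_comm if_same ifF //; lia.
Qed.

Lemma Em_annihilation i k n v : a0 i (Posz k.+1) (Em n v) =
  Em n (a0 i (Posz k.+1) v) + alpha 0 i *: Em (n - k.+1%:Z) v.
Proof.
apply: (fexp_comm charF0 Aminus_lin Aminus_le0 Aminus_Aminus (ha_lin h0 _ _)).
move=> m w; rewrite Aminus_comm; congr (_ + _ *: _).
by rewrite (eq_sym m); case: eqP => [<-|]; rewrite ?andbF.
Qed.

Lemma Ep_annihilation i k n v : a0 i (Posz k) (Ep n v) = Ep n (a0 i (Posz k) v).
Proof.
rewrite (@fexp_comm _ charF0 _ _ Ap_lin Ap_le0 Ap_Ap _ 0 0 (ha_lin h0 i (Posz k))).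
  by rewrite scale0r addr0.
by move=> m w; rewrite Ap_comm if_same ifF //; lia.
Qed.

Lemma Ep_creation i k n v : a0 i (Negz k) (Ep n v) =
  Ep n (a0 i (Negz k) v) + alpha 0 i *: Ep (n - k.+1%:Z) v.
Proof.
apply: (fexp_comm charF0 Ap_lin Ap_le0 Ap_Ap (ha_lin h0 _ _)).
move=> m w; rewrite Ap_comm; congr (_ + _ *: _).
rewrite (_ : (Negz k == - m) = (m == k.+1%:Z)); last by apply/eqP/eqP; lia.
by case: eqP => [->|]; rewrite ?andbF.
Qed.

Lemma Em_deriv (n : int) v : n%:~R *: Em n v =
  nsum (fun j => amode (Negz j) (Em (n - j.+1%:Z) v)).
Proof.
rewrite /Em (fexp_deriv charF0 Aminus_lin Aminus_le0 Aminus_Aminus).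
apply: eq_nsum => j; rewrite AminusE scalerA divff ?scale1r //.
exact: natF_neq0.
Qed.

Lemma Ep_deriv (n : int) v : n%:~R *: Ep n v =
  - nsum (fun j => Ep (n - j.+1%:Z) (amode (Posz j.+1) v)).
Proof.
rewrite /Ep (fexp_deriv charF0 Ap_lin Ap_le0 Ap_Ap) -scaleN1r nsumZ; last first.
  by exists `|n|.+1 => j nj; apply: Ep_lt0; lia.
apply: eq_nsum => j; rewrite (fexp_A charF0 Ap_lin Ap_le0 Ap_Ap) ApE.
rewrite -scaleNr -/Ep (linZ (Ep_lin _)) scalerA mulrN divff ?scaleN1r //.
exact: natF_neq0.
Qed.

Lemma Em0 v : Em 0 v = v.
Proof. exact: (fexp0 Aminus_lin Aminus_le0). Qed.

Lemma Ep0 v : Ep 0 v = v.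
Proof. exact: (fexp0 Ap_lin Ap_le0). Qed.

Lemma a0_vac i k : a0 i (Posz k) vac = 0.
Proof. by case: k => [|k]; [exact: a0_zero | exact: (ann_vac fm)]. Qed.

Lemma Ep_vac (n : int) : 0 < n -> Ep n vac = 0.
Proof.
move=> n0; have nz : (n%:~R : F) != 0 by rewrite intF_eq0 //; lia.
apply: (scalerI nz); rewrite Ep_deriv scaler0 nsum0 ?oppr0 // => j.
rewrite /amode big1 ?(lin0 (Ep_lin _)) // => i _.
by rewrite a0_vac scaler0.
Qed.

(** Y_+ fixes the vacuum, and moving a creation operator across it only shifts the
    exponent, so that Y_+(alpha, z) v is a polynomial in 1/z. *)
Lemma Ep_ev0 v : ev0 (fun t => Ep (Posz t) v).
Proof.
elim/(fock_ind fm): v => [c u v [N uN] [M vM]||i k u [N uN]].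
- exists (maxn N M) => t; rewrite geq_max => /andP[/uN u0 /vM v0].
  by rewrite Ep_lin u0 v0 scaler0 addr0.
- by exists 1%N => t t0; apply: Ep_vac; lia.
exists (N + k.+1)%N => t Nt; have := Ep_creation i k (Posz t) u.
rewrite uN; last by lia.
rewrite (lin0 (ha_lin h0 _ _)) (_ : Posz t - k.+1%:Z = Posz (t - k.+1)); last by lia.
by rewrite uN; [rewrite scaler0 addr0 => <- | lia].
Qed.

Variable Y : 'rV[F]_l -> V -> fser V V.
Hypothesis vY : forall beta, vertex_map a0 (modes cre ann beta) (modes cre ann beta) (Y beta).
Hypothesis Y_vac : forall beta, Y beta vac = @fone F V.

Let em s := Em (Posz s).
Let ep t := Ep (Posz t).

(** The operator e^(alpha.q) Y_-(alpha, z) Y(u, z) Y_+(alpha, z). *)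
Definition intertwiner (u : V) : fser V V :=
  ltwist em (rtwist ep (Y 0 u)).

Lemma fmul_intertwiner u n v :
  fmul (fexp Aminus) (fmul (Y 0 u) (fmul (fexp Aplus) zpow0)) n v = intertwiner u n v.
Proof.
have f0 := vm_field (vY 0) u.
have E3 m w : fmul (fexp Aplus) zpow0 m w = Ep (- m) w.
  have -> : Ep (- m) w = fexp Aplus m w by rewrite fexp_opp.
  rewrite /fmul (fsum_seq (s := [:: m])) ?big_seq1 //.
    rewrite /zpow0 subrr big1 ?eqxx // => i _; first by rewrite mxE mulr0.
  move=> k; rewrite inE => km; rewrite /zpow0 big1 => [|i _]; last by rewrite mxE mulr0.
  rewrite eq_sym intF_eq0 // subr_eq0 eq_sym (negbTE km) fexp_opp.
  exact: (lin0 (Ep_lin (- k))).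
have E2 m w : fmul (Y 0 u) (fmul (fexp Aplus) zpow0) m w = rtwist ep (Y 0 u) m w.
  rewrite {1}/fmul (@fsum_nsum _ _ (fun t : nat => m + t%:Z)).
  - apply: eq_nsum => t; rewrite E3.
    by congr (Y 0 u _ (Ep _ w)); lia.
  - by move=> i j; lia.
  move=> k km; rewrite E3 Ep_lt0 ?(lin0 (field_lin f0 _)) //.
  have [//|mk] := ltP; exfalso; apply: (km `|k - m|%N); lia.
rewrite {1}/fmul (@fsum_nsum _ _ Posz).
- by apply: eq_nsum => s; rewrite E2.
- by move=> i j [].
by case=> [k km|k _]; [case: (km k) | exact: Em_lt0].
Qed.

Let field_r u : is_field (rtwist ep (Y 0 u)).
Proof.
apply: rtwist_field => //; [exact: Ep_lin|exact: Ep_ev0|exact: vm_field (vY 0) u].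
Qed.

(** Y_- commutes with creation operators and Y_+ with annihilation operators, so both
    factors pass through normally ordered products. *)
Lemma intertwiner_vertex_map : vertex_map aa a0 aa intertwiner.
Proof.
have f0 u := vm_field (vY 0) u.
split=> [n v c u w|u|i m u n v].
- rewrite /intertwiner /ltwist nsumZ -?nsumD.
  + apply: eq_nsum => s; rewrite -[RHS]Em_lin; congr (Em _ _).
    rewrite /rtwist nsumZ -?nsumD.
    * by apply: eq_nsum => t; rewrite (vm_lin (vY 0)).
    * by apply: (ev0Z (fun=> c)); exact: (rtwist_ev0 Ep_ev0).
    * exact: (rtwist_ev0 Ep_ev0).
    * exact: (rtwist_ev0 Ep_ev0).
  + by apply: (ev0Z (fun=> c)); exact: (ltwist_ev0 (fun s => Em_lin s)).
  + exact: (ltwist_ev0 (fun s => Em_lin s)).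
  + exact: (ltwist_ev0 (fun s => Em_lin s)).
- apply: ltwist_field; [exact: (fun s => Em_lin s)|exact: field_r].
rewrite /intertwiner; have -> : Y 0 (aa i (Negz m) u) = nord a0 a0 i m (Y 0 u).
  by apply/funext => x; apply/funext => y; rewrite -(vm_nord (vY 0)).
rewrite (rtwist_nord h0 h0 Ep_ev0 (fun j k t w => Ep_annihilation j k t w)) //.
have Ec j k s w : aa j (Negz k) (em s w) = em s (a0 j (Negz k) w).
  exact: Em_creation.
by rewrite (ltwist_nord h0 ha h0 (fun s => Em_lin s) Ec).
Qed.


Lemma intertwiner_vac c v :
  intertwiner vac c v = nsum (fun s => Em (Posz s) (Ep (Posz s - c) v)).
Proof.
apply: eq_nsum => s; congr (Em _ _); rewrite /rtwist Y_vac /fone.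
have [sc|sc] := lerP c (Posz s); last first.
  rewrite Ep_lt0; last by lia.
  by apply: nsum0 => t; rewrite ifF //; lia.
rewrite (@nsum1 _ `|(Posz s - c)%R|%N).
  rewrite ifT; last by lia.
  by have -> : Posz s - c = Posz `|(Posz s - c)%R|%N by lia.
by move=> t ts; rewrite ifF //; lia.
Qed.

Lemma vac_ev0 c v : ev0 (fun s => Em (Posz s) (Ep (Posz s - c) v)).
Proof.
have [N EN] := Ep_ev0 v; exists (N + `|c|)%N => s Ns.
rewrite (_ : Posz s - c = Posz `|(Posz s - c)%R|%N); last by lia.
by rewrite EN ?(lin0 (Em_lin _)) //; lia.
Qed.

Lemma vac_shift k c v :
  nsum (fun s => Em (Posz s - Posz k) (Ep (Posz s - c) v)) = intertwiner vac (c - Posz k) v.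
Proof.
rewrite intertwiner_vac (@nsum_shift _ k).
- apply: eq_nsum => s.
  have -> : Posz (k + s) - Posz k = Posz s by lia.
  by have -> : Posz (k + s) - c = Posz s - (c - Posz k) by lia.
- have [N EN] := Ep_ev0 v; exists (N + `|c|)%N => s Ns.
  rewrite (_ : Posz s - c = Posz `|(Posz s - c)%R|%N); last by lia.
  by rewrite EN ?(lin0 (Em_lin _)) //; lia.
- by move=> s sk; rewrite Em_lt0 //; lia.
Qed.

Lemma a_vac i k : aa i (Posz k) vac = (if k == 0%N then alpha 0 i else 0) *: vac.
Proof. by case: k => [|k] //=; rewrite scale0r; exact: (ann_vac fm). Qed.

(** Among the a^i(j) with j >= 0 only a^i(0) acts nontrivially on the label e^alpha,
    by the scalar alpha^i. The
    modes a^i(n) with n > 0 get their commutator alpha^i z^n from Y_-, those with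
    n < 0 get it from Y_+, and a^i(0) gets it from the shift of the module. *)
Lemma intertwiner_comm_vac : comm_formula aa a0 aa intertwiner vac.
Proof.
move=> i n c v; have lv := vm_lin intertwiner_vertex_map.
have -> : nsum (fun j => gbin F n j *:
    intertwiner (aa i (Posz j) vac) (c - n + Posz j) v) =
    alpha 0 i *: intertwiner vac (c - n) v.
  rewrite (@nsum1 _ 0%N) => [|j j0]; last first.
    by rewrite a_vac (negbTE j0) scale0r (lin0 (lv _ _)) scaler0.
  by rewrite gbin0 scale1r a_vac (linZ (lv _ _)) addr0.
have lX m := field_lin (vm_field intertwiner_vertex_map vac) m.
have la := ha_lin ha i n.
case: n la => [[|k]|k] la.
- by rewrite a0_zero (lin0 (lX _)) add0r subr0.
- rewrite -(vac_shift k.+1) !intertwiner_vac (lin_nsum la); last exact: vac_ev0.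
  have ek : ev0 (fun s => Em (Posz s - k.+1%:Z) (Ep (Posz s - c) v)).
    have [N EN] := Ep_ev0 v; exists (N + `|c|)%N => s Ns.
    rewrite (_ : Posz s - c = Posz `|(Posz s - c)%R|%N); last by lia.
    by rewrite EN ?(lin0 (Em_lin _)) //; lia.
  rewrite nsumZ // -nsumD; [|exact: vac_ev0|exact: (ev0Z (fun=> _))].
  apply: eq_nsum => s; rewrite -Ep_annihilation; exact: Em_annihilation.
rewrite !intertwiner_vac (lin_nsum la); last exact: vac_ev0.
have ek : ev0 (fun s => Em (Posz s) (Ep (Posz s - (c - Negz k)) v)) by exact: vac_ev0.
rewrite nsumZ // -nsumD; [|exact: vac_ev0|exact: (ev0Z (fun=> _))].
apply: eq_nsum => s; apply: etrans (Em_creation _ _ _ _) _.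
rewrite Ep_creation (linD (Em_lin _)) (linZ (Em_lin _)).
by have -> : Posz s - c - k.+1%:Z = Posz s - (c - Negz k) by lia.
Qed.

Lemma comm_formula_all (b g : 'rV[F]_l) (d : 'rV[F]_l) (P : V -> fser V V) :
  vertex_map (modes cre ann d) (modes cre ann b) (modes cre ann g) P ->
  comm_formula (modes cre ann d) (modes cre ann b) (modes cre ann g) P vac ->
  forall u, comm_formula (modes cre ann d) (modes cre ann b) (modes cre ann g) P u.
Proof.
move=> vP cv; have hd := modes_heis_action fm d.
elim/(fock_ind fm) => [k u w IHu IHw|//|j m u IH].
  move=> i n c v; rewrite (vm_lin vP) (linD (ha_lin (modes_heis_action fm g) _ _)).
  rewrite (linZ (ha_lin (modes_heis_action fm g) _ _)) IHu IHw (vm_lin vP).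
  rewrite scalerDr addrACA; congr (_ + _).
  have e y := comm_ev0 hd i y (gbin F n) (fun j => c - n + Posz j) v vP.
  rewrite nsumZ -?nsumD; [|by apply: (ev0Z (fun=> k)); exact: e|exact: e|exact: e].
  apply: eq_nsum => x; rewrite (ha_lin hd) (vm_lin vP) scalerDr !scalerA.
  by rewrite mulrC.
exact: (comm_formula_creation charF0 hd (modes_heis_action fm b)
  (modes_heis_action fm g) j m vP IH).
Qed.

Lemma intertwiner_comm u : comm_formula aa a0 aa intertwiner u.
Proof. exact: comm_formula_all intertwiner_vertex_map intertwiner_comm_vac u. Qed.

Lemma Y_comm beta u :
  comm_formula a0 (modes cre ann beta) (modes cre ann beta) (Y beta) u.
Proof.
apply: comm_formula_all => // i n c v; rewrite nsum0 => [|j]; last first.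
  by rewrite -/a0 a0_vac (lin0 (vm_lin (vY beta) _ _)) scaler0.
rewrite addr0 Y_vac /fone; case: eqP => // _.
exact: lin0 (ha_lin (modes_heis_action fm beta) i n).
Qed.

(** On the vacuum only the creation half of normally ordered products survives, so
    the constant term reproduces the creation operators of the label. *)
Lemma creative_of_vac (P : V -> fser V V) : vertex_map aa a0 aa P ->
  P vac 0 vac = vac -> (forall n : int, n < 0 -> P vac n vac = 0) ->
  forall u, P u 0 vac = u /\ (forall n : int, n < 0 -> P u n vac = 0).
Proof.
move=> vP P0 Pn; elim/(fock_ind fm) => [c u w [u0 un] [w0 wn]|//|i m u [u0 un]].
  split=> [|n n0]; rewrite (vm_lin vP) ?u0 ?w0 //.
  by rewrite un // wn // scaler0 addr0.
have E n : P (cre i m u) n vac = nordl aa i m (P u) n vac.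
  have := vm_nord vP i m u n vac; rewrite /nord /= => ->.
  rewrite [X in _ *: X]nsum0 ?scaler0 ?addr0 // => k.
  by rewrite a0_vac (lin0 (field_lin (vm_field vP u) _)) scaler0.
split=> [|n n0]; rewrite E.
  rewrite /nordl (@nsum1 _ 0%N) => [|k k0]; last first.
    by rewrite un ?(lin0 (ha_lin ha _ _)) ?scaler0 //; lia.
  by rewrite addn0 binn scale1r subr0 u0.
rewrite /nordl nsum0 // => k.
by rewrite un ?(lin0 (ha_lin ha _ _)) ?scaler0 //; lia.
Qed.

Lemma intertwiner_creative u :
  intertwiner u 0 vac = u /\ (forall n : int, n < 0 -> intertwiner u n vac = 0).
Proof.
apply: creative_of_vac; first exact: intertwiner_vertex_map.
  rewrite intertwiner_vac (@nsum1 _ 0%N) => [|s s0].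
    by rewrite subr0 Ep0 Em0.
  by rewrite Ep_vac ?(lin0 (Em_lin _)) //; lia.
move=> n n0; rewrite intertwiner_vac nsum0 // => s.
by rewrite Ep_vac ?(lin0 (Em_lin _)) //; lia.
Qed.

(** Induction on the label u: the delta function identity for the vacuum, and
    [jacobi_at_creation] for each further creation operator. *)
Lemma Y_jacobi (P : V -> fser V V) : vertex_map aa a0 aa P ->
  (forall w, comm_formula aa a0 aa P w) ->
  forall u w v, jacobi_at (Y 0) (Y alpha) P u w v.
Proof.
move=> vP cP; elim/(fock_ind fm) => [c u u' IHu IHu'||i m u IH] w v.
- apply: jac_ext (jacD (jac_lin (linear_scale c) (IHu w v)) (IHu' w v)) _ _ _ => x y.
  + by rewrite /J1 (vm_lin (vY alpha)).
  + by rewrite /J2 (vm_lin (vY 0)) (field_lin (vm_field vP w)).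
  + by rewrite /J3 (vm_lin (vY alpha)) (vm_lin vP).
- apply: jac_ext (jac_delta charF0 (field_trunc (vm_field vP w) v)) _ _ _ => x y.
  + by rewrite /J1 Y_vac.
  + by rewrite /J2 Y_vac /fone; case: eqP; rewrite ?(lin0 (field_lin (vm_field vP w) _)).
  + by rewrite /J3 Y_vac /fone; case: eqP; rewrite ?(lin0 (vm_lin vP _ _)).
exact: (jacobi_at_creation charF0 h0 ha (vY 0) (vY alpha) vP cP i m w v IH).
Qed.

Definition conformal : V := 2%:R^-1 *: \sum_(i < l) a0 i (-1) (a0 i (-1) vac).

Let Lneg1 := Y alpha conformal (-1).

Lemma Y_generator beta i n v : Y beta (cre i 0 vac) n v = modes cre ann beta i (- n - 1) v.
Proof.
have hb := modes_heis_action fm beta.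
have := vm_nord (vY beta) i 0 vac n v; rewrite /nord /nordl /nordr Y_vac => E.
apply: etrans E _; rewrite expr0 scale1r.
have z (k : nat) (w : V) x : w = 0 -> 'C(0 + k, 0)%:R *: modes cre ann beta i x w = 0.
  by move=> ->; rewrite (lin0 (ha_lin hb _ _)) scaler0.
case: n => [n|n].
  rewrite (@nsum1 _ n) => [|k kn]; last by apply: z; rewrite /fone ifF //; lia.
  rewrite nsum0 => [|k]; last by rewrite /fone ifF ?scaler0 //; lia.
  rewrite /fone subrr eqxx bin0 scale1r addr0; congr (modes _ _ _ _ _ v); lia.
rewrite nsum0 => [|k]; last by apply: z; rewrite /fone ifF //; lia.
rewrite add0r (@nsum1 _ n) => [|k kn]; last by rewrite /fone ifF ?scaler0 //; lia.
rewrite /fone ifT; last by lia.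
by rewrite bin0 scale1r; congr (modes _ _ _ _ _ v); lia.
Qed.

Lemma Lneg1_vac : Lneg1 vac = \sum_(i < l) alpha 0 i *: cre i 0 vac.
Proof.
have lY := vm_lin (vY alpha) (-1) vac.
rewrite /Lneg1 /conformal (linZ lY) (big_morph _ (linD lY) (lin0 lY)).
rewrite scaler_sumr; apply: eq_bigr => i _.
have := vm_nord (vY alpha) i 0 (cre i 0 vac) (-1) vac; rewrite /nord /nordl /nordr.
rewrite (_ : a0 i (Negz 0) _ = a0 i (-1) (a0 i (-1) vac)) // => ->.
rewrite expr0 scale1r (@nsum1 _ 0%N) => [|k k0]; last first.
  rewrite Y_generator (_ : - (-1 - Posz k) - 1 = Posz k); last by lia.
  by rewrite -/aa a_vac (negbTE k0) scale0r (lin0 (ha_lin ha _ _)) scaler0.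
rewrite (@nsum1 _ 0%N) => [|k k0]; last first.
  rewrite -/aa a_vac (negbTE k0) scale0r (lin0 (field_lin (vm_field (vY alpha) _) _)).
  by rewrite scaler0.
rewrite !Y_generator bin0 !scale1r (_ : - (-1 - 0%:Z) - 1 = Posz 0) //.
rewrite -/aa a_vac /= (linZ (cre_lin fm i 0)) -mulr2n -scaler_nat scalerA mulVf ?scale1r //.
exact: natF_neq0.
Qed.

Lemma a0_conformal i j : a0 i (Posz j) conformal = if j == 1%N then cre i 0 vac else 0.
Proof.
have la := ha_lin h0 i (Posz j).
case: j la => [|j] la; first exact: a0_zero.
rewrite /conformal (linZ la) (big_morph _ (linD la) (lin0 la)).
rewrite (bigD1 i) //= big1 => [|k ki]; last first.
  rewrite !(ann_cre fm) (ann_vac fm) (eq_sym i) (negbTE ki) /= !scale0r !addr0.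
  by rewrite !(lin0 (cre_lin fm _ _)).
rewrite !(ann_cre fm) (ann_vac fm) eqxx /= addr0 (lin0 (cre_lin fm _ _)) add0r.
case: j {la} => [|j] /=; last by rewrite !scale0r (lin0 (cre_lin fm _ _)) addr0 scaler0.
rewrite !scale1r -mulr2n -scaler_nat scalerA mulVf ?scale1r //.
exact: natF_neq0.
Qed.

(** The commutator formula for the label omega, for which only a^i(1) omega = a^i(-1) 1
    contributes. *)
Lemma Lneg1_creation i m v : Lneg1 (cre i m v) = cre i m (Lneg1 v) + m.+1%:R *: cre i m.+1 v.
Proof.
have := Y_comm alpha conformal i (Negz m) (-1) v.
rewrite (@nsum1 _ 1%N) => [|j j1]; last first.
  by rewrite a0_conformal (negbTE j1) (lin0 (vm_lin (vY alpha) _ _)) scaler0.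
rewrite a0_conformal /= Y_generator (_ : - (-1 - Negz m + 1) - 1 = Negz m.+1); last by lia.
rewrite -/Lneg1 => ->; rewrite -addrA -scalerDl (_ : gbin F (Negz m) 1 = - m.+1%:R).
  by rewrite addNr scale0r addr0.
by rewrite /gbin big_ord1 (_ : 1`! = 1%N) // divr1 subr0 NegzE mulrNz.
Qed.

Lemma amode_ev0 v : ev0 (fun j => amode (Posz j) v).
Proof.
apply: ev0_sum => i; apply: (ev0Z (fun=> _)); exact: (ha_ev0 h0 i v).
Qed.

(** As L(-1) e^alpha = alpha(-1) e^alpha, this is the normally ordered product of
    alpha(z) with P(e^alpha, z). *)
Lemma translation_vac (P : V -> fser V V) n v : vertex_map aa a0 aa P ->
  P (Lneg1 vac) n v = nsum (fun j => amode (Negz j) (P vac (n - Posz j) v))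
    + nsum (fun j => P vac (n + 1 + Posz j.+1) (amode (Posz j.+1) v)).
Proof.
move=> vP; have lP := vm_lin vP n v; have fP := vm_field vP vac.
have e1 i : ev0 (fun j => alpha 0 i *: a0 i (Negz j) (P vac (n - Posz j) v)).
  exact: (nord_ev0l h0 i (fun=> alpha 0 i) (fun j => Negz j) n v fP).
have e2 i : ev0 (fun j => alpha 0 i *: P vac (n + (Posz j.+1)) (a0 i (Posz j) v)).
  exact: (nord_ev0r h0 i (fun=> alpha 0 i) (fun j => n + Posz j.+1) v fP).
rewrite Lneg1_vac (big_morph _ (linD lP) (lin0 lP)).
transitivity (\sum_(i < l) (nsum (fun j => alpha 0 i *: a0 i (Negz j) (P vac (n - Posz j) v))
  + nsum (fun j => alpha 0 i *: P vac (n + (Posz j.+1)) (a0 i (Posz j) v)))).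
  apply: eq_bigr => i _; rewrite (linZ lP).
  have := vm_nord vP i 0 vac n v; rewrite /nord /nordl /nordr expr0 scale1r => E.
  apply: etrans (congr1 _ E) _; rewrite scalerDr !nsumZ.
  - by congr (_ + _); apply: eq_nsum => j; rewrite bin0 scale1r.
  - exact: (nord_ev0r h0 _ _ _ _ fP).
  - exact: (nord_ev0l ha _ _ _ _ _ fP).
rewrite big_split /=; congr (_ + _); first by rewrite -nsum_sum.
rewrite -nsum_sum // nsumS; last exact: ev0_sum.
rewrite big1 ?add0r => [|i _]; last first.
  by rewrite mxE scale0r (lin0 (field_lin fP _)) scaler0.
apply: eq_nsum => j; rewrite /amode.
rewrite (big_morph _ (linD (field_lin fP _)) (lin0 (field_lin fP _))).
apply: eq_bigr => i _; rewrite (linZ (field_lin fP _)).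
by have -> : n + Posz j.+2 = n + 1 + Posz j.+1 by lia.
Qed.

(** Differentiating Y_- brings down the creation half of alpha(z) on the left and
    differentiating Y_+ its annihilation half on the right. *)
Lemma intertwiner_translation_vac n v :
  intertwiner (Lneg1 vac) n v = fderiv (intertwiner vac) n v.
Proof.
rewrite (translation_vac n v intertwiner_vertex_map) /fderiv.
set c := n + 1.
have [N EN] := Ep_ev0 v; have [J aJ] := amode_ev0 v.
have Elarge s : (N + `|c| <= s)%N -> Ep (Posz s - c) v = 0.
  move=> Ns; rewrite (_ : Posz s - c = Posz `|(Posz s - c)%R|%N); last by lia.
  by apply: EN; lia.
pose f (s j : nat) := amode (Negz j) (Em (Posz s - Posz j.+1) (Ep (Posz s - c) v)).
pose g (s j : nat) := Em (Posz s) (Ep (Posz s - c - Posz j.+1) (amode (Posz j.+1) v)).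
have ef : ev02 f.
  apply: ev02_intro => [|s].
    exists (N + `|c|)%N => s j /Elarge; rewrite /f => ->.
    by rewrite (lin0 (Em_lin _)) (lin0 (amode_lin _)).
  by exists s => j sj; rewrite /f Em_lt0 ?(lin0 (amode_lin _)) //; lia.
have eg : ev02 g.
  apply: ev02_swap; apply: ev02_intro => [|j].
    exists J => j s Jj; rewrite /g aJ; last exact: leqW.
    by rewrite (lin0 (Ep_lin _)) (lin0 (Em_lin _)).
  have [M EM] := vac_ev0 (c + Posz j.+1) (amode (Posz j.+1) v).
  exists M => s Ms; rewrite /g.
  by have -> : Posz s - c - Posz j.+1 = Posz s - (c + Posz j.+1); [lia | exact: EM].
transitivity (nsum (fun s => nsum (f s) + nsum (g s))); last first.
  rewrite intertwiner_vac nsumZ; last exact: vac_ev0.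
  apply: eq_nsum => s.
  have -> : nsum (f s) = (Posz s)%:~R *: Em (Posz s) (Ep (Posz s - c) v).
    by rewrite Em_deriv.
  have -> : nsum (g s) = - (Posz s - c)%:~R *: Em (Posz s) (Ep (Posz s - c) v).
    rewrite scaleNr -(linZ (Em_lin _)) Ep_deriv -scaleN1r -(linZ (Em_lin _)).
    rewrite scalerN scaleN1r opprK (lin_nsum (Em_lin _)) //.
    exists J => j Jj; rewrite aJ ?(lin0 (Ep_lin _)) //; exact: leqW.
  rewrite -scalerDl; congr (_ *: _); rewrite rmorphB /=; ring.
rewrite nsumD; [|exact: ev02_ev0_nsum|exact: ev02_ev0_nsum]; congr (_ + _).
  rewrite exchange_nsum //; apply: eq_nsum => j.
  have -> : n - Posz j = c - Posz j.+1 by rewrite /c; lia.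
  rewrite -vac_shift (lin_nsum (amode_lin _)) //.
  exists (N + `|c|)%N => s /Elarge ->; exact: (lin0 (Em_lin _)).
rewrite exchange_nsum //; apply: eq_nsum => j; rewrite intertwiner_vac.
apply: eq_nsum => s; rewrite /g.
by have -> : Posz s - c - Posz j.+1 = Posz s - (c + Posz j.+1) by lia.
Qed.

(** Moving L(-1) across a creation operator of the label corresponds to the Leibniz
    rule for normally ordered products, which reduces the claim to the label
    e^alpha. *)
Lemma intertwiner_translation u n v :
  intertwiner (Lneg1 u) n v = fderiv (intertwiner u) n v.
Proof.
have vP := intertwiner_vertex_map; have lL := field_lin (vm_field (vY alpha) conformal) (-1).
elim/(fock_ind fm): u n v => [k u w IHu IHw||i m u IH] n v.
- rewrite /Lneg1 lL (vm_lin vP) -/Lneg1 IHu IHw /fderiv (vm_lin vP).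
  by rewrite scalerDr !scalerA mulrC.
- exact: intertwiner_translation_vac.
rewrite Lneg1_creation (linD (vm_lin vP n v)) (linZ (vm_lin vP n v)).
have E k w : intertwiner (cre i k w) = nord a0 aa i k (intertwiner w).
  by apply/funext => x; apply/funext => y; rewrite -(vm_nord vP).
have ET : intertwiner (Lneg1 u) = fderiv (intertwiner u).
  by apply/funext => x; apply/funext => y; exact: IH.
by rewrite !E (nord_fderiv h0 ha _ _ _ _ (vm_field vP u)) ET.
Qed.

(** The commutators move creation operators out of the argument and normal ordering
    moves them out of the label, so that only the values on the label e^alpha and
    the argument 1 remain. *)
Lemma vertex_map_unique (P Q : V -> fser V V) :
  vertex_map aa a0 aa P -> vertex_map aa a0 aa Q ->
  comm_formula aa a0 aa P vac -> comm_formula aa a0 aa Q vac ->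
  (forall n, P vac n vac = Q vac n vac) -> forall u n v, P u n v = Q u n v.
Proof.
move=> vP vQ cP cQ PQ.
have C (R : V -> fser V V) : vertex_map aa a0 aa R -> comm_formula aa a0 aa R vac ->
    forall i k c v, R vac c (cre i k v) =
      cre i k (R vac c v) - alpha 0 i *: R vac (c + Posz k.+1) v.
  move=> vR cR i k c v; have := cR i (Negz k) c v.
  rewrite (@nsum1 _ 0%N) => [|j j0]; last first.
    by rewrite a_vac (negbTE j0) scale0r (lin0 (vm_lin vR _ _)) scaler0.
  rewrite gbin0 scale1r a_vac (linZ (vm_lin vR _ _)) addr0 /= => ->.
  by rewrite addrK.
have PQv n v : P vac n v = Q vac n v.
  elim/(fock_ind fm): v n => [c u v IHu IHv|//|i k v IH] n.
    by rewrite (field_lin (vm_field vP vac)) IHu IHv (field_lin (vm_field vQ vac)).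
  by rewrite (C P) // (C Q) // !IH.
elim/(fock_ind fm) => [c u w IHu IHw|//|i m u IH] n v.
  by rewrite (vm_lin vP) IHu IHw (vm_lin vQ).
have E : P u = Q u by apply/funext => x; apply/funext => y; exact: IH.
have := vm_nord vP i m u n v; have := vm_nord vQ i m u n v; rewrite E => <- //.
Qed.

Section FromJacobi.
Variable P : V -> fser V V.
Hypothesis P_lin : forall n v, linear (fun u => P u n v).
Hypothesis P_field : forall u, is_field (P u).
Hypothesis P_jacobi : forall u w v, jacobi_at (Y 0) (Y alpha) P u w v.

(** The coefficient of z_0^(-1) in the Jacobi identity for u = a^i(-1) 1. *)
Lemma jacobi_comm w : comm_formula aa a0 aa P w.
Proof.
move=> i n c v; have := jacE (P_jacobi (cre i 0 vac) w v) (-1) (- n - 1) c.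
rewrite (_ : - -1 - 1 = 0) // !binact0 expr0z scale1r /J1 /J2 !Y_generator.
rewrite (_ : - (- n - 1) - 1 = n); last by lia.
move=> /eqP; rewrite subr_eq addrC => /eqP E; apply: etrans E _; congr (_ + _).
apply: eq_nsum => j; rewrite expr1n mul1r /J3 Y_generator.
by rewrite (_ : - (-1 - Posz j) - 1 = Posz j) //; lia.
Qed.

(** The coefficient of z_1^(-1) in the Jacobi identity for u = a^i(-1) 1. *)
Lemma jacobi_nord i m w n v : P (aa i (Negz m) w) n v = nord a0 aa i m (P w) n v.
Proof.
have := jacE (P_jacobi (cre i 0 vac) w v) (Posz m) (-1) n.
rewrite (_ : - -1 - 1 = 0) // binact0 /J3 Y_generator.
rewrite (_ : - Posz m - 1 = Negz m) => [<-|]; last by lia.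
have G j : (-1) ^+ j * gbin F (Negz m) j = 'C(m + j, m)%:R.
  by rewrite NegzE sign_gbin_neg.
congr (_ + _).
  apply: eq_nsum => j; rewrite G /J1 Y_generator.
  by rewrite (_ : - (-1 - Negz m + Posz j) - 1 = Negz (m + j)) //; lia.
rewrite -scaleNr; congr (_ *: _).
  rewrite NegzE -exprnN -exprVn invrN1 exprS mulN1r opprK //.
apply: eq_nsum => j; rewrite G /J2 Y_generator.
rewrite (_ : - (-1 - Posz j) - 1 = Posz j); last by lia.
by rewrite (_ : n - Negz m + Posz j = n + (m + j).+1%:Z) //; lia.
Qed.

Hypothesis P_creative : forall u, P u 0 vac = u /\ (forall n : int, n < 0 -> P u n vac = 0).
Hypothesis P_translation : forall u n v, P (Lneg1 u) n v = fderiv (P u) n v.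

(** By [vertex_map_unique] it is enough to compare P(e^alpha, z) 1. The L(-1)-derivative
    property is a first order differential equation for it, and creativity fixes
    its initial value. *)
Lemma intertwiner_unique u n v : P u n v = intertwiner u n v.
Proof.
have vP : vertex_map aa a0 aa P by split=> //; exact: jacobi_nord.
have vI := intertwiner_vertex_map.
apply: (vertex_map_unique vP vI (jacobi_comm vac) intertwiner_comm_vac) => {}n.
have [P0 Pn] := P_creative vac; have [I0 In] := intertwiner_creative vac.
elim/int_strong_ind: n => [n|n n0 IH].
  by rewrite le_eqVlt => /orP[/eqP ->|n0]; rewrite ?P0 ?I0 // Pn // In.
have nz : (n%:~R : F) != 0 by rewrite intF_eq0 //; lia.
apply: (scalerI nz).
have D (R : V -> fser V V) : vertex_map aa a0 aa R ->
    (forall u n v, R (Lneg1 u) n v = fderiv (R u) n v) ->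
    n%:~R *: R vac n vac = nsum (fun j => amode (Negz j) (R vac (n - 1 - Posz j) vac)).
  move=> vR dR; have := translation_vac (n - 1) vac vR.
  rewrite dR /fderiv subrK => ->; rewrite [X in _ + X]nsum0 ?addr0 // => j.
  rewrite /amode big1 ?(lin0 (field_lin (vm_field vR vac) _)) // => i _.
  by rewrite a0_vac scaler0.
rewrite (D P) // (D intertwiner) //; last exact: intertwiner_translation.
by apply: eq_nsum => j; rewrite IH //; lia.
Qed.

End FromJacobi.
End Intertwiner.

Section Characterization.
Variable F : fieldType.
Hypothesis charF0 : [pchar F] =i pred0.
Variables (l : nat) (V : lmodType F).
Variables (cre ann : 'I_l -> nat -> V -> V) (vac : V).
Hypothesis fm : fock_model cre ann vac.
Variable Y : 'rV[F]_l -> V -> fser V V.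
Hypothesis vY : forall beta,
  vertex_map (modes cre ann 0) (modes cre ann beta) (modes cre ann beta) (Y beta).
Hypothesis Y_vac : forall beta, Y beta vac = @fone F V.
Variable alpha : 'rV[F]_l.

(** The coefficient of z^n is the mode -n-1. *)
Lemma is_field_mode (P : V -> fser V V) u v :
  (exists N : int, forall n, n < N -> P u n v = 0) <->
  (exists N : int, forall n, N <= n -> mode (P u) n v = 0).
Proof.
split=> -[N PN]; exists (- N) => n nN; first by apply: PN; lia.
have -> : n = - (- n - 1) - 1 by lia.
by apply: PN; lia.
Qed.

Lemma jacobi_jac (P : V -> fser V V) :
  (forall n v, linear (fun u => P u n v)) -> (forall u, is_field (P u)) ->
  jacobi (Y 0) (Y alpha) P <->
  forall u w v, jacobi_at (Y 0) (Y alpha) P u w v.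
Proof.
move=> lP fP.
have b1 u w v : bounded (J1 (Y alpha) P u w v).
  have [N PN] := field_trunc (fP w) v; exists N => b c /PN; rewrite /J1 => ->.
  exact: lin0 (field_lin (vm_field (vY alpha) u) b).
have b2 u w v : bounded (J2 (Y 0) P u w v).
  have [N YN] := field_trunc (vm_field (vY 0) u) v; exists N => c b /YN.
  by rewrite /J2 => ->; exact: lin0 (field_lin (fP w) c).
have b3 u w v : bounded (J3 (Y alpha) P u w v).
  have [N YN] := field_trunc (vm_field (vY alpha) u) w; exists N => c a /YN.
  by rewrite /J3 => ->; exact: lin0 (lP c v).
have E1 u w v a b c := fmul3_delta12 (J1 (Y alpha) P u w v) a b c.
have E2 u w v a b c := fmul3_delta21 a b c (b2 u w v).
have E3 u w v a b c := fmul3_delta10 charF0 (J3 (Y alpha) P u w v) a b c.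
split=> [J u w v|J u w v [[a b] c]].
  split=> // a b c; have := J u w v (a, b, c).
  by rewrite -E1 -E2 -E3.
by have := jacE (J u w v) a b c; rewrite -E1 -E2 -E3.
Qed.

Theorem creative_intertwinerP (P : V -> fser V V) :
  (creative_intertwiner vac (Y 0) (Y alpha) P /\
   L_derivative (Y alpha) (conformal cre ann vac) P) <->
  (forall u n v, P u n v = intertwiner cre ann alpha Y u n v).
Proof.
split=> [[[lPl lPr cP tP jP] dP] u n v|E].
  have fP w : is_field (P w).
    by split=> [k|x]; [exact: lPr | apply/is_field_mode; exact: tP].
  apply: (intertwiner_unique charF0 fm vY Y_vac) => //.
  exact/jacobi_jac.
have -> : P = intertwiner cre ann alpha Y.
  apply/funext => u; apply/funext => n; apply/funext => v; exact: E.
have vP := intertwiner_vertex_map charF0 fm alpha vY.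
split; last exact: (intertwiner_translation charF0 fm alpha vY Y_vac).
split.
- exact: vm_lin vP.
- by move=> w; exact: field_lin (vm_field vP w).
- exact: (intertwiner_creative charF0 fm alpha vY Y_vac).
- by move=> w v; apply/is_field_mode; exact: field_trunc (vm_field vP w) v.
apply/jacobi_jac; [exact: vm_lin vP | exact: vm_field vP | ].
apply: (Y_jacobi charF0 fm vY Y_vac vP).
exact: (intertwiner_comm charF0 fm alpha vY Y_vac).
Qed.

End Characterization.

(** * Vertex operators of the Heisenberg algebra *)

Section IteratedNormalOrder.
Variables (F : fieldType) (I : eqType) (V : lmodType F) (a : I -> int -> V -> V).
Hypothesis charF0 : [pchar F] =i pred0.
Hypothesis ha : heis_action a.

Lemma fderivnE (W : lmodType F) m (A : fser V W) n v :
  fderivn m A n v = gbin F (n + m%:Z) m *: A (n + m%:Z) v.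
Proof.
have E : iter m (@fderiv F V W) A n v =
    (m`!%:R * gbin F (n + m%:Z) m) *: A (n + m%:Z) v.
  elim: m n => [|m IH] n; first by rewrite gbin0 fact0 mulr1 scale1r addr0.
  rewrite iterS /fderiv IH (_ : n + 1 + m%:Z = n + m.+1%:Z); last by lia.
  rewrite scalerA; congr (_ *: _).
  have := gbinS charF0 (n + m.+1%:Z) m.
  rewrite (_ : n + m.+1%:Z - m%:Z = n + 1) => [e|]; last by lia.
  by rewrite factS natrM mulrCA -e; ring.
by rewrite /fderivn E scalerA mulKf //; exact: factF_neq0.
Qed.

(** The m-th divided derivative of a^i(z) has no powers from z^(-m) to z^(-1); its
    other coefficients are binomial multiples of the modes, the negative powers
    carrying the sign (-1)^m. *)
Lemma fnormal_nord i m (B : fser V V) : is_field B ->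
  fnormal (fderivn m (fun n => a i (- n - 1))) B = nord a a i m B.
Proof.
move=> fB; apply/funext => n; apply/funext => v; rewrite /fnormal /nord.
congr (_ + _).
  rewrite /fmul (@fsum_nsum _ _ Posz).
  - apply: eq_nsum => k; rewrite le0z_nat fderivnE -PoszD gbin_nat // addnC.
    by congr (_ *: a _ _ _); lia.
  - by move=> x y [].
  - by case=> [k h|k _] //; case: (h k).
rewrite nsumZ; last exact: (nord_ev0r ha _ _ _ _ fB).
rewrite /fmul (@fsum_nsum _ _ (fun k : nat => n + (m + k).+1%:Z)).
- apply: eq_nsum => k; rewrite ifF; last by apply/negbTE; lia.
  rewrite fderivnE (linZ (field_lin fB _)) scalerA.
  rewrite (_ : n - _ + m%:Z = - k%:Z - 1); last by lia.
  rewrite gbin_opp // addrC -PoszD gbin_nat //; congr (_ *: B _ (a _ _ _)); lia.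
- by move=> x y; lia.
move=> k h; case: ifP => [_|nk]; first exact: lin0 (field_lin fB _).
rewrite fderivnE (_ : gbin F (n - k + m%:Z) m = 0).
  by rewrite scale0r (lin0 (field_lin fB _)).
have e : n - k + m%:Z = `|(n - k + m%:Z)%R|%N%:Z.
  have [//|neg] := lerP 0 (n - k + m%:Z); first by lia.
  exfalso; apply: (h (`|(n - k + m%:Z)%R|%N.-1)); lia.
by rewrite e gbin_nat // bin_small //; lia.
Qed.

Definition normal_seq (s : seq (I * nat)) : fser V V :=
  foldr (fun x B => fnormal (fderivn x.2 (fun n => a x.1 (- n - 1))) B) (@fone F V) s.

Lemma fone_field : is_field (@fone F V).
Proof.
split=> [n c u v|v]; first by rewrite /fone; case: eqP; rewrite ?scaler0 ?addr0.
by exists 0 => n n0; rewrite /fone ifF //; lia.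
Qed.

Lemma normal_seq_field s : is_field (normal_seq s).
Proof.
elim: s => [|x s IH] /=; first exact: fone_field.
by rewrite fnormal_nord //; exact: nord_field.
Qed.

Lemma normal_seq_cons i m s : normal_seq ((i, m) :: s) = nord a a i m (normal_seq s).
Proof. by rewrite /= fnormal_nord //; exact: normal_seq_field. Qed.

(** Needed because the variables of a monomial come listed in an unspecified order. *)
Lemma normal_seq_perm s t : perm_eq s t -> normal_seq s = normal_seq t.
Proof.
have cat1 x s1 s2 : normal_seq (s1 ++ x :: s2) = normal_seq (x :: s1 ++ s2).
  elim: s1 => [//|[j p] s1 IH]; case: x IH => i m IH.
  rewrite cat_cons normal_seq_cons IH !normal_seq_cons.
  by apply: nord_swap => //; exact: normal_seq_field.
elim: s t => [|[i m] s IH] t; first by rewrite perm_sym => /perm_nilP ->.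
move=> st; have xt : (i, m) \in t by rewrite -(perm_mem st) mem_head.
case/splitPr: xt st => t1 t2 st; rewrite cat1 !normal_seq_cons.
rewrite (IH (t1 ++ t2)) // -(perm_cons (i, m)) (perm_trans st) //.
by rewrite -cat_rcons -cats1 -catA perm_catCA.
Qed.

End IteratedNormalOrder.

Section HeisenbergVertexOperators.
Variables (F : fieldType) (l : nat).
Hypothesis charF0 : [pchar F] =i pred0.
Local Notation mon := {cmonom ('I_l * nat)%type}.
Local Notation cre := (@fock_creation F l).
Local Notation ann := (@fock_annihilation F l).
Local Notation vac := (@vacuum F l).
Local Notation Yseq beta := (normal_seq (@heis F l beta)).

Lemma count_mon_vars y (m : mon) : count_mem y (mon_vars l m) = m y.
Proof.
rewrite /mon_vars count_flatten -map_comp sumnE big_map.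
rewrite (eq_bigr (fun x => ((x == y) * m x)%N)) => [|x _]; last first.
  by rewrite /= count_nseq.
have [ym|ym] := boolP (y \in finsupp m); last first.
  rewrite big1_seq => [|x /andP[_ xm]].
    by apply/esym/eqP; rewrite -[_ == _]negbK cmE_neq0.
  by case: eqP => // xy; rewrite -xy xm in ym.
rewrite (bigD1_seq y) ?fset_uniq //= eqxx mul1n big1 ?addn0 // => x /negbTE ->.
by rewrite mul0n.
Qed.

Lemma mon_vars_mulvar x (m : mon) : perm_eq (mon_vars l (mulvar x m)) (x :: mon_vars l m).
Proof. by apply/allP => y _; rewrite /= !count_mon_vars mulvarE. Qed.

Lemma Yheis_lin beta n v : linear (fun u : fock F l => Yheis beta u n v).
Proof. exact: (linear_extension (fun m : mon => Yseq beta (mon_vars l m) n v)). Qed.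

Lemma Yheis_fmon beta (m : mon) n v : Yheis beta (fmon F m) n v = Yseq beta (mon_vars l m) n v.
Proof.
rewrite fmonE.
exact: (linear_extensionU (fun m : mon => Yseq beta (mon_vars l m) n v)).
Qed.

Lemma heis_heis_action beta : heis_action (@heis F l beta).
Proof. exact: (modes_heis_action (fock_fock_model F l) beta). Qed.

Lemma Yheis_field beta (u : fock F l) : is_field (Yheis beta u).
Proof.
apply: (is_field_sum (msupp u) (fun m => u@_m)
  (C := fun m : mon => Yseq beta (mon_vars l m))) => m.
exact: (normal_seq_field charF0 (heis_heis_action beta)).
Qed.

Lemma Yheis_creation beta i m (u : fock F l) n v :
  Yheis beta (cre i m u) n v = nord (@heis F l beta) (@heis F l beta) i m (Yheis beta u) n v.
Proof.
have hb := heis_heis_action beta.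
apply: (@fock_monomial_ext F l (fun u => Yheis beta (cre i m u) n v)
  (fun u => nord (@heis F l beta) (@heis F l beta) i m (Yheis beta u) n v)).
- move=> c u1 u2; rewrite fock_cre_lin; exact: Yheis_lin.
- move=> c u1 u2.
  have Ec : Yheis beta (c *: u1 + u2) =
      (fun n v => c *: Yheis beta u1 n v + Yheis beta u2 n v).
    by apply/funext => x; apply/funext => y; exact: Yheis_lin.
  rewrite Ec; exact: (nordDZ hb hb _ _ _ _ _ (Yheis_field beta u1) (Yheis_field beta u2)).
move=> k; rewrite creU Yheis_fmon (normal_seq_perm charF0 hb (mon_vars_mulvar _ _)).
rewrite (normal_seq_cons charF0 hb).
have -> // : Yheis beta (fmon F k) = Yseq beta (mon_vars l k).
by apply/funext => x; apply/funext => y; exact: Yheis_fmon.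
Qed.

Lemma Yheis_vertex_map beta :
  vertex_map (@heis F l 0) (@heis F l beta) (@heis F l beta) (Yheis beta).
Proof.
split; [exact: Yheis_lin | exact: Yheis_field | exact: Yheis_creation].
Qed.

Lemma Yheis_vacuum beta : Yheis beta vac = @fone F (fock F l).
Proof.
have -> : (vac : fock F l) = fmon F mone by rewrite fmonE.
apply/funext => n; apply/funext => v; rewrite Yheis_fmon.
suff /perm_nilP -> : perm_eq (mon_vars l mone) [::] by [].
by apply/allP => y _; rewrite /= count_mon_vars cm1.
Qed.

Theorem heis_creative_intertwinerP (alpha : 'rV[F]_l)
    (Yc : heis_mod alpha -> fser (heis_mod (0 : 'rV[F]_l)) (heis_mod alpha)) :
  (heis_creative_intertwiner alpha Yc /\ heis_L_derivative alpha Yc) <->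
  (forall u n v, Yc (expq alpha u) n v = heis_intertwiner alpha u n v).
Proof.
have E u n v : heis_intertwiner alpha u n v =
    intertwiner cre ann alpha Yheis u n v.
  exact: (fmul_intertwiner charF0 (fock_fock_model F l) alpha Yheis_vertex_map).
have M := creative_intertwinerP charF0 (fock_fock_model F l) Yheis_vertex_map
  Yheis_vacuum alpha Yc.
split=> [/M H u n v|H]; first by rewrite E; exact: H.
by apply/M => u n v; rewrite -E; exact: H.
Qed.

End HeisenbergVertexOperators.

Theorem theorem3p3 (R : realType) (l : nat) (hl : (1 <= l)%N)
    (alpha : 'rV[R[i]]_l)
    (Yc : heis_mod alpha ->
          fser (heis_mod (0 : 'rV[R[i]]_l)) (heis_mod alpha)) :
  (heis_creative_intertwiner alpha Yc /\ heis_L_derivative alpha Yc)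
  <->
  (forall (u : heis_mod (0 : 'rV[R[i]]_l)) (n : int)
          (v : heis_mod (0 : 'rV[R[i]]_l)),
     Yc (expq alpha u) n v = heis_intertwiner alpha u n v).
Proof. exact: heis_creative_intertwinerP (@pchar_num R[i]) alpha Yc. Qed.
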